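(* Let $M$ be the graphic matroid $M(G)$ or the cographic matroid $M(G)^*$ of a simple connected graph $G$. Then the following are equivalent: (a) $\mu(M)\le2$; (b) $M$ has no g-series minor isomorphic to $M(K_4)$; (c) $M$ has no minor isomorphic to $M(K_4)$ obtained by a sequence of deletions, series contractions or coloop contractions; (a$'$) $M$ has no minor isomorphic to $M(K_4)$.
   Context: Throughout, matroids are finite and non-free (they have at least one circuit). $\mathbb{K}$ is a field. $M(G)$ is the cycle matroid of $G$ and $M(G)^*$ its dual; $K_4$ is the complete graph on $4$ vertices. A cycle of $M$ is a disjoint union of (possibly zero) circuits; the cycle ideal $I_{\mathrm{Cyc}(M)}$ is the kernel of $\mathbb{K}[x_C:C\text{ cycle}]\to\mathbb{K}[y_e,z:e\in E(M)]$, $x_C\mapsto\prod_{e\in C}y_e\cdot z$; $\mu(M)$ is the highest degree of an element of a minimal homogeneous generating set of $I_{\mathrm{Cyc}(M)}$ (with $\deg0=-\infty$). Series contraction: $M/e$ with $e$ in a $2$-element cocircuit; coloop contraction: $M/e$ with $e$ a coloop. Binary matroidal retract: for binary $M$ and disjoint $E=\{e_1,\dots,e_s\}$, $E'=\{e'_1,\dots,e'_s\}\subseteq E(M)$, $s\ge1$, such that $E'$ is a circuit of $M$ and for every circuit $C$, every $p\in\{0,\dots,s-1\}$ and indices $i_1,\dots,i_p$: $C\cap E'=\{e'_{i_1},\dots,e'_{i_p}\}$ iff $C\cap E$ equals $\{e_{i_1},\dots,e_{i_p}\}$ or $E-\{e_{i_1},\dots,e_{i_p}\}$; then $M/E'$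 is a binary matroidal retract. A g-series minor is obtained by a sequence of deletions, series contractions, coloop contractions and binary matroidal retracts. *)

(* Defs.v *)
From Stdlib Require Import Relation_Operators.
From mathcomp Require Import all_boot all_order all_algebra.
From mathcomp Require Import mpoly.

Set Implicit Arguments.
Unset Strict Implicit.
Unset Printing Implicit Defensive.

Import GRing.Theory.

Local Open Scope ring_scope.

(* The ground set is a subset of an ambient finite type, so that a minor of a
   matroid lives over the same ambient type. *)
Record matroid (T : finType) := Matroid {
  ground : {set T};
  indep : {set {set T}};
  indep_ground : forall I, I \in indep -> I \subset ground;
  indep0 : set0 \in indep;
  indepS : forall I J : {set T}, I \subset J -> J \in indep -> I \in indep;
  indep_aug : forall I J, I \in indep -> J \in indep -> (#|I| < #|J|)%N ->
    exists2 x, x \in J :\: I & x |: I \in indep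
}.

Section MatroidTheory.
Variables (T : finType) (M : matroid T).
Implicit Types (A B C I J : {set T}).

Definition bases : {set {set T}} := [set B | maxset (mem (indep M)) B].

Definition circuits : {set {set T}} :=
  [set C | minset (fun D => (D \subset ground M) && (D \notin indep M)) C].

Definition nonfree := exists C, C \in circuits.

Lemma basis_indep B : B \in bases -> B \in indep M.
Proof. by rewrite inE => /maxsetp. Qed.

Lemma indep_basis I : I \in indep M -> exists2 B, B \in bases & I \subset B.
Proof.
by move=> iI; have [B mB sIB] := maxset_exists (P := mem (indep M)) iI;
  exists B; rewrite ?inE.
Qed.

Lemma leq_basis I B : I \in indep M -> B \in bases -> (#|I| <= #|B|)%N.
Proof.
move=> iI; rewrite inE => /maxsetP[iB maxB]; rewrite leqNgt; apply/negP=> ltBI.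
have [x xI ixB] := indep_aug iB iI ltBI.
have := maxB _ ixB (subsetUr _ _) => eB.
by move: xI; rewrite -eB !inE eqxx.
Qed.

Lemma card_basis B I : B \in bases -> I \in indep M -> #|I| = #|B| -> I \in bases.
Proof.
move=> bB iI eqc; rewrite inE; apply/maxsetP; split=> // J iJ sIJ.
by apply/esym/eqP; rewrite eqEcard sIJ eqc leq_basis.
Qed.

Lemma indep_ext (A B I : {set T}) : B \in bases -> B \subset A ->
  I \in indep M -> I \subset A ->
  exists2 B', B' \in bases & I \subset B' /\ B' \subset A.
Proof.
move=> bB sBA iI sIA.
pose P := [pred J : {set T} | (J \in indep M) && (J \subset A)].
have PI : P I by rewrite /= iI.
have [J /maxsetP[/andP[iJ sJA] maxJ] sIJ] := maxset_exists PI.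
exists J => //; apply: (card_basis bB) => //.
apply/eqP; rewrite eqn_leq leq_basis // leqNgt; apply/negP=> ltJB.
have [x /setDP[xB xJ] ixJ] := indep_aug iJ (basis_indep bB) ltJB.
have eJ : x |: J = J.
  apply: maxJ; rewrite ?subsetUr //= ixJ subUset sJA andbT sub1set.
  exact: subsetP xB.
by rewrite -eJ !inE eqxx in xJ.
Qed.

Definition dual_indep : {set {set T}} :=
  [set I : {set T} |
     (I \subset ground M) && [exists B in bases, [disjoint I & B]]].

Lemma dual_indep_ground (I : {set T}) : I \in dual_indep -> I \subset ground M.
Proof. by rewrite inE => /andP[]. Qed.

Lemma dual_indep0 : set0 \in dual_indep.
Proof.
have [B bB _] := indep_basis (indep0 M).
rewrite inE sub0set; apply/existsP; exists B; rewrite bB.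
by rewrite disjoints_subset sub0set.
Qed.

Lemma dual_indepS (I J : {set T}) :
  I \subset J -> J \in dual_indep -> I \in dual_indep.
Proof.
rewrite !inE => sIJ /andP[sJ /existsP[B /andP[bB dJB]]].
rewrite (subset_trans sIJ sJ); apply/existsP; exists B; rewrite bB.
exact: disjointWl dJB.
Qed.

Lemma dual_indep_aug (I J : {set T}) : I \in dual_indep -> J \in dual_indep ->
  (#|I| < #|J|)%N -> exists2 x, x \in J :\: I & x |: I \in dual_indep.
Proof.
rewrite !inE => /andP[sI /existsP[BI /andP[bBI dI]]].
move=> /andP[sJ /existsP[BJ /andP[bBJ dJ]]] ltIJ.
have iB : BJ :\: I \in indep M by apply: indepS (subsetDl _ _) (basis_indep bBJ).
have sBI : BI \subset ~: I by rewrite -disjoints_subset disjoint_sym.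
have sDI : BJ :\: I \subset ~: I by rewrite setDE subsetIr.
have [B bB [sDB sB]] := indep_ext bBI sBI iB sDI.
case: (boolP (J :\: I \subset B)) => [sJB|/subsetPn[x xJ xB]]; last first.
  exists x; first exact: xJ.
  rewrite inE subUset sub1set sI andbT; case/setDP: (xJ) => xJ' xI.
  rewrite (subsetP sJ) //=; apply/existsP; exists B; rewrite bB /=.
  rewrite disjoints_subset subUset sub1set inE xB /=.
  by rewrite -disjoints_subset disjoint_sym disjoints_subset.
have dd : (J :\: I) :&: (BJ :\: I) = set0.
  apply/setP=> x; rewrite !inE; apply/negbTE/negP.
  case/andP=> /andP[_ xJ] /andP[_ xB].
  by move/disjointFr: dJ => /(_ x xJ); rewrite xB.
have leU : (#|J :\: I| + #|BJ :\: I| <= #|B|)%N.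
  rewrite -cardsUI dd cards0 addn0; apply: subset_leq_card.
  by rewrite subUset sJB.
have leBI : (#|BJ :&: I| <= #|I :\: J|)%N.
  apply: subset_leq_card; apply/subsetP=> x; rewrite !inE => /andP[xB xI].
  by rewrite xI andbT; apply/negP=> xJ; move/disjointFr: dJ => /(_ x xJ); rewrite xB.
have eqB : #|B| = #|BJ|.
  by apply/eqP; rewrite eqn_leq !leq_basis // basis_indep.
have := cardsID I BJ; have := cardsID J I; have := cardsID I J.
rewrite (setIC J I) => e1 e2 e3; exfalso.
move: leU; rewrite eqB -e3 leq_add2r leqNgt => /negP; apply.
by apply: leq_ltn_trans leBI _; rewrite -(ltn_add2l #|I :&: J|) e2 e1.
Qed.

Definition dual : matroid T :=
  Matroid dual_indep_ground dual_indep0 dual_indepS dual_indep_aug.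

Variable X : {set T}.

Definition deletion_indep : {set {set T}} :=
  [set I : {set T} in indep M | [disjoint I & X]].

Lemma deletion_indep_ground (I : {set T}) : I \in deletion_indep -> I \subset ground M :\: X.
Proof. by rewrite inE subsetD => /andP[/indep_ground-> ->]. Qed.

Lemma deletion_indep0 : set0 \in deletion_indep.
Proof. by rewrite inE indep0 disjoints_subset sub0set. Qed.

Lemma deletion_indepS (I J : {set T}) :
  I \subset J -> J \in deletion_indep -> I \in deletion_indep.
Proof.
by rewrite !inE => sIJ /andP[/(indepS sIJ)-> dJ]; apply: disjointWl dJ.
Qed.

Lemma deletion_indep_aug (I J : {set T}) : I \in deletion_indep -> J \in deletion_indep ->
  (#|I| < #|J|)%N -> exists2 x, x \in J :\: I & x |: I \in deletion_indep.
Proof.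
rewrite !inE => /andP[iI dI] /andP[iJ dJ] ltIJ.
have [x xJ ix] := indep_aug iI iJ ltIJ; exists x => //; rewrite inE ix /=.
rewrite disjoints_subset subUset -[I \subset _]disjoints_subset dI andbT sub1set.
by case/setDP: xJ => xJ _; rewrite inE (disjointFr dJ xJ).
Qed.

Definition deletion : matroid T :=
  Matroid deletion_indep_ground deletion_indep0 deletion_indepS
    deletion_indep_aug.

End MatroidTheory.

Definition contraction (T : finType) (M : matroid T) (X : {set T}) : matroid T :=
  dual (deletion (dual M) X).

Definition cocircuits (T : finType) (M : matroid T) := circuits (dual M).

Definition coloop (T : finType) (M : matroid T) (e : T) :=
  [set e] \in cocircuits M.

Definition isomorphic (T T' : finType) (M : matroid T) (N : matroid T') :=
  exists f : T -> T',
    [/\ {in ground M &, injective f},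
        f @: ground M = ground N
      & forall I : {set T}, I \subset ground M ->
          (I \in indep M) = (f @: I \in indep N)].

Definition binary (T : finType) (M : matroid T) :=
  exists n (f : T -> 'rV['F_2]_n), forall I : {set T}, I \subset ground M ->
    (I \in indep M) = free [seq f x | x in I].

Section Minors.
Variables (T : finType).
Implicit Types M N : matroid T.

Definition deletion_step M N :=
  exists2 e, e \in ground M & N = deletion M [set e].

Definition contraction_step M N :=
  exists2 e, e \in ground M & N = contraction M [set e].

Definition series_contraction_step M N :=
  exists2 e, (exists2 D, D \in cocircuits M & e \in D /\ #|D| = 2%N)
    & N = contraction M [set e].

Definition coloop_contraction_step M N :=
  exists2 e, coloop M e & N = contraction M [set e].

(* The set I of positions stands for {i_1, ..., i_p}, with p <= s - 1.
   The equivalence is required for all circuits and all such I, without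
   exception; note that the instance C = E', I = set0 can then never hold. *)
Definition retract_condition M (s : nat) (e e' : 'I_s -> T) :=
  let E := e @: setT in let E' := e' @: setT in
  [/\ injective e /\ injective e',
      E \subset ground M /\ E' \subset ground M,
      [disjoint E & E'],
      E' \in circuits M
    & forall (C : {set T}) (I : {set 'I_s}), C \in circuits M -> (#|I| < s)%N ->
        C :&: E' = e' @: I <-> C :&: E = e @: I \/ C :&: E = E :\: e @: I].

Definition binary_matroidal_retract_step M N :=
  exists s (e e' : 'I_s -> T),
    [/\ (0 < s)%N, binary M, retract_condition M e e'
      & N = contraction M (e' @: setT)].

Definition minor_step M N := deletion_step M N \/ contraction_step M N.

Definition series_minor_step M N :=
  [\/ deletion_step M N, series_contraction_step M N
    | coloop_contraction_step M N].

Definition g_series_minor_step M N :=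
  series_minor_step M N \/ binary_matroidal_retract_step M N.

Definition minor := clos_refl_trans (matroid T) minor_step.
Definition series_minor := clos_refl_trans (matroid T) series_minor_step.
Definition g_series_minor := clos_refl_trans (matroid T) g_series_minor_step.

End Minors.

Record sgraph := SGraph {
  vertex :> finType;
  adj : rel vertex;
  adj_sym : ssrbool.symmetric adj;
  adj_irrefl : irreflexive adj
}.

Definition connected (G : sgraph) :=
  (0 < #|G|)%N /\ forall x y : G, connect (@adj G) x y.

Section CycleMatroid.
Variable G : sgraph.
Implicit Types (x y z : G) (e : {set G}) (F I J : {set {set G}}) (p : seq G).

Definition edges : {set {set G}} :=
  [set e | [exists x, exists y, adj x y && (e == [set x; y])]].

Definition cycle_edges p : {set {set G}} := [set [set x; next p x] | x in p].

(* Edge sets of the cycles of G; the bound on the length only serves to make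
   the quantifier finite, as the vertices are pairwise distinct. *)
Definition polygons : {set {set {set G}}} :=
  [set C | [exists n : 'I_#|G|.+1, exists p : n.-tuple G,
     [&& (2 < n)%N, cycle (@adj G) p, uniq p & C == cycle_edges p]]].

Definition forests : {set {set {set G}}} :=
  [set F : {set {set G}} |
     (F \subset edges) && [forall C in polygons, ~~ (C \subset F)]].

Lemma polygonP C : reflect
  (exists p, [/\ (2 < size p)%N, cycle (@adj G) p, uniq p & C = cycle_edges p])
  (C \in polygons).
Proof.
rewrite inE; apply: (iffP idP) => [/existsP[n /existsP[p]]|[p [sp cp up ->]]].
  by case/and4P=> n2 cp up /eqP->; exists p; rewrite size_tuple.
have ltp : (size p < #|G|.+1)%N by rewrite ltnS -(card_uniqP up) max_card.
apply/existsP; exists (Ordinal ltp); apply/existsP; exists (in_tuple p).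
by apply/and4P; split.
Qed.

Lemma adj_edge x y : [set x; y] \in edges -> adj x y.
Proof.
rewrite inE => /existsP[a /existsP[b /andP[ab /eqP eq_xy]]].
have neq_ab : a != b by apply: contraTneq ab => ->; rewrite adj_irrefl.
have : x \in [set a; b] by rewrite -eq_xy !inE eqxx.
have : y \in [set a; b] by rewrite -eq_xy !inE eqxx orbT.
have : a \in [set x; y] by rewrite eq_xy !inE eqxx.
have : b \in [set x; y] by rewrite eq_xy !inE eqxx orbT.
rewrite !inE => bxy axy /orP[]/eqP ey /orP[]/eqP ex; subst x y => //.
- by move: bxy; rewrite orbb eq_sym (negbTE neq_ab).
- by rewrite adj_sym.
- by move: axy; rewrite orbb (negbTE neq_ab).
Qed.

(* Linear algebra over F_2, used only to prove the augmentation axiom for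
   forests. *)
Definition incidence e : {ffun G -> ('F_2)^o} := [ffun v => (v \in e)%:R].

Definition cut_span F : {vspace {ffun G -> ('F_2)^o}} :=
  (\sum_(e in F) <[incidence e]>)%VS.

Definition edge_rel F : rel G := fun x y => [set x; y] \in F.

Lemma mem_cut_span F e : e \in F -> incidence e \in cut_span F.
Proof.
by move=> eF; rewrite memvE /cut_span (bigD1 e) //= addvSl.
Qed.

Lemma incidence2 x y : x != y ->
  incidence [set x; y] = incidence [set x] + incidence [set y].
Proof.
move=> neq; apply/ffunP=> v; rewrite !ffunE !inE.
by case: eqP => [->|_]; rewrite ?(negbTE neq) ?addr0 ?add0r.
Qed.

Lemma next_next p z : uniq p -> (2 < size p)%N -> z \in p ->
  next p z != z /\ next p (next p z) != z.
Proof.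
move=> up sp zp; have [i q eqp] := rot_to zp.
rewrite -(next_rot i up) -(next_rot i up) -(size_rot i) in sp *.
have uq : uniq (z :: q) by rewrite -eqp rot_uniq.
rewrite eqp in sp *; case: q => [|y [|w r]] // in uq sp eqp *.
move: uq => /=; rewrite !inE !negb_or -!andbA.
case/and5P=> zy zw zr yw _; rewrite !eqxx [y == z]eq_sym (negbTE zy) /=.
by rewrite ?eqxx [w == z]eq_sym.
Qed.

Lemma sum_cycle p : uniq p -> (2 < size p)%N ->
  \sum_(z <- p) incidence [set z; next p z] = 0.
Proof.
move=> up sp.
have -> : \sum_(z <- p) incidence [set z; next p z] =
    \sum_(z <- p) (incidence [set z] + incidence [set next p z]).
  rewrite big_seq [RHS]big_seq; apply: eq_bigr => z zp; apply: incidence2.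
  by rewrite eq_sym; have [] := next_next up sp zp.
rewrite big_split /=.
have -> : \sum_(z <- p) incidence [set next p z] = \sum_(z <- p) incidence [set z].
  rewrite -(big_map (next p) xpredT (fun z => incidence [set z])).
  apply: perm_big; apply: uniq_perm => //.
    by rewrite map_inj_in_uniq // => a b _ _; apply: (can_inj (prev_next up)).
  apply/subset_eqP/andP.
  have sub : {subset map (next p) p <= p}.
    by move=> _ /mapP[z zp ->]; rewrite mem_next.
  split; apply/subsetP => // a ap; apply/mapP; exists (prev p a).
    by rewrite mem_prev.
  by rewrite next_prev.
apply/ffunP=> v; rewrite ffunE [RHS]ffunE; set s := (X in X + X).
by rewrite -mulr2n; case: s => -[|[|]] //= ?; apply/val_inj.
Qed.

Lemma forest_dep F e : F \in forests -> e \in edges -> e \notin F ->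
  e |: F \notin forests -> incidence e \in cut_span F.
Proof.
rewrite inE => /andP[sF /forallP acF] eE eF.
rewrite [_ \in forests]inE subUset sub1set eE sF /=.
case/forallPn=> C; rewrite negb_imply negbK => /andP[pC sC].
have neC : ~~ (C \subset F) by have := acF C; rewrite pC.
have eC : e \in C.
  apply: contraR neC => eC; apply/subsetP=> f fC.
  by have := subsetP sC f fC; rewrite !inE; case: eqP fC => // ->; rewrite (negbTE eC).
case/polygonP: pC => p [sp _ up eqC].
move: eC; rewrite eqC => /imsetP[z zp eqe].
have := sum_cycle up sp; rewrite (big_rem z) //= -eqe => /eqP.
rewrite addr_eq0 => /eqP->; rewrite memvN big_seq; apply: memv_suml => w.
rewrite mem_rem_uniq // inE => /andP[wz wp]; apply: mem_cut_span.
have : [set w; next p w] \in C by rewrite eqC; apply: imset_f.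
move/(subsetP sC); rewrite !inE => /predU1P[] //; rewrite eqe => eqzw.
have [_ nn] := next_next up sp zp.
have : w \in [set z; next p z] by rewrite -eqzw !inE eqxx.
have : z \in [set w; next p w] by rewrite eqzw !inE eqxx.
rewrite !inE (negbTE wz) eq_sym (negbTE wz) /= => /eqP ez /eqP ew.
by rewrite -ew -ez eqxx in nn.
Qed.

Lemma forest_connect F x y : [set x; y] |: F \in forests ->
  [set x; y] \notin F -> ~~ connect (edge_rel F) x y.
Proof.
rewrite inE => /andP[sF /forallP acF] xyF; apply/negP => /connectP[q].
case/shortenP=> p pth up _ ey.
have sub : subrel (edge_rel F) (@adj G).
  by rewrite /edge_rel => a b ab; apply/adj_edge/(subsetP sF); rewrite !inE ab orbT.
have xyadj : adj x y by apply/adj_edge/(subsetP sF); rewrite !inE eqxx.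
have := acF (cycle_edges (x :: p)); rewrite implybE => /orP[/polygonP[]|/negP[]].
  exists (x :: p); split => //.
    case: p => [|w [|]] //= in pth up ey *.
      by rewrite ey adj_irrefl in xyadj.
    by move: xyF; rewrite ey; case/andP: pth; rewrite /edge_rel => ->.
  by rewrite /= rcons_path (sub_path sub) //= -ey adj_sym.
apply/subsetP=> _ /imsetP[z zp ->].
have cyc : cycle [rel a b | [set a; b] \in [set x; y] |: F] (x :: p).
  rewrite /= rcons_path -ey /= [X in _ && (X \in _)]setUC setU11 andbT.
  by apply: sub_path pth => a b; rewrite /edge_rel /= => ab; rewrite !inE ab ?orbT.
exact: (next_cycle cyc zp).
Qed.

Lemma cut_span_connect F x y : ~~ connect (edge_rel F) x y ->
  F \subset edges -> incidence [set x; y] \notin cut_span F.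
Proof.
move=> nxy sF; apply/negP=> /memv_sumP[u uP eu].
pose K := [set z | connect (edge_rel F) x z].
have sum0 e : e \in F -> \sum_(v in K) u e v = 0.
  move=> eF; have /vlineP[k ->] := uP e eF.
  under eq_bigr do rewrite ffunE.
  rewrite -scaler_sumr; suff -> : \sum_(v in K) incidence e v = 0 by rewrite scaler0.
  move: (subsetP sF e eF); rewrite inE => /existsP[a /existsP[b /andP[ab /eqP ee]]].
  have neq : a != b by apply: contraTneq ab => ->; rewrite adj_irrefl.
  have symF : connect_sym (edge_rel F).
    by apply: sym_connect_sym => c d; rewrite /edge_rel setUC.
  have abK : (a \in K) = (b \in K).
    rewrite !inE; apply/idP/idP => h; apply: connect_trans h _; last rewrite symF.
      by apply: connect1; rewrite /edge_rel ?(setUC [set b]) -ee.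
    by apply: connect1; rewrite /edge_rel ?(setUC [set b]) -ee.
  have sum1 c : \sum_(v in K) incidence [set c] v = (c \in K)%:R.
    case: (boolP (c \in K)) => cK.
      rewrite (bigD1 c) //= big1 => [|v /andP[_ vc]]; rewrite !ffunE !inE ?eqxx ?addr0 //.
      by rewrite (negbTE vc).
    rewrite big1 // => v vK; rewrite ffunE inE.
    by case: eqP vK cK => [-> ->|].
  rewrite ee incidence2 //; under eq_bigr do rewrite ffunE.
  rewrite big_split /= !sum1 abK; case: (b \in K); last by rewrite addr0.
  by apply/val_inj.
have : \sum_(v in K) incidence [set x; y] v = 0.
  rewrite eu; under eq_bigr do rewrite sum_ffunE.
  by rewrite exchange_big big1.
have xK : x \in K by rewrite inE connect0.
rewrite (bigD1 x) //= big1 => [|v /andP[vK vx]]; last first.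
  rewrite ffunE !inE (negbTE vx) /=.
  case: eqP vK => [->|//]; rewrite inE => h.
  by rewrite h in nxy.
by rewrite ffunE !inE eqxx addr0 => /eqP; rewrite oner_eq0.
Qed.

Lemma forest_ground F : F \in forests -> F \subset edges.
Proof. by rewrite inE => /andP[]. Qed.

Lemma forest0 : set0 \in forests.
Proof.
rewrite inE sub0set; apply/forallP=> C; apply/implyP=> /polygonP[[|x p] [] // _ _ _ ->].
by apply/subsetPn; exists [set x; next (x :: p) x];
  rewrite ?inE //; apply: imset_f; rewrite inE eqxx.
Qed.

Lemma forestS I J : I \subset J -> J \in forests -> I \in forests.
Proof.
rewrite !inE => sIJ /andP[sJ /forallP acJ]; rewrite (subset_trans sIJ sJ) /=.
apply/forallP=> C; apply/implyP=> pC.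
by apply: contra (implyP (acJ C) pC) => /subset_trans; apply.
Qed.

Lemma dim_cut_span F : F \in forests -> \dim (cut_span F) = #|F|.
Proof.
elim: {F}#|F| {-2}F (leqnn #|F|) => [|n IHn] F.
  rewrite leqn0 cards_eq0 => /eqP-> _.
  by rewrite /cut_span big_set0 dimv0 cards0.
case: (set_0Vmem F) => [->|[e eF]] leF forF.
  by rewrite /cut_span big_set0 dimv0 cards0.
set F' := F :\ e; have eqF : e |: F' = F by rewrite setD1K.
have neF : e \notin F' by rewrite !inE eqxx.
have forF' : F' \in forests by apply: forestS forF; rewrite subsetDl.
have eqc : #|F| = #|F'|.+1 by rewrite (cardsD1 e) eF.
rewrite eqc -IHn //; last by rewrite -ltnS -eqc.
have eE := subsetP (forest_ground forF) e eF.
move: (eE); rewrite inE => /existsP[x /existsP[y /andP[xy /eqP ee]]].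
have nin : incidence e \notin cut_span F'.
  rewrite ee; apply: cut_span_connect (forest_ground forF').
  by apply: forest_connect; rewrite -ee ?eqF.
have -> : cut_span F = (<[incidence e]> + cut_span F')%VS.
  by rewrite -eqF /cut_span big_setU1.
rewrite dimv_disjoint_sum ?dim_vline.
  by case: eqP nin => // -> /negP[]; apply: mem0v.
apply/eqP; rewrite -subv0; apply/subvP=> v; rewrite memv_cap => /andP[/vlineP[k ->]].
have [->|k0] := eqVneq k 0; first by rewrite scale0r !mem0v.
move=> kv; case/negP: nin; rewrite -[incidence e]scale1r -(mulVf k0) -scalerA.
exact: memvZ.
Qed.

Lemma forest_aug I J : I \in forests -> J \in forests -> (#|I| < #|J|)%N ->
  exists2 e, e \in J :\: I & e |: I \in forests.
Proof.
move=> fI fJ ltIJ.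
case: (boolP [exists e in J :\: I, e |: I \in forests]) => [/existsP[e]|].
  by case/andP; exists e.
move/existsPn=> noaug; exfalso; move: ltIJ.
rewrite ltnNge -(dim_cut_span fI) -(dim_cut_span fJ) dimvS //.
apply/subv_sumP=> e eJ; rewrite -memvE; case: (boolP (e \in I)) => eI.
  exact: mem_cut_span.
apply: forest_dep => //; first exact: (subsetP (forest_ground fJ)).
by have := noaug e; rewrite inE eI eJ.
Qed.

Definition cycle_matroid : matroid {set G} :=
  Matroid forest_ground forest0 forestS forest_aug.

End CycleMatroid.

Definition complete_graph (n : nat) : sgraph.
Proof.
refine (@SGraph 'I_n (fun x y => x != y) _ _).
- by move=> x y; rewrite eq_sym.
- by move=> x; rewrite eqxx.
Defined.

Definition MK4 : matroid {set 'I_4} := cycle_matroid (complete_graph 4).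

Section CycleIdeal.
Variables (K : fieldType) (T : finType) (M : matroid T).

Definition cycles : {set {set T}} :=
  [set C | [exists P : {set {set T}},
     [&& P \subset circuits M, trivIset P & C == cover P]]].

(* K[x_C : C a cycle], the i-th variable being x_C for C = enum_val i. *)
Definition cycle_ring := {mpoly K[#|cycles|]}.

(* K[y_e, z : e in ground M]: z is the variable of index 0 and y_e, for
   e = enum_val i, is the variable of index i + 1. *)
Definition edge_ring := {mpoly K[#|ground M|.+1]}.

Definition cycle_monomial (C : {set T}) : edge_ring :=
  (\prod_(i < #|ground M| | enum_val i \in C) 'X_(lift ord0 i)) * 'X_ord0.

Definition cycle_map (p : cycle_ring) : edge_ring :=
  p \mPo [tuple cycle_monomial (enum_val i) | i < #|cycles|].

Definition cycle_ideal : pred cycle_ring := fun p => cycle_map p == 0.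

Definition generated_by (s : seq cycle_ring) (p : cycle_ring) :=
  exists c : cycle_ring -> cycle_ring, p = \sum_(q <- s) c q * q.

Definition generates (s : seq cycle_ring) :=
  forall p, p \in cycle_ideal <-> generated_by s p.

(* Generating sets are finite: the ring is noetherian, so that a minimal
   generating set of an ideal is. *)
Definition minimal_homogeneous_generators (s : seq cycle_ring) :=
  [/\ uniq s,
      {in s, forall p, exists d : nat, p \is d.-homog},
      generates s
    & forall t : seq cycle_ring, {subset t <= s} -> generates t ->
        {subset s <= t}].

(* mu_size k means mu(M) = k - 1, where k = 0 stands for mu(M) = -oo; this is
   the convention of msize, which maps 0 to 0 and p <> 0 to deg p + 1.  The
   value does not depend on the choice of s. *)
Definition mu_size (k : nat) :=
  exists2 s, minimal_homogeneous_generators s & k = (\max_(p <- s) msize p)%N.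

Definition mu_le (d : nat) := exists2 k, mu_size k & (k <= d.+1)%N.

End CycleIdeal.

(* Main.v *)
(* A binary matroid M is determined by its cycle space W, a subspace of the
   F_2-space of subsets of the ground set, on which deletion, contraction and
   duality act explicitly.

   (c) => (a'): M(G) and its dual are represented over the rationals by integral
   flows and coboundaries. Let M(K4) arise from M by deletions and the contraction
   of X, with X minimal. Membership of x in X in a cycle is one of the eight linear
   functionals on the cycle space of K4: it is zero (x is a coloop), or one of the
   six edges (x is in series with it), or the remaining one; the last case yields
   the minor F7*, which is not representable over the rationals.

   (a) => (b): let T_0, ..., T_3 be the triangles of K4. The products of the x_C
   over the cycles T_0 + T_i and over the cycles T_i have the same image, but since
   K4 has no two disjoint circuits no quadratic relation involves two factors of
   the first product. For M, lift these cycles along deletions and series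
   contractions.

   (a') => (a): a simple graph with n >= 2 vertices and at least 2n - 2 edges has a
   K4 minor. The binary version of this fact applies to M or to its dual, so that a
   binary matroid without M(K4) minor has a loop, a coloop, a series pair or a
   parallel pair. By induction, two tuples of cycles with equal column sums are
   connected by exchanging a cycle D contained in C + C' between two members C and
   C', which means that quadrics generate the ideal. For a parallel pair {e, f},
   let k be the number of members containing exactly one of e and f. Tuples with
   the same k are connected because M \ f is quadratic, and a path for M / {e, f}
   between tuples with different values of k crosses from k to k + 2. *)

Require Import Defs.
From HB Require Import structures.
From Stdlib Require Import Relation_Operators Classical_Prop.
From mathcomp Require Import all_boot all_order all_algebra.
From mathcomp Require Import mpoly zify ring.

Set Implicit Arguments.
Unset Strict Implicit.
Unset Printing Implicit Defensive.

Import GRing.Theory Num.Theory.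

Local Open Scope ring_scope.

(** * Binary vector spaces of subsets *)

(** The induction for (a') => (a) leaves graphs behind: it needs deletion, contraction and duality
    at once, and spaces of subsets are closed under all three. Graphs return only through
    regularity, which turns an arbitrary M(K4) minor into one made of deletions, series contractions
    and coloop contractions. The same passage serves (a) => (b): a g-series minor is a minor, and
    minimality of X makes lifts of cycles unique and linear, while series elements copy the column
    sums of K4. The F7* case fails because a combination of four integral vectors takes a value 2 or
    -2 that is invisible modulo 2.

    For a parallel pair {e, f} the column sums fix the parity of k but not k, and every move of M \
    f preserves k. A move touches two members only, so it changes k by -2, 0 or 2; hence the first
    passage of a path beyond its starting value begins exactly at that value and raises it by 2.
    What remains is to lift this single move from M / {e, f} to M. *)

Section SymmetricDifference.
Variable T : finType.
Implicit Types A B C : {set T}.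

Definition symd A B := (A :\: B) :|: (B :\: A).

Lemma in_symd x A B : (x \in symd A B) = (x \in A) (+) (x \in B).
Proof. by rewrite !inE; case: (x \in A); case: (x \in B). Qed.

Fact symdA : associative symd.
Proof. by move=> A B C; apply/setP=> x; rewrite !in_symd addbA. Qed.

Fact symdC : commutative symd.
Proof. by move=> A B; apply/setP=> x; rewrite !in_symd addbC. Qed.

Fact sym0d : left_id set0 symd.
Proof. by move=> A; apply/setP=> x; rewrite in_symd inE. Qed.

Fact symdd : left_inverse set0 id symd.
Proof. by move=> A; apply/setP=> x; rewrite in_symd inE addbb. Qed.

HB.instance Definition _ := GRing.isZmodule.Build {set T} symdA symdC sym0d symdd.

Lemma set0E : (0 : {set T}) = set0. Proof. by []. Qed.

Lemma in_add x A B : (x \in A + B) = (x \in A) (+) (x \in B).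
Proof. exact: in_symd. Qed.

Lemma in_zero x : (x \in (0 : {set T})) = false.
Proof. exact: in_set0. Qed.

Lemma addSS A : A + A = 0. Proof. exact: (addNr A). Qed.

Lemma addSK A B : A + B + B = A. Proof. by rewrite -addrA addSS addr0. Qed.

Lemma addKS A B : A + (A + B) = B. Proof. by rewrite addrA addSS add0r. Qed.

Lemma addS_eq0 A B : (A + B == 0) = (A == B).
Proof. exact: (subr_eq0 A B). Qed.

Lemma in_sum (I : Type) (r : seq I) (P : pred I) (F : I -> {set T}) x :
  (x \in \sum_(i <- r | P i) F i) = \sum_(i <- r | P i) (x \in F i) :> bool.
Proof.
by apply: (big_morph (fun A : {set T} => x \in A)) => [A B|]; rewrite ?in_add ?in_zero.
Qed.

Lemma sum_set1 A : \sum_(x in A) [set x] = A.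
Proof.
apply/setP=> y; rewrite in_sum; case: (boolP (y \in A)) => yA.
  rewrite (bigD1 y) //= inE eqxx big1 // => x /andP[_ ne].
  by rewrite inE eq_sym (negbTE ne).
rewrite big1 // => x xA; rewrite inE; apply/negbTE.
by apply: contraNneq yA => ->.
Qed.

Lemma add_disjoint A B : [disjoint A & B] -> A + B = A :|: B.
Proof.
move=> dAB; apply/setP=> x; rewrite in_add inE.
by case: (boolP (x \in A)) => // /(disjointFr dAB)->.
Qed.

Lemma add_subset A B : A \subset B -> A + B = B :\: A.
Proof.
move=> sAB; apply/setP=> x; rewrite in_add inE.
by case: (boolP (x \in A)) => [/(subsetP sAB)->|] //=; case: (x \in B).
Qed.

Lemma subset_add A B C : A \subset C -> B \subset C -> A + B \subset C.
Proof.
move=> sA sB; apply/subsetP=> x; rewrite in_add.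
by case: (boolP (x \in A)) => [/(subsetP sA)//|_ /(subsetP sB)].
Qed.

Lemma subset_sum (I : Type) (r : seq I) (P : pred I) (F : I -> {set T}) C :
  (forall i, P i -> F i \subset C) -> \sum_(i <- r | P i) F i \subset C.
Proof.
move=> sF; elim/big_rec: _ => [|i A Pi sA]; first exact: sub0set.
by apply: subset_add; rewrite ?sF.
Qed.

Definition dotS A B : bool := odd #|A :&: B|.

Lemma dotSC A B : dotS A B = dotS B A. Proof. by rewrite /dotS setIC. Qed.

Lemma odd_card A : odd #|A| = \sum_(x in A) true :> bool.
Proof.
rewrite -sum1_card (big_morph odd (id1 := false) (op1 := addb)) //; last exact: oddD.
Qed.

Lemma dotSE A B : dotS A B = \sum_(x in A) (x \in B) :> bool.
Proof.
rewrite /dotS odd_card (eq_bigl (fun x => (x \in A) && (x \in B))) => [|x]; last by rewrite inE.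
by rewrite big_mkcondr; apply: eq_bigr => x _; case: (x \in B).
Qed.

Lemma dotSDr A B C : dotS A (B + C) = dotS A B (+) dotS A C.
Proof.
rewrite !dotSE -[RHS](big_split (GRing.add : bool -> bool -> bool)) /=.
by apply: eq_bigr => x _; rewrite in_add.
Qed.

Lemma dotSDl A B C : dotS (A + B) C = dotS A C (+) dotS B C.
Proof. by rewrite !(dotSC _ C) dotSDr. Qed.

Lemma dotS0 A : dotS A 0 = false.
Proof. by rewrite /dotS setI0 cards0. Qed.

Lemma dot0S A : dotS 0 A = false.
Proof. by rewrite dotSC dotS0. Qed.

Lemma dotS_sum (I : Type) (r : seq I) (P : pred I) (F : I -> {set T}) A :
  dotS A (\sum_(i <- r | P i) F i) = \sum_(i <- r | P i) dotS A (F i) :> bool.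
Proof.
by apply: (big_morph (dotS A)) => [B C|]; rewrite ?dotSDr ?dotS0.
Qed.

Lemma dotS1 A x : dotS A [set x] = (x \in A).
Proof.
rewrite /dotS; case: (boolP (x \in A)) => xA.
  by rewrite (setIidPr _) ?cards1 ?sub1set.
suff -> : A :&: [set x] = set0 by rewrite cards0.
by apply/setP=> y; rewrite !inE; case: eqP => [->|]; rewrite ?andbF // (negbTE xA).
Qed.

Lemma set2_add x y : x != y -> [set x; y] = [set x] + [set y].
Proof. by move=> ne; rewrite add_disjoint // disjoints1 inE. Qed.

Lemma dotS2 A x y : x != y -> dotS A [set x; y] = (x \in A) (+) (y \in A).
Proof. by move=> ne; rewrite set2_add // dotSDr !dotS1. Qed.

End SymmetricDifference.

Section Subspaces.
Variable T : finType.
Implicit Types (A B C D E X Y : {set T}) (U W : {set {set T}}).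

Definition subspace W := (set0 \in W) && [forall A in W, forall B in W, A + B \in W].

Lemma subspaceP W :
  reflect (0 \in W /\ {in W &, forall A B, A + B \in W}) (subspace W).
Proof.
apply: (iffP andP) => -[W0 h]; split=> //.
  by move=> A B WA WB; have /forall_inP/(_ B WB) := forall_inP h A WA.
by apply/forall_inP=> A WA; apply/forall_inP=> B WB; apply: h.
Qed.

Lemma subspace0 W : subspace W -> 0 \in W.
Proof. by case/subspaceP. Qed.

Lemma subspaceD W A B : subspace W -> A \in W -> B \in W -> A + B \in W.
Proof. by case/subspaceP=> _ h; apply: h. Qed.

Lemma subspaceDl W A B : subspace W -> A \in W -> (A + B \in W) = (B \in W).
Proof.
move=> sW WA; apply/idP/idP=> WB; last exact: subspaceD.
by rewrite -(addKS A B) subspaceD.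
Qed.

Lemma subspaceDr W A B : subspace W -> B \in W -> (A + B \in W) = (A \in W).
Proof. by move=> sW WB; rewrite addrC subspaceDl. Qed.

Lemma subspace_sum W (I : Type) (r : seq I) (P : pred I) (F : I -> {set T}) :
  subspace W -> (forall i, P i -> F i \in W) -> \sum_(i <- r | P i) F i \in W.
Proof.
move=> sW WF; elim/big_rec: _ => [|i A Pi WA]; first exact: subspace0.
by rewrite subspaceD ?WF.
Qed.

(* A maximal subgroup U containing W but not A has index two, so that the
   indicator function of its complement is additive, hence of the form dotS D. *)
Lemma separation W A : subspace W -> A \notin W ->
  exists D, (forall C, C \in W -> ~~ dotS D C) /\ dotS D A.
Proof.
move=> sW nWA.
pose P := [pred U | subspace U && (A \notin U)].
have PW : P W by rewrite /= sW.
have [U /maxsetP[/andP[sU nUA] maxU] sWU] := maxset_exists PW.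
have split_ B : B \notin U -> A + B \in U.
  move=> nUB; rewrite addrC; pose U' := [set C | (C \in U) || (C + B \in U)].
  have sU' : subspace U'.
    apply/subspaceP; split=> [|C D]; rewrite !inE ?subspace0 //.
    case/orP=> h1 /orP[] h2; apply/orP.
    - by left; apply: subspaceD.
    - by right; rewrite -addrA subspaceD.
    - by right; rewrite addrAC subspaceD.
    - left; have -> : C + D = (C + B) + (D + B) by rewrite addrACA addSS addr0.
      exact: subspaceD.
  have sUU' : U \subset U' by apply/subsetP=> C; rewrite inE => ->.
  have: A \in U'.
    apply: contraR nUB => nA; have PU' : P U' by rewrite /= sU'.
    by rewrite -(maxU U' PU' sUU') inE addSS subspace0 ?orbT.
  by rewrite inE (negbTE nUA) addrC.
have addU B C : (B + C \notin U) = (B \notin U) (+) (C \notin U).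
  case: (boolP (B \in U)) => UB; first by rewrite subspaceDl.
  case: (boolP (C \in U)) => UC; first by rewrite subspaceDr.
  have -> : B + C = (A + B) + (A + C) by rewrite addrACA addSS add0r.
  by rewrite subspaceD // ?split_.
pose D := [set x | [set x] \notin U].
have dotD B : dotS D B = (B \notin U).
  rewrite -[in RHS](sum_set1 B) dotSC dotSE.
  rewrite (big_morph (fun B => B \notin U) (id1 := false) (op1 := addb)) //=.
    by apply: eq_bigr => x _; rewrite inE.
  by rewrite subspace0.
exists D; rewrite dotD; split=> // C WC; rewrite dotD negbK.
exact: (subsetP sWU).
Qed.

Definition wdel W Y := [set C in W | [disjoint C & Y]].
Definition wcon W X := [set C :\: X | C in W].
Lemma mem_wcon W X C : C \in W -> C :\: X \in wcon W X.
Proof. exact: imset_f. Qed.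

Definition wdual E W := [set D : {set T} | (D \subset E) && [forall C in W, ~~ dotS D C]].

Lemma setD_add A B X : (A + B) :\: X = (A :\: X) + (B :\: X).
Proof.
by apply/setP=> x; rewrite !(inE, in_add); case: (x \in X).
Qed.

Lemma wdel_subspace W Y : subspace W -> subspace (wdel W Y).
Proof.
move=> sW; apply/subspaceP; split=> [|A B]; rewrite !inE.
  by rewrite subspace0 //= disjoints_subset sub0set.
rewrite !disjoints_subset => /andP[WA sA] /andP[WB sB].
by rewrite subspaceD // subset_add.
Qed.

Lemma wcon_subspace W X : subspace W -> subspace (wcon W X).
Proof.
move=> sW; apply/subspaceP; split=> [|_ _ /imsetP[A WA ->] /imsetP[B WB ->]].
  by apply/imsetP; exists 0; rewrite ?subspace0 ?set0D.
by rewrite -setD_add mem_wcon ?subspaceD.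
Qed.

Lemma wdualP E W D :
  reflect (D \subset E /\ forall C, C \in W -> ~~ dotS D C) (D \in wdual E W).
Proof.
by rewrite inE; apply: (iffP andP) => -[sD /forall_inP h].
Qed.

Lemma wdual_subspace E W : subspace (wdual E W).
Proof.
apply/subspaceP; split=> [|A B /wdualP[sA hA] /wdualP[sB hB]].
  by apply/wdualP; split=> [|C _]; rewrite ?sub0set ?dot0S.
apply/wdualP; split=> [|C WC]; first exact: subset_add.
by rewrite dotSDl (negbTE (hA C WC)) (negbTE (hB C WC)).
Qed.

Lemma wdualS E W D : D \in wdual E W -> D \subset E.
Proof. by case/wdualP. Qed.

Lemma wdualK E W : subspace W -> (forall C, C \in W -> C \subset E) ->
  wdual E (wdual E W) = W.
Proof.
move=> sW sWE; apply/setP=> A; apply/idP/idP=> [/wdualP[sA hA]|WA].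
  apply/negPn/negP=> /(separation sW)[D [hD dDA]].
  have WD : D :&: E \in wdual E W.
    apply/wdualP; rewrite subsetIr; split=> // C WC.
    by rewrite /dotS -setIA (setIidPr (sWE C WC)); apply: hD.
  have := hA _ WD; rewrite dotSC /dotS -setIA (setIidPr sA).
  by rewrite -/(dotS D A) dDA.
apply/wdualP; split=> [|D /wdualP[_ hD]]; first exact: sWE.
by rewrite dotSC hD.
Qed.

(** By double duality it is enough to compare orthogonal spaces: a set that avoids Y is orthogonal
    to D exactly when it is orthogonal to [D :\: Y]. *)
Lemma wdual_wdel E W Y : subspace W -> (forall C, C \in W -> C \subset E) ->
  wdual (E :\: Y) (wdel W Y) = wcon (wdual E W) Y.
Proof.
move=> sW sWE; pose U := wcon (wdual E W) Y.
have sU : subspace U by rewrite wcon_subspace ?wdual_subspace.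
have UE D : D \in U -> D \subset E :\: Y.
  by case/imsetP=> D' /wdualS sD' ->; rewrite setSD.
rewrite -[RHS](wdualK sU UE); congr wdual; apply/setP=> C.
rewrite inE -{1}(wdualK sW sWE) disjoints_subset.
apply/andP/wdualP=> [[/wdualP[sC hC] CY]|[]].
  rewrite setDE subsetI sC; split=> // _ /imsetP[D hD ->].
  have := hC D hD; rewrite /dotS setIDA setDE -setIA [D :&: _]setIC setIA.
  by rewrite (setIidPl CY).
rewrite setDE subsetI => /andP[sC CY] hC; split=> //; apply/wdualP; split=> // D hD.
have := hC (D :\: Y) (mem_wcon _ hD).
by rewrite /dotS setIDA setDE -setIA [D :&: _]setIC setIA (setIidPl CY).
Qed.

Lemma wdual_wcon E W X : subspace W -> (forall C, C \in W -> C \subset E) ->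
  wdual (E :\: X) (wcon W X) = wdel (wdual E W) X.
Proof.
move=> sW sWE; have sD := wdual_subspace E W.
have sDE D : D \in wdual E W -> D \subset E by apply: wdualS.
have := wdual_wdel X sD sDE; rewrite (wdualK sW sWE) => <-.
rewrite wdualK ?wdel_subspace // => D; rewrite inE => /andP[/sDE sDE' dD].
by rewrite subsetD sDE'.
Qed.

Lemma wdel_wdel W Y Y' : wdel (wdel W Y) Y' = wdel W (Y :|: Y').
Proof.
by apply/setP=> C; rewrite !inE -andbA !disjoints_subset setCU subsetI.
Qed.

Lemma wcon_wcon W X X' : wcon (wcon W X) X' = wcon W (X :|: X').
Proof.
apply/setP=> C; apply/imsetP/imsetP=> [[_ /imsetP[D WD ->] ->]|[D WD ->]].
  by exists D; rewrite // setDDl.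
by exists (D :\: X); rewrite ?mem_wcon // setDDl.
Qed.

Lemma wdel_wcon W X Y : wdel (wcon W X) Y = wcon (wdel W (Y :\: X)) X.
Proof.
have eqd C : [disjoint C :\: X & Y] = [disjoint C & Y :\: X].
  by rewrite -!setI_eq0 setIDAC setIDA.
apply/setP=> C; rewrite inE; apply/andP/imsetP=> [[/imsetP[D WD ->]]|[D]].
  by rewrite eqd => dD; exists D; rewrite // inE WD.
by rewrite inE -eqd => /andP[WD dD] ->; rewrite mem_wcon.
Qed.

End Subspaces.

(** * Cycle spaces of matroids *)

Section CycleSpace.
Variable T : finType.
Implicit Types (M N : matroid T) (A B C D I X Y : {set T}) (W : {set {set T}}).

(** The last clause speaks of independent sets rather than circuits; in this form it passes directly
    to deletions and duals. *)
Definition cycle_space M W :=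
  [/\ subspace W, forall C, C \in W -> C \subset ground M
    & forall I, I \subset ground M ->
        (I \in indep M <-> forall C, C \in W -> C \subset I -> C = 0)].

Lemma cycle_spaceP M W I : cycle_space M W -> I \subset ground M ->
  reflect (forall C, C \in W -> C \subset I -> C = 0) (I \in indep M).
Proof. by case=> _ _ h /h hI; apply: (iffP idP) => /hI. Qed.

Lemma dep_cycle M W I : cycle_space M W -> I \subset ground M -> I \notin indep M ->
  exists C, [/\ C \in W, C != 0 & C \subset I].
Proof.
move=> cs sI dI; have iW := @cycle_spaceP _ _ _ cs; have [sW WE _] := cs.
case: (boolP [exists C in W, (C != 0) && (C \subset I)]) => [/exists_inP[C WC]|].
  by case/andP; exists C.
move/exists_inPn=> h; case/negP: dI; apply/iW => // C WC sC.
by have := h C WC; rewrite sC andbT negbK => /eqP.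
Qed.

Lemma cycle_dep M W C : cycle_space M W -> C \in W -> C != 0 -> C \notin indep M.
Proof.
move=> cs WC; have iW := @cycle_spaceP _ _ _ cs; have [sW WE _] := cs; apply: contraNN => /(iW _ (WE _ WC)) h.
by apply/eqP/h.
Qed.

Lemma circuit_cycle M W C : cycle_space M W -> C \in circuits M -> C \in W.
Proof.
move=> cs; rewrite inE => /minsetP[/andP[sC dC] minC].
have [D [WD nzD sD]] := dep_cycle cs sC dC.
suff <- : D = C by [].
by apply: minC => //; rewrite (subset_trans sD sC) (cycle_dep cs).
Qed.

Lemma cycle_circuit M W C : cycle_space M W -> C \in W -> C != 0 ->
  exists2 D, D \in circuits M & D \subset C.
Proof.
move=> cs WC nzC; have [_ WE _] := cs.
pose P D := (D \subset ground M) && (D \notin indep M).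
have PC : P C by rewrite /P WE //= (cycle_dep cs).
by have [D minD sD] := minset_exists PC; exists D; rewrite ?inE.
Qed.

Lemma circuit_neq0 M C : C \in circuits M -> C != 0.
Proof.
rewrite inE => /minsetP[/andP[_ dC] _].
by apply: contraNneq dC => ->; rewrite set0E indep0.
Qed.

(** A nonzero member of W contains a circuit; removing it leaves a smaller member of W disjoint from
    it, so that induction on the size applies. *)
Lemma cycles_cycle_space M W : cycle_space M W -> cycles M = W.
Proof.
move=> cs; have iW := @cycle_spaceP _ _ _ cs; have [sW WE _] := cs.
apply/setP=> C; rewrite inE; apply/existsP/idP=> [[P /and3P[cP tP /eqP->]]|].
  have -> : cover P = \sum_(D in P) D.
    apply/setP=> x; rewrite in_sum; apply/bigcupP/idP=> [[D PD xD]|].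
      rewrite (bigD1 D) //= xD big1 // => D' /andP[PD' neD].
      by apply/negbTE; rewrite (disjointFl (trivIsetP tP _ _ PD' PD neD) xD).
    case: (boolP [exists D in P, x \in D]) => [/exists_inP[D]|/exists_inPn h]; first by exists D.
    by rewrite big1 // => D /h/negbTE.
  apply: subspace_sum => // D /(subsetP cP); exact: circuit_cycle.
elim: {C}_.+1 {-2}C (ltnSn #|C|) => // n IHn C leC WC.
have [->|nzC] := eqVneq C 0.
  exists set0; rewrite sub0set /cover big_set0 eqxx andbT /=.
  by apply/trivIsetP=> A B; rewrite inE.
have [D cD sDC] := cycle_circuit cs WC nzC.
have /set0Pn[x xD] := circuit_neq0 cD.
have WCD : C :\: D \in W by rewrite -(add_subset sDC) subspaceD ?(circuit_cycle cs cD).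
have ltCD : (#|C :\: D| < n)%N.
  rewrite -ltnS; apply: leq_trans leC; rewrite ltnS; apply: proper_card.
  apply/properP; split; first exact: subsetDl.
  by exists x; rewrite ?(subsetP sDC) // inE xD.
have [P /and3P[cP tP /eqP eqP]] := IHn _ ltCD WCD.
have dD E : E \in P -> [disjoint D & E].
  move=> PE; have : E \subset C :\: D by rewrite eqP; apply: bigcup_sup.
  by rewrite subsetD disjoint_sym => /andP[].
exists (D |: P); apply/and3P; split.
- by rewrite subUset sub1set cD.
- apply/trivIsetP=> A B; rewrite !inE => /predU1P[->|PA] /predU1P[->|PB] ne.
  + by rewrite eqxx in ne.
  + exact: dD.
  + by rewrite disjoint_sym dD.
  + exact: (trivIsetP tP).
- rewrite /cover bigcup_setU big_set1 -/(cover P) -eqP.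
  by rewrite setUC setDE setUIl [~: D :|: D]setUC setUCr setIT (setUidPl sDC).
Qed.

Lemma cycle_space_deletion M W Y : cycle_space M W ->
  cycle_space (deletion M Y) (wdel W Y).
Proof.
move=> cs; have iW := @cycle_spaceP _ _ _ cs; have [sW WE _] := cs; split=> [|C|I] /=; first exact: wdel_subspace.
  by rewrite inE subsetD => /andP[/WE-> ->].
rewrite subsetD => /andP[sI dI]; rewrite inE dI andbT.
split=> [/(iW _ sI) h C|h].
  by rewrite inE => /andP[WC _]; apply: h.
apply/(iW _ sI) => C WC sC; apply: h => //; rewrite inE WC; exact: disjointWl dI.
Qed.

Lemma basis_ground M B : B \in bases M -> B \subset ground M.
Proof. by move/basis_indep; apply: indep_ground. Qed.

Lemma cycle_space_dual M W : cycle_space M W ->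
  cycle_space (dual M) (wdual (ground M) W).
Proof.
move=> cs; have iW := @cycle_spaceP _ _ _ cs; have [sW WE _] := cs.
split=> [|D|I /= sI]; first exact: wdual_subspace.
  exact: wdualS.
rewrite inE sI /=; split=> [/exists_inP[B bB dI] D /wdualP[sD hD] sDI|hI].
  apply/eqP/set0Pn=> -[x xD].
  have xB : x \notin B by rewrite (disjointFr dI) ?(subsetP sDI).
  have sxB : x |: B \subset ground M.
    by rewrite subUset sub1set (subsetP sD) // basis_ground.
  have dxB : x |: B \notin indep M.
    apply/negP=> ixB; move: bB; rewrite inE => /maxsetP[_ /(_ _ ixB (subsetUr _ _)) eB].
    by rewrite -eB setU11 in xB.
  have [C [WC nzC sC]] := dep_cycle cs sxB dxB.
  have xC : x \in C.
    apply: contraR nzC => xC; apply/eqP/(iW _ (basis_ground bB)) => //.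
      exact: basis_indep.
    apply/subsetP=> y yC; have := subsetP sC y yC; rewrite !inE.
    by case: eqP yC => // ->; rewrite (negbTE xC).
  (* C lies in [x |: B] and D avoids B, so the two meet in x alone, an odd intersection. *)
  have := hD C WC; rewrite /dotS; suff -> : D :&: C = [set x] by rewrite cards1.
  apply/setP=> y; rewrite !inE; apply/andP/eqP=> [[yD yC]|->]; last by [].
  have := subsetP sC y yC; rewrite !inE => /predU1P[] // yB.
  by rewrite (disjointFr dI) ?(subsetP sDI) in yB.
(* A maximal independent set B outside I is the candidate basis. If it is not one, some x in I
   enlarges it, and this x yields a nonzero dual vector inside I. *)
pose P := [pred B | (B \in indep M) && (B \subset ground M :\: I)].
have P0 : P set0 by rewrite /= indep0 sub0set.
apply/exists_inP; have [B /maxsetP[/andP[iB]] ] := maxset_exists P0.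
rewrite subsetD => /andP[sB dB] maxB _.
exists B; last by rewrite disjoint_sym.
have [B' bB' sBB'] := indep_basis iB.
case: (boolP (B' \subset B)) => [sB'|/subsetPn[x xB' xB]].
  by have <- : B' = B by apply/eqP; rewrite eqEsubset sB' sBB'.
have ixB : x |: B \in indep M.
  by apply: indepS (basis_indep bB'); rewrite subUset sub1set xB'.
have xE := subsetP (basis_ground bB') x xB'.
have xI : x \in I.
  apply: contraNT xB => xI; rewrite -(maxB (x |: B)) ?setU11 ?subsetUr //=.
  rewrite ixB /= subUset sub1set inE xI xE /= subsetD sB.
  exact: dB.
(* U is W plus all subsets of the complement of I. A functional that vanishes on U but not at x is
   orthogonal to W and supported, within the ground set, on I. *)
pose U := [set C : {set T} | [exists Z : {set T}, (Z \subset ground M :\: I) && (C + Z \in W)]].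
have sU : subspace U.
  apply/subspaceP; split=> [|C1 C2]; rewrite !inE.
    by apply/existsP; exists 0; rewrite sub0set addr0 subspace0.
  case/existsP=> Z1 /andP[s1 h1] /existsP[Z2 /andP[s2 h2]]; apply/existsP.
  by exists (Z1 + Z2); rewrite subset_add //= addrACA subspaceD.
(* Otherwise x is a sum of elements outside I modulo W; cancelling those outside B by their
   fundamental cycles leaves a nonzero cycle inside the independent set [x |: B]. *)
have nxU : [set x] \notin U.
  rewrite inE; apply/existsP=> -[Z /andP[sZ WxZ]].
  have fund z : z \in Z :\: B -> exists C, [/\ C \in W, z \in C & C \subset z |: B].
    case/setDP=> zZ zB; have /setDP[zE zI] := subsetP sZ z zZ.
    have sz : z |: B \subset ground M by rewrite subUset sub1set zE.
    have [] := dep_cycle cs sz.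
      apply: contraNN zB => iz; rewrite -(maxB (z |: B)) ?setU11 ?subsetUr //=.
      by rewrite iz subUset sub1set inE zI zE subsetD sB.
    move=> C [WC nzC sC]; exists C; split=> //.
    apply: contraR nzC => zC; apply/eqP/(iW _ sB) => //.
    apply/subsetP=> y yC; have := subsetP sC y yC; rewrite !inE.
    by case: eqP yC => // ->; rewrite (negbTE zC).
  pose c z := odflt 0 [pick C | [&& C \in W, z \in C & C \subset z |: B]].
  have cP z : z \in Z :\: B -> [/\ c z \in W, z \in c z & c z \subset z |: B].
    move=> /fund[C [WC zC sC]]; rewrite /c; case: pickP => [C' /and3P[] //|/(_ C)].
    by rewrite WC zC sC.
  pose C := [set x] + Z + \sum_(z in Z :\: B) c z.
  have WC : C \in W by rewrite subspaceD // subspace_sum // => z /cP[].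
  have xZ : x \notin Z by apply/negP=> /(subsetP sZ); rewrite inE xI.
  have xC : x \in C.
    rewrite !in_add inE eqxx (negbTE xZ) in_sum big1 // => z zZ.
    have [_ _ sc] := cP z zZ; apply/negbTE/negP=> /(subsetP sc).
    rewrite !inE (negbTE xB) orbF => /eqP e; case/setDP: zZ => zZ _.
    by rewrite -e (negbTE xZ) in zZ.
  have sC : C \subset x |: B.
    apply/subsetP=> y; rewrite !in_add !inE.
    have [//|neyx] := eqVneq y x; case: (boolP (y \in B)) => //= yB.
    rewrite in_sum; have cy z : z \in Z :\: B -> y != z -> y \in c z = false.
      move=> /cP[_ _ sc] ne; apply/negbTE/negP=> /(subsetP sc).
      by rewrite !inE (negbTE ne) (negbTE yB).
    case: (boolP (y \in Z)) => yZ /=.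
      have yZB : y \in Z :\: B by rewrite inE yB.
      rewrite (bigD1 y) //= big1 => [|z /andP[zZ ne]]; last by rewrite cy // eq_sym.
      by have [_ -> _] := cP y yZB.
    rewrite big1 // => z zZ; apply: cy => //; apply: contraNneq yZ => ->.
    by case/setDP: zZ.
  have C0 := elimT (iW _ (indep_ground ixB)) ixB C WC sC.
  by rewrite C0 in_zero in xC.
have [D [hD]] := separation sU nxU; rewrite dotS1 => xD.
have : x \in D :&: ground M by rewrite inE xD.
rewrite (hI (D :&: ground M)) ?in_zero //.
  apply/wdualP; rewrite subsetIr; split=> // C WC.
  rewrite /dotS -setIA (setIidPr (WE _ WC)); apply: hD; rewrite inE.
  by apply/existsP; exists 0; rewrite sub0set addr0.
apply/subsetP=> y /setIP[yD yE]; apply: contraTT yD => yI.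
rewrite -dotS1; apply: hD; rewrite inE; apply/existsP; exists [set y].
by rewrite addSS subspace0 // sub1set inE yI yE.
Qed.

Lemma cycle_space_contraction M W X : cycle_space M W ->
  cycle_space (contraction M X) (wcon W X).
Proof.
move=> cs; have iW := @cycle_spaceP _ _ _ cs; have [sW WE _] := cs.
have := cycle_space_dual (cycle_space_deletion X (cycle_space_dual cs)).
rewrite /= wdual_wdel ?wdual_subspace //; last by move=> C; apply: wdualS.
by rewrite wdualK.
Qed.

End CycleSpace.

(** * Graphs *)

Lemma sum_addS (T I : finType) (F : T -> {set I}) (A B : {set T}) :
  \sum_(x in A + B) F x = \sum_(x in A) F x + \sum_(x in B) F x.
Proof.
have h (C : {set T}) i : (i \in \sum_(x in C) F x) = dotS C [set x | i \in F x].
  by rewrite in_sum dotSE; apply: eq_bigr => x _; rewrite inE.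
by apply/setP=> i; rewrite in_add !h dotSDl.
Qed.

Section EvenSets.
Variable G : sgraph.
Implicit Types (x y z v : G) (e f : {set G}) (A : {set G}) (C D : {set {set G}}).

(** The edges are added as sets of vertices, so a zero sum says that every vertex has even
    degree. *)
Definition even_sets : {set {set {set G}}} :=
  [set C : {set {set G}} | (C \subset edges G) && (\sum_(e in C) e == 0)].

Lemma even_setsP C :
  reflect (C \subset edges G /\ \sum_(e in C) e = 0) (C \in even_sets).
Proof. by rewrite inE; apply: (iffP andP) => -[sC /eqP]. Qed.

Lemma even_sets_subspace : subspace even_sets.
Proof.
apply/subspaceP; split=> [|C D /even_setsP[sC C0] /even_setsP[sD D0]].
  by apply/even_setsP; rewrite sub0set big_set0.
by apply/even_setsP; rewrite subset_add // sum_addS C0 D0 addr0.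
Qed.

Lemma edgeP e : reflect (exists x y, adj x y /\ e = [set x; y]) (e \in edges G).
Proof.
rewrite inE; apply: (iffP existsP) => [[x /existsP[y /andP[xy /eqP->]]]|[x [y [xy ->]]]].
  by exists x, y.
by exists x; apply/existsP; exists y; rewrite xy eqxx.
Qed.

Lemma adj_neq x y : adj x y -> x != y.
Proof. by apply: contraTneq => ->; rewrite adj_irrefl. Qed.

Lemma cycle_edges_inj (p : seq G) : uniq p -> (2 < size p)%N ->
  {in [set z in p] &, injective (fun z => [set z; next p z])}.
Proof.
move=> up sp z w; rewrite !inE => zp wp eqzw; apply/eqP/negPn/negP=> wz.
have [_ nn] := next_next up sp zp.
have : w \in [set z; next p z] by rewrite eqzw !inE eqxx.
have : z \in [set w; next p w] by rewrite -eqzw !inE eqxx.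
rewrite !inE (negbTE wz) [w == z]eq_sym (negbTE wz) /= => /eqP ez /eqP ew.
by rewrite -ew -ez eqxx in nn.
Qed.

Lemma cycle_edgesE (p : seq G) :
  cycle_edges p = [set [set z; next p z] | z in [set z in p]].
Proof. by apply/setP=> e; apply/imsetP/imsetP=> -[z zp ->]; exists z; rewrite ?inE // in zp *. Qed.

Lemma polygon_even C : C \in polygons G -> C \in even_sets.
Proof.
case/polygonP=> p [sp cp up ->]; apply/even_setsP; split.
  apply/subsetP=> _ /imsetP[z zp ->]; apply/edgeP; exists z, (next p z); split=> //.
  exact: next_cycle.
rewrite cycle_edgesE big_imset /=; last exact: cycle_edges_inj.
rewrite (eq_bigr (fun z => [set z] + [set next p z])) => [|z]; last first.
  by rewrite inE => zp; rewrite set2_add // eq_sym; have [] := next_next up sp zp.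
rewrite big_split /= [X in X + _](reindex_inj (can_inj (prev_next up))) /=.
rewrite (eq_bigl (mem [set z in p])) ?addSS // => z.
by rewrite !inE mem_next.
Qed.

Lemma incidence_add A B : incidence (A + B) = incidence A + incidence B.
Proof.
apply/ffunP=> v; rewrite !ffunE in_add.
by case: (v \in A); case: (v \in B); apply/val_inj.
Qed.

Lemma incidence0 : incidence (0 : {set G}) = 0.
Proof. by apply/ffunP=> v; rewrite !ffunE in_zero. Qed.

(** In a forest the ends of an edge are not joined by the other edges, so its incidence vector is
    outside their span; a zero sum would put it inside. *)
Lemma forest_even C : C \in forests G -> C \in even_sets -> C = 0.
Proof.
move=> fC /even_setsP[sC C0]; apply/eqP/set0Pn=> -[e eC].
have eqC : e |: (C :\ e) = C by rewrite setD1K.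
have [x [y [xy ee]]] := edgeP _ (subsetP sC e eC).
have neC : e \notin C :\ e by rewrite !inE eqxx.
have nconn : ~~ connect (edge_rel (C :\ e)) x y.
  by apply: forest_connect; rewrite -ee ?eqC.
have sCe : C :\ e \subset edges G by apply: subset_trans sC; apply: subsetDl.
have /negP[] := cut_span_connect nconn sCe; rewrite -ee.
have /eqP : \sum_(f in C) incidence f = 0.
  by rewrite -(big_morph _ incidence_add incidence0) C0 incidence0.
rewrite (big_setD1 e) //= addr_eq0 => /eqP->; rewrite memvN.
by apply: memv_suml => f fCe; apply: mem_cut_span.
Qed.

Lemma cycle_space_even_sets : cycle_space (cycle_matroid G) even_sets.
Proof.
split=> [|C /even_setsP[]//|I /= sI]; first exact: even_sets_subspace.
split=> [fI C eC sC|h]; first exact: (forest_even (forestS sC fI)).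
rewrite inE sI; apply/forall_inP=> C pC; apply/negP=> sC.
have C0 := h C (polygon_even pC) sC.
move: pC; rewrite C0 => /polygonP[[|z p] [] // _ _ _ /setP/(_ [set z; next (z :: p) z])].
by rewrite in_zero; have -> : [set z; next (z :: p) z] \in cycle_edges (z :: p)
  by apply: imset_f; rewrite inE eqxx.
Qed.

Lemma circuit_polygon C : C \in circuits (cycle_matroid G) -> C \in polygons G.
Proof.
rewrite inE => /minsetP[/andP[/= sC nfC] minC].
move: nfC; rewrite inE sC /= => /forall_inPn[D pD]; rewrite negbK => sD.
suff <- : D = C by [].
apply: minC => //; rewrite (subset_trans sD sC) /=.
by rewrite inE negb_and; apply/orP; right; apply/forall_inPn; exists D; rewrite ?subxx.
Qed.

(* An arbitrary orientation: e leaves the vertex chosen by pick. *)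
Definition orient e v : int :=
  if v \in e then if [pick x in e] == Some v then -1 else 1 else 0.

Lemma orient_out e v : v \notin e -> orient e v = 0.
Proof. by rewrite /orient => /negbTE->. Qed.

Lemma orient_sqr e v : v \in e -> orient e v * orient e v = 1.
Proof. by rewrite /orient => ->; case: ifP. Qed.

Lemma orient_opp x y : x != y -> orient [set x; y] y = - orient [set x; y] x.
Proof.
move=> ne; rewrite /orient !inE !eqxx orbT.
case: pickP => [z|/(_ x)]; last by rewrite !inE eqxx.
have neS : (Some x == Some y) = false by apply/eqP=> -[e]; rewrite e eqxx in ne.
by rewrite !inE => /orP[]/eqP->; rewrite eqxx 1?[Some y == _]eq_sym neS ?opprK.
Qed.

Lemma orient_unit e v : v \in e -> orient e v = 1 \/ orient e v = -1.
Proof. by rewrite /orient => ->; case: ifP; auto. Qed.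

Lemma sum_orient x y (p : G -> int) : x != y ->
  \sum_v orient [set x; y] v * p v = orient [set x; y] x * (p x - p y).
Proof.
move=> ne; rewrite (bigD1 x) //= (bigD1 y) ?[y == x]eq_sym //= big1 => [|v /andP[vx vy]].
  by rewrite addr0 orient_opp // mulrBr mulNr.
by rewrite orient_out ?mul0r // !inE negb_or vx.
Qed.

End EvenSets.

(* A weak form of regularity of the binary matroid with cycle space W: the
   lattice L represents over the rationals the matroid that W represents over
   the two-element field. *)
Definition regular (T : finType) (W : {set {set T}}) :=
  exists L : (T -> int) -> Prop,
  [/\ forall u v (c : int), L u -> L v -> L (fun x => u x + c * v x),
      forall C, C \in W -> exists2 u, L u &
        forall x, if x \in C then u x = 1 \/ u x = -1 else u x = 0
    & forall u x, L u -> u x != 0 ->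
        exists C, [/\ C \in W, C != 0 & forall y, y \in C -> u y != 0]].

(** * Regularity of the cycle space and of the cut space of a graph *)

Section Regular.
Variable G : sgraph.
Implicit Types (x y z v : G) (e f : {set G}) (A : {set G}) (C D : {set {set G}}).

Definition cut A : {set {set G}} := [set e in edges G | dotS A e].

Lemma in_cut A e : (e \in cut A) = (e \in edges G) && dotS A e.
Proof. by rewrite in_set. Qed.

(** A set of edges meets [cut A] with the parity with which A meets its boundary. A set separating D
    from all cuts is in particular orthogonal to the vertex stars, hence even. *)
Lemma dual_even_setsP D :
  reflect (exists A, D = cut A) (D \in wdual (edges G) (even_sets G)).
Proof.
have cutC A C : C \subset edges G -> dotS C (cut A) = dotS A (\sum_(e in C) e).
  move=> sC; rewrite dotS_sum dotSE; apply: eq_bigr => e eC.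
  by rewrite in_cut (subsetP sC).
apply: (iffP idP) => [/wdualP[sD hD]|[A ->]]; last first.
  apply/wdualP; split=> [|C /even_setsP[sC C0]].
    by apply/subsetP=> e; rewrite in_cut => /andP[].
  by rewrite dotSC cutC // C0 dotS0.
pose U := [set cut A | A : {set G}].
have sU : subspace U.
  apply/subspaceP; split=> [|_ _ /imsetP[A _ ->] /imsetP[B _ ->]].
    by apply/imsetP; exists 0 => //; apply/setP=> e; rewrite in_zero in_cut dot0S andbF.
  apply/imsetP; exists (A + B) => //; apply/setP=> e; rewrite in_add !in_cut dotSDl.
  by case: (e \in edges G).
have : D \in U; last by case/imsetP=> A _ ->; exists A.
apply/negPn/negP=> /(separation sU)[C [hC dCD]].
have sCE : C :&: edges G \subset edges G by apply: subsetIr.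
suff /hD : C :&: edges G \in even_sets G.
  by rewrite dotSC /dotS -setIA (setIidPr sD) -/(dotS C D) dCD.
apply/even_setsP; split=> //; apply/setP=> v.
have cutE : edges G :&: cut [set v] = cut [set v].
  by apply/setIidPr/subsetP=> e; rewrite in_cut => /andP[].
have Uv : cut [set v] \in U by apply/imsetP; exists [set v].
have := hC _ Uv.
rewrite /dotS -cutE setIA -/(dotS _ _) cutC // dotSC dotS1 in_zero.
exact: negbTE.
Qed.

Lemma regular_cuts : regular (wdual (edges G) (even_sets G)).
Proof.
exists (fun u => exists p : G -> int, forall e,
  u e = if e \in edges G then \sum_v orient e v * p v else 0).
split=> [u w c [p hp] [q hq]|D|u e [p hp]].
- exists (fun v => p v + c * q v) => e; rewrite hp hq.
  case: ifP => _; last by rewrite mulr0 addr0.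
  rewrite mulr_sumr -big_split; apply: eq_bigr => v _ /=.
  by rewrite mulrDr mulrCA.
- case/dual_even_setsP=> A ->.
  pose p v : int := (v \in A)%:R.
  exists (fun e => if e \in edges G then \sum_v orient e v * p v else 0); first by exists p.
  move=> e; rewrite in_cut; case: (boolP (e \in edges G)) => //= /edgeP[x [y [xy ->]]].
  have ne := adj_neq xy; rewrite sum_orient // dotS2 // /p.
  have [->|->] : orient [set x; y] x = 1 \/ orient [set x; y] x = -1
    by apply: orient_unit; rewrite !inE eqxx.
    by case: (x \in A); case: (y \in A); rewrite /= ?subrr ?sub0r ?subr0; auto.
  by case: (x \in A); case: (y \in A); rewrite /= ?subrr ?sub0r ?subr0; auto.
rewrite hp; case: ifP => [eE|]; last by rewrite eqxx.
have [x [y [xy ee]]] := edgeP _ eE; rewrite ee sum_orient ?adj_neq //.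
rewrite mulf_eq0 negb_or => /andP[_]; rewrite subr_eq0 => pxy.
(* The level set of the potential at one end of e: e leaves it, and every edge that leaves it joins
   vertices of different potential. *)
exists (cut [set z | p z == p x]); split.
- by apply/dual_even_setsP; exists [set z | p z == p x].
- apply/set0Pn; exists e; rewrite in_cut eE ee dotS2 ?adj_neq //.
  by rewrite !inE eqxx eq_sym (negbTE pxy).
move=> f; rewrite in_cut hp => /andP[fE]; rewrite fE.
have [a [b [ab ->]]] := edgeP _ fE; rewrite dotS2 ?adj_neq //.
rewrite !inE sum_orient ?adj_neq // => neq.
rewrite mulf_neq0 //.
  by have [->|->] : orient [set a; b] a = 1 \/ orient [set a; b] a = -1
    by apply: orient_unit; rewrite !inE eqxx.
by rewrite subr_eq0; apply: contraTneq neq => ->; rewrite addbb.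
Qed.

Definition flow (u : {set G} -> int) :=
  (forall e, e \notin edges G -> u e = 0) /\
  forall v, \sum_(e in edges G) orient e v * u e = 0.

Lemma flow_lin u w (c : int) : flow u -> flow w -> flow (fun e => u e + c * w e).
Proof.
move=> [u0 hu] [w0 hw]; split=> [e eE|v]; first by rewrite u0 // w0 // mulr0 addr0.
under eq_bigr do rewrite mulrDr mulrCA.
by rewrite big_split /= hu -mulr_sumr hw mulr0 addr0.
Qed.

Lemma polygon_flow C : C \in polygons G -> exists2 u, flow u &
  forall e, if e \in C then u e = 1 \/ u e = -1 else u e = 0.
Proof.
move=> pC; have /even_setsP[sCE _] := polygon_even pC.
case/polygonP: pC sCE => p [sp cp up ->] sCE.
pose edge z := [set z; next p z].
(* One unit of flow around the polygon: the sign compares the orientation of e with the direction of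
   travel. *)
pose u e := \sum_(z in [set z in p] | edge z == e) orient e (next p z).
have injE := cycle_edges_inj up sp.
have u1 z : z \in p -> u (edge z) = orient (edge z) (next p z).
  move=> zp; rewrite /u (big_pred1 z) // => w; rewrite inE.
  apply/andP/eqP=> [[wp /eqP e]|->]; last by rewrite zp.
  by apply: injE; rewrite ?inE.
have u0 e : e \notin cycle_edges p -> u e = 0.
  move=> ne; rewrite /u big_pred0 // => z; rewrite inE; apply/negbTE/negP.
  by case/andP=> zp /eqP ee; case/negP: ne; rewrite -ee; apply: imset_f.
exists u; last first.
  move=> e; case: ifP => [/imsetP[z zp ->]|/negbT/u0//].
  by rewrite u1 //; apply: orient_unit; rewrite !inE eqxx orbT.
split=> [e eE|v]; first by apply: u0; apply: contra eE; apply: (subsetP sCE).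
rewrite (bigID (mem (cycle_edges p))) /= [X in _ + X]big1 ?addr0 => [|e /andP[_ /u0->]];
  last by rewrite mulr0.
rewrite (eq_bigl (mem (cycle_edges p))) => [|e]; last first.
  by rewrite /=; case: (boolP (e \in cycle_edges p)) => [/(subsetP sCE)->|]; rewrite ?andbF.
rewrite cycle_edgesE big_imset //=.
(* Each edge enters [next p z] and leaves z, so the net flow at v cancels when summed around the
   polygon. *)
have step z : z \in [set z in p] -> orient (edge z) v * u (edge z) =
    (v == next p z)%:R - (v == z)%:R.
  rewrite inE => zp; rewrite u1 //.
  have [nz _] := next_next up sp zp; rewrite eq_sym in nz.
  have [->|vz] := eqVneq v z.
    rewrite (negbTE nz) sub0r -[orient _ z]opprK -orient_opp // mulNr orient_sqr //.
    by rewrite !inE eqxx orbT.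
  have [->|vn] := eqVneq v (next p z); first by rewrite orient_sqr ?subr0 // !inE eqxx orbT.
  by rewrite orient_out ?mul0r ?subr0 // !inE negb_or vz.
rewrite (eq_bigr _ step) sumrB; apply/eqP; rewrite subr_eq0; apply/eqP.
rewrite [RHS](reindex_inj (can_inj (prev_next up))) /=.
by apply: eq_bigl => z; rewrite !inE mem_next.
Qed.

(** Unit flows around disjoint polygons have disjoint supports, so that their sum still has values
    0, 1 and -1. *)
Lemma even_flow C : C \in even_sets G -> exists2 u, flow u &
  forall e, if e \in C then u e = 1 \/ u e = -1 else u e = 0.
Proof.
rewrite -(cycles_cycle_space (cycle_space_even_sets G)) inE.
case/existsP=> P /and3P[cP tP /eqP->].
have fl D : D \in P -> exists2 u, flow u &
    forall e, if e \in D then u e = 1 \/ u e = -1 else u e = 0.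
  by move=> PD; apply/polygon_flow/circuit_polygon/(subsetP cP).
elim: {P}#|P| {-2}P (erefl #|P|) cP tP fl => [|n IHn] P cardP cP tP fl.
  move/eqP: cardP; rewrite cards_eq0 => /eqP->; exists (fun _ => 0).
    by split=> // v; rewrite big1 // => e _; rewrite mulr0.
  by move=> e; rewrite /cover big_set0 inE.
have /set0Pn[D PD] : P != set0 by rewrite -cards_eq0 cardP.
have sP : P :\ D \subset P by apply: subsetDl.
have [| | | |u fu hu] := IHn (P :\ D).
- by apply/eqP; rewrite -eqSS -cardP (cardsD1 D P) PD.
- exact: subset_trans cP.
- exact: trivIsetS tP.
- by move=> D' /(subsetP sP); apply: fl.
have [w fw hw] := fl D PD.
exists (fun e => u e + 1 * w e); first exact: flow_lin.
move=> e; have := hu e; have := hw e; rewrite mul1r.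
have -> : (e \in cover P) = (e \in D) || (e \in cover (P :\ D)).
  by rewrite /cover (big_setD1 D) //= inE.
case: (boolP (e \in D)) => eD /=; last first.
  by move=> ->; rewrite addr0.
have -> : (e \in cover (P :\ D)) = false.
  apply/bigcupP=> -[D']; rewrite !inE => /andP[ne PD'].
  by move/trivIsetP: tP => /(_ _ _ PD' PD ne)/disjointFl/(_ eD)->.
by move=> h ->; rewrite add0r.
Qed.

Lemma odd_abszM (a b : int) : odd `|a * b| = odd `|a| && odd `|b|.
Proof. by rewrite abszM oddM. Qed.

Lemma odd_abszD (a b : int) : odd `|a + b| = odd `|a| (+) odd `|b|.
Proof. by lia. Qed.

(** Modulo 2 the edges of odd flow form an even set. If there are none, half of u is a flow with the
    same support and smaller total absolute value. *)
Lemma flow_support u e : flow u -> u e != 0 ->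
  exists C, [/\ C \in even_sets G, C != 0 & forall f, f \in C -> u f != 0].
Proof.
elim: {u}_.+1 {-2}u (ltnSn (\sum_(e in edges G) `|u e|%N)) => // n IHn u leu fu nz.
have eE : e \in edges G by apply: contraNT nz => /(proj1 fu)->.
pose C := [set f in edges G | odd `|u f|].
have inC f : (f \in C) = (f \in edges G) && odd `|u f| by rewrite in_set.
have [C0|nzC] := eqVneq C 0; last first.
  exists C; split=> // [|f]; last by rewrite inC => /andP[_]; apply: contraTneq => ->.
  apply/even_setsP; split; first by apply/subsetP=> f; rewrite inC => /andP[].
  apply/setP=> v; rewrite in_sum in_zero.
  have := congr1 (fun a : int => odd `|a|) (proj2 fu v); rewrite /=.
  rewrite (big_morph (fun a : int => odd `|a|) odd_abszD (erefl : odd `|0%Z| = false)) => <-.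
  rewrite (eq_bigl (fun f => (f \in edges G) && (odd `|u f|))) => [|f]; last exact: inC.
  rewrite big_mkcondr /=; apply: eq_bigr => f _; rewrite odd_abszM.
  have -> : odd `|orient f v| = (v \in f).
    case: (boolP (v \in f)) => vf; last by rewrite orient_out.
    by have [->|->] := orient_unit vf.
  by case: (v \in f); case: (odd _).
have ev f : u f = 2 * (u f %/ 2)%Z.
  have [fE|fE] := boolP (f \in edges G); last by rewrite (proj1 fu).
  have /negbT : f \in C = false by rewrite C0 in_zero.
  rewrite inC fE /= => h; lia.
pose w f := (u f %/ 2)%Z.
have fw : flow w.
  split=> [f fE|v]; first by rewrite /w (proj1 fu).
  have := proj2 fu v; rewrite (eq_bigr (fun f => 2 * (orient f v * w f))) => [|f _].
    by rewrite -mulr_sumr => /eqP; rewrite mulf_eq0 => /orP[]// /eqP.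
  by rewrite mulrCA -ev.
have wu f : (w f != 0) = (u f != 0) by rewrite [in RHS]ev -/(w f) mulf_eq0.
have [||C' [eC' nz' hC']] := IHn w _ fw; last first.
- by exists C'; split=> // f /hC'; rewrite wu.
- by rewrite wu.
rewrite -ltnS; apply: leq_trans leu; rewrite ltnS.
rewrite (bigD1 e) //= [X in (_ < X)%N](bigD1 e) //= -addSn leq_add //.
  by have := ev e; rewrite -/(w e); have : u e != 0 by []; lia.
by apply: leq_sum => f _; have := ev f; rewrite -/(w f); lia.
Qed.

Lemma regular_even_sets : regular (even_sets G).
Proof.
exists flow; split=> [u w c|C|u e]; [exact: flow_lin | exact: even_flow|exact: flow_support].
Qed.

End Regular.

(** * The cycle space of K4 *)

Lemma set2_eq (T : finType) (a b c d : T) :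
  ([set a; b] == [set c; d]) = (a == c) && (b == d) || (a == d) && (b == c).
Proof.
apply/eqP/idP=> [e|/orP[]/andP[/eqP-> /eqP->] //]; last by rewrite setUC.
have : a \in [set c; d] by rewrite -e !inE eqxx.
have : b \in [set c; d] by rewrite -e !inE eqxx orbT.
have : c \in [set a; b] by rewrite e !inE eqxx.
have : d \in [set a; b] by rewrite e !inE eqxx orbT.
rewrite !inE [d == a]eq_sym [d == b]eq_sym [c == a]eq_sym [c == b]eq_sym.
by case: (a == c); case: (b == d); case: (a == d); case: (b == c).
Qed.

Notation K4 := (complete_graph 4).
Notation E4 := (edges K4).
Notation W4 := (even_sets K4).

Definition o0 : 'I_4 := @Ordinal 4 0 isT.
Definition o1 : 'I_4 := @Ordinal 4 1 isT.
Definition o2 : 'I_4 := @Ordinal 4 2 isT.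
Definition o3 : 'I_4 := @Ordinal 4 3 isT.

Lemma ord4_ind (P : 'I_4 -> Prop) : P o0 -> P o1 -> P o2 -> P o3 -> forall i, P i.
Proof.
move=> p0 p1 p2 p3 [[|[|[|[|i]]]] lti] //.
- by rewrite (_ : Ordinal lti = o0) //; apply: val_inj.
- by rewrite (_ : Ordinal lti = o1) //; apply: val_inj.
- by rewrite (_ : Ordinal lti = o2) //; apply: val_inj.
- by rewrite (_ : Ordinal lti = o3) //; apply: val_inj.
Qed.

Lemma mem_E4 (i j : 'I_4) : ([set i; j] \in E4) = (i != j).
Proof.
apply/idP/idP=> [/adj_edge//|ne]; apply/edgeP.
by exists i, j.
Qed.

(** With an explicit list, statements about cycles of K4 become case analyses on six Booleans. *)
Definition edges4 : seq {set 'I_4} :=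
  [:: [set o0; o1]; [set o0; o2]; [set o0; o3]; [set o1; o2]; [set o1; o3]; [set o2; o3]].

Lemma edges4_uniq : uniq edges4.
Proof. by rewrite /= !inE !set2_eq. Qed.

Lemma E4E : E4 =i edges4.
Proof.
move=> e; apply/idP/idP=> [/edgeP[i [j [ne ->]]]|]; last first.
  by rewrite !in_cons in_nil orbF => /or4P[| | |/or3P[]] /eqP->; rewrite mem_E4.
move: ne; rewrite /adj /= !in_cons in_nil !set2_eq.
by elim/ord4_ind: i; elim/ord4_ind: j.
Qed.

Lemma sum_E4 (V : nmodType) (F : {set 'I_4} -> V) :
  \sum_(e in E4) F e = F [set o0; o1] + F [set o0; o2] + F [set o0; o3]
    + F [set o1; o2] + F [set o1; o3] + F [set o2; o3].
Proof.
rewrite (eq_bigl (mem edges4)) => [|e]; last exact: E4E.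
by rewrite -big_uniq ?edges4_uniq //= !big_cons big_nil addr0 !addrA.
Qed.

Lemma sub_E4_eq (A B : {set {set 'I_4}}) : A \subset E4 -> B \subset E4 ->
  all (fun e => (e \in A) == (e \in B)) edges4 -> A = B.
Proof.
move=> sA sB /allP h; apply/setP=> e; case: (boolP (e \in E4)) => [eE|ne].
  by apply/eqP/h; rewrite -E4E.
have /negbTE-> : e \notin A by apply: contra ne; apply: (subsetP sA).
by have /negbTE-> : e \notin B by apply: contra ne; apply: (subsetP sB).
Qed.

Lemma W4E (A : {set {set 'I_4}}) : A \subset E4 ->
  (A \in W4) = let x i j := [set i; j] \in A in
    [&& ~~ (x o0 o1 (+) x o0 o2 (+) x o0 o3), ~~ (x o0 o1 (+) x o1 o2 (+) x o1 o3),
        ~~ (x o0 o2 (+) x o1 o2 (+) x o2 o3) & ~~ (x o0 o3 (+) x o1 o3 (+) x o2 o3)].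
Proof.
move=> sA /=; rewrite in_set sA /=.
have in_v v : (v \in \sum_(e in A) e) = \sum_(e in E4) (e \in A) && (v \in e) :> bool.
  rewrite in_sum [RHS](bigID (mem A)) /= [X in _ = _ + X]big1 => [|e /andP[_ /negbTE->//]].
  rewrite addr0; apply: eq_big => [e|e ->//].
  by case: (boolP (e \in A)) => [/(subsetP sA)->|]; rewrite ?andbF.
apply/eqP/and4P=> [s0|[h0 h1 h2 h3]].
  by split; [have := in_v o0|have := in_v o1|have := in_v o2|have := in_v o3];
    rewrite s0 in_zero sum_E4 !inE /= ?andbT ?andbF ?addr0 ?add0r => h;
    apply/negbT/esym/h.
apply/setP=> v; rewrite in_v in_zero sum_E4.
by elim/ord4_ind: v; rewrite !inE /= ?andbT ?andbF ?addr0 ?add0r; apply: negbTE.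
Qed.

Lemma W4S (A : {set {set 'I_4}}) : A \in W4 -> A \subset E4.
Proof. by case/even_setsP. Qed.

Lemma W4_subspace : subspace W4. Proof. exact: even_sets_subspace. Qed.

Lemma sum_ord4 (V : nmodType) (F : 'I_4 -> V) :
  \sum_i F i = F o0 + F o1 + F o2 + F o3.
Proof.
rewrite !big_ord_recl big_ord0 addr0 !addrA.
by congr (_ + _ + _ + _); congr (F _); apply: val_inj.
Qed.

Definition tri (i : 'I_4) : {set {set 'I_4}} := [set e in E4 | i \notin e].

Lemma triE i j k : ([set j; k] \in tri i) = [&& j != k, i != j & i != k].
Proof. by rewrite in_set mem_E4 !inE negb_or. Qed.

Lemma tri_W4 i : tri i \in W4.
Proof.
rewrite W4E; last by apply/subsetP=> e; rewrite in_set => /andP[].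
by rewrite /= !triE; elim/ord4_ind: i.
Qed.

(** An edge lies in exactly two of the four triangles. Adding T_0 to each keeps or complements these
    four memberships, and two out of four is stable under complement. *)
Lemma sum_tri (e : {set 'I_4}) :
  (\sum_i (e \in tri i) = \sum_i (e \in tri o0 + tri i)%R)%N.
Proof.
have [eE|neE] := boolP (e \in E4).
  rewrite !(sum_ord4 (V := nat)) !in_add.
  move: eE; rewrite E4E !in_cons in_nil orbF.
  by move=> /or4P[| | |/or3P[]] /eqP->; rewrite !triE.
have tri0 i : e \in tri i = false by rewrite in_set (negbTE neE).
by apply: eq_bigr => i _; rewrite in_add !tri0.
Qed.

Lemma W4_disjoint (A B : {set {set 'I_4}}) : A \in W4 -> B \in W4 ->
  [disjoint A & B] -> A = 0 \/ B = 0.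
Proof.
move=> WA WB dAB; have sA := W4S WA; have sB := W4S WB.
have dj e : ~~ ((e \in A) && (e \in B)).
  by apply/negP=> /andP[eA]; rewrite (disjointFr dAB eA).
have eq0 (C : {set {set 'I_4}}) : C \subset E4 -> all (fun e => e \notin C) edges4 -> C = 0.
  move=> sC /allP h; apply: sub_E4_eq; rewrite ?sub0set //.
  by apply/allP=> e /h; rewrite in_zero => /negbTE->.
have [A0|nzA] := eqVneq A 0; first by left.
right; apply: (eq0 B sB); move: WA WB.
have {nzA} : ~~ all (fun e => e \notin A) edges4.
  by apply: contra nzA => /(eq0 _ sA)->.
rewrite !W4E //=.
have := dj [set o0; o1]; have := dj [set o0; o2]; have := dj [set o0; o3].
have := dj [set o1; o2]; have := dj [set o1; o3]; have := dj [set o2; o3].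
do 6 case: (_ \in A) => //=; do 6 case: (_ \in B) => //=.
Qed.

(** T_1, T_2, T_3 form a basis; the edges 23, 13, 12 read off the coordinates because each lies in
    exactly one of them. *)
Lemma W4_decomp (A : {set {set 'I_4}}) : A \in W4 ->
  A = (if [set o2; o3] \in A then tri o1 else 0) +
      (if [set o1; o3] \in A then tri o2 else 0) +
      (if [set o1; o2] \in A then tri o3 else 0).
Proof.
move=> WA; have sA := W4S WA.
have sC b i : (if b then tri i else 0) \subset E4.
  by case: b; [exact: W4S (tri_W4 i)|exact: sub0set].
apply: sub_E4_eq; rewrite ?subset_add //.
move: WA; rewrite W4E //= !in_add.
have inC b i e : (e \in (if b then tri i else 0)) = b && (e \in tri i).
  by case: b; rewrite ?in_zero.
rewrite !inC !triE.
by do 6 case: (_ \in A).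
Qed.

Lemma setC_edges4 : [/\ ~: [set o0; o1] = [set o2; o3], ~: [set o0; o2] = [set o1; o3],
  ~: [set o0; o3] = [set o1; o2], ~: [set o1; o2] = [set o0; o3] &
  (~: [set o1; o3] = [set o0; o2]) * (~: [set o2; o3] = [set o0; o1])].
Proof.
by do !split; apply/setP=> i; rewrite !inE; elim/ord4_ind: i.
Qed.

Lemma setC_E4 e : (~: e \in E4) = (e \in E4).
Proof.
have [e1 e2 e3 e4 [e5 e6]] := setC_edges4.
have sub (f : {set 'I_4}) : f \in E4 -> ~: f \in E4.
  rewrite E4E !in_cons in_nil orbF => /or4P[| | |/or3P[]] /eqP->;
  by rewrite ?(e1, e2, e3, e4, e5, e6) mem_E4.
by apply/idP/idP=> /sub; rewrite ?setCK.
Qed.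

(** Complementation sends an edge to the opposite edge and the star of i to the triangle avoiding i,
    so it exchanges cuts and cycles. *)
Lemma W4_selfdual (D : {set {set 'I_4}}) : D \subset E4 ->
  (D \in wdual E4 W4) = ([set ~: e | e in D] \in W4).
Proof.
move=> sD; have [e1 e2 e3 e4 [e5 e6]] := setC_edges4.
have inD e : (~: e \in [set ~: e | e in D]) = (e \in D).
  by rewrite mem_imset //; apply: setC_inj.
have sD' : [set ~: e | e in D] \subset E4.
  by apply/subsetP=> _ /imsetP[e eD ->]; rewrite setC_E4 (subsetP sD).
have dotE (C : {set {set 'I_4}}) : C \subset E4 -> dotS D C = \sum_(e in E4) (e \in D) && (e \in C) :> bool.
  move=> sC; rewrite dotSE [RHS](bigID (mem D)) /= [X in _ + X]big1 => [|e /andP[_ /negbTE->//]].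
  rewrite addr0; apply: eq_big => [e|e ->//].
  by case: (boolP (e \in D)) => [/(subsetP sD)->|]; rewrite ?andbF.
pose D' := [set ~: e | e in D].
have d1 : ([set o0; o1] \in D') = ([set o2; o3] \in D) by rewrite -e6 inD.
have d2 : ([set o0; o2] \in D') = ([set o1; o3] \in D) by rewrite -e5 inD.
have d3 : ([set o0; o3] \in D') = ([set o1; o2] \in D) by rewrite -e4 inD.
have d4 : ([set o1; o2] \in D') = ([set o0; o3] \in D) by rewrite -e3 inD.
have d5 : ([set o1; o3] \in D') = ([set o0; o2] \in D) by rewrite -e2 inD.
have d6 : ([set o2; o3] \in D') = ([set o0; o1] \in D) by rewrite -e1 inD.
rewrite W4E //= d1 d2 d3 d4 d5 d6.
apply/wdualP/and4P=> [[_ hD]|[h0 h1 h2 h3]]; last first.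
  split=> // C WC; have sC := W4S WC; rewrite dotE // sum_E4.
  move: WC h0 h1 h2 h3; rewrite W4E //=.
  by do 6 (case: (_ \in C) => //=); do 6 (case: (_ \in D) => //=).
have dT i : ~~ dotS D (tri i) := hD _ (tri_W4 i).
have := (dT o0, dT o1, dT o2, dT o3); rewrite !dotE ?sum_E4; last first.
- exact: W4S (tri_W4 _).
- exact: W4S (tri_W4 _).
- exact: W4S (tri_W4 _).
- exact: W4S (tri_W4 _).
rewrite !triE => -[[[]]].
by do 6 (case: (_ \in D) => //=).
Qed.

Lemma E4_cycle e : e \in E4 -> exists2 A, A \in W4 & e \in A.
Proof.
move=> eE; suff [i] : exists i, e \in tri i by exists (tri i); rewrite ?tri_W4.
move: eE; rewrite E4E !in_cons in_nil orbF.
by move=> /or4P[| | |/or3P[]] /eqP->;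
  [exists o2|exists o1|exists o1|exists o0|exists o0|exists o0]; rewrite triE.
Qed.

(** * K4 minors of cycle spaces *)

Section ImageInjective.
Variables (T T' : finType) (D : {set T}) (f : T -> T').
Hypothesis injf : {in D &, injective f}.
Implicit Types A B : {set T}.

Lemma mem_imset_in A x : A \subset D -> x \in D -> (f x \in f @: A) = (x \in A).
Proof.
move=> sA xD; apply/imsetP/idP=> [[y yA e]|xA]; last by exists x.
by rewrite (injf xD (subsetP sA _ yA) e).
Qed.

Lemma subset_imset_in A B : A \subset D -> B \subset D ->
  (f @: A \subset f @: B) = (A \subset B).
Proof.
move=> sA sB; apply/idP/idP=> [/subsetP h|]; last exact: imsetS.
apply/subsetP=> x xA; rewrite -(mem_imset_in sB) ?(subsetP sA) //.
by apply: h; apply: imset_f.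
Qed.

Lemma imset_in_inj A B : A \subset D -> B \subset D -> f @: A = f @: B -> A = B.
Proof.
by move=> sA sB e; apply/eqP; rewrite eqEsubset -(subset_imset_in sA sB) -(subset_imset_in sB sA) e subxx.
Qed.

Lemma imset_add A B : A \subset D -> B \subset D -> f @: (A + B) = f @: A + f @: B.
Proof.
move=> sA sB; have sAB := subset_add sA sB.
have out y (C : {set T}) : C \subset D -> y \notin f @: D -> y \notin f @: C.
  by move=> sC; apply: contra; apply: (subsetP (imsetS f sC)).
apply/setP=> y; rewrite in_add; case: (boolP (y \in f @: D)) => [/imsetP[x xD ->]|ny].
  by rewrite !mem_imset_in // in_add.
by rewrite !(negbTE (out _ _ _ ny)).
Qed.

Lemma imset_in_preimset (B : {set T'}) : B \subset f @: D -> f @: (D :&: f @^-1: B) = B.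
Proof.
move=> /subsetP sB; apply/setP=> y; apply/imsetP/idP=> [[x]|yB].
  by rewrite !inE => /andP[_ ?] ->.
by have /imsetP[x xD e] := sB y yB; exists x; rewrite // !inE xD -e.
Qed.

End ImageInjective.

Section Isomorphism.
Variables (T T' : finType) (M : matroid T) (N : matroid T') (f : T -> T').
Variable W : {set {set T}}.
Implicit Types (C I : {set T}).
Hypotheses (csM : cycle_space M W) (injf : {in ground M &, injective f}).
Hypothesis imf : f @: ground M = ground N.

Lemma cycle_space_image :
  (forall I : {set T}, I \subset ground M -> (I \in indep M) = (f @: I \in indep N)) ->
  cycle_space N [set f @: C | C : {set T} in W].
Proof.
have [sW WE _] := csM => iMN; split=> [|_ /imsetP[C WC ->]|I sI].
- apply/subspaceP; split=> [|_ _ /imsetP[A WA ->] /imsetP[B WB ->]].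
    by apply/imsetP; exists 0; rewrite ?subspace0 ?imset0.
  by rewrite -(imset_add injf) ?WE // imset_f // subspaceD.
- by rewrite -imf imsetS ?WE.
have eI := imset_in_preimset (f := f) (D := ground M) (B := I); rewrite imf in eI.
rewrite -(eI sI) -iMN ?subsetIl //.
have iW := cycle_spaceP csM (subsetIl (ground M) (f @^-1: I)).
split=> [/iW h _ /imsetP[C WC ->]|h].
  by rewrite (subset_imset_in injf (WE _ WC) (subsetIl _ _)) => /(h _ WC)->; rewrite imset0.
apply/iW => C WC sC; apply: (imset_in_inj injf (WE _ WC) (sub0set _)).
by rewrite imset0; apply: h; rewrite ?imset_f // imsetS.
Qed.

Lemma isomorphic_cycle_space :
  cycle_space N [set f @: C | C : {set T} in W] -> isomorphic M N.
Proof.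
have [sW WE _] := csM => csN; exists f; split=> // I sI.
have sI' : f @: I \subset ground N by rewrite -imf imsetS.
apply/(cycle_spaceP csM sI)/(cycle_spaceP csN sI').
  move=> h _ /imsetP[C WC ->]; rewrite (subset_imset_in injf (WE _ WC) sI).
  by move=> /(h _ WC)->; rewrite imset0.
move=> h C WC sC; apply: (imset_in_inj injf (WE _ WC) (sub0set _)).
by rewrite imset0; apply: h; rewrite ?imset_f // imsetS.
Qed.

End Isomorphism.

Lemma isomorphic_sym (T T' : finType) (M : matroid T) (N : matroid T') (x0 : T) :
  isomorphic M N -> exists g : T' -> T,
    [/\ {in ground N &, injective g}, g @: ground N = ground M
      & forall I : {set T'}, I \subset ground N -> (I \in indep N) = (g @: I \in indep M)].
Proof.
move=> [f [injf imf iMN]].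
pose g y := odflt x0 [pick x in ground M | f x == y].
have fK : {in ground M, cancel f g}.
  move=> x xE; rewrite /g; case: pickP => [y /andP[yE /eqP e]|/(_ x)].
    exact: injf.
  by rewrite xE eqxx.
have gK : {in ground N, cancel g f}.
  by move=> y; rewrite -imf => /imsetP[x xE ->]; rewrite fK.
have gim (I : {set T}) : I \subset ground M -> g @: (f @: I) = I.
  move=> sI; rewrite -imset_comp -[RHS]imset_id; apply: eq_in_imset => x xI /=.
  by rewrite fK // (subsetP sI).
have fim (I : {set T'}) : I \subset ground N -> f @: (g @: I) = I.
  move=> sI; rewrite -imset_comp -[RHS]imset_id; apply: eq_in_imset => x xI /=.
  by rewrite gK // (subsetP sI).
exists g; split; first exact: can_in_inj gK.
  by rewrite -imf gim.
move=> I sI; rewrite iMN ?fim //.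
by rewrite -(gim (ground M)) // imf imsetS.
Qed.

Section K4Minors.
Variable T : finType.
Implicit Types (M N : matroid T) (C D E I X Y Z : {set T}) (W : {set {set T}}).
Implicit Types (A B : {set {set 'I_4}}) (g : {set 'I_4} -> T).

Definition k4image g : {set {set T}} := [set g @: A | A : {set {set 'I_4}} in W4].

Lemma isomorphic_k4 M W : cycle_space M W -> isomorphic M MK4 ->
  exists g, [/\ {in E4 &, injective g}, g @: E4 = ground M & W = k4image g].
Proof.
move=> cs iso; have /set0Pn[x0 _] : ground M != set0.
  case: iso => f [_ imf _]; apply/negP=> /eqP e; move: imf; rewrite e imset0.
  by move/setP/(_ [set o0; o1]); rewrite in_set0 mem_E4.
have [g [injg img ig]] := isomorphic_sym x0 iso.
exists g; split=> //; rewrite -(cycles_cycle_space cs).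
apply: cycles_cycle_space.
exact: (cycle_space_image (cycle_space_even_sets K4) injg img ig).
Qed.

Lemma k4_isomorphic M g : {in E4 &, injective g} -> g @: E4 = ground M ->
  cycle_space M (k4image g) -> isomorphic M MK4.
Proof.
move=> injg img cs.
have iso := isomorphic_cycle_space (cycle_space_even_sets K4) injg img cs.
have [f [injf imf iMN]] := isomorphic_sym [set o0; o1] iso.
by exists f.
Qed.

Definition k4minor W := exists Y X g,
  {in E4 &, injective g} /\ wcon (wdel W Y) X = k4image g.

(* Contracting X and deleting everything else outside the image of g gives K4. *)
Definition k4model W X g := [/\ {in E4 &, injective g}, [disjoint X & g @: E4]
  & forall A, A \subset E4 ->
      A \in W4 <-> exists2 Z : {set T}, Z \subset X & g @: A + Z \in W].

Lemma k4minor_wdel W Y : k4minor (wdel W Y) -> k4minor W.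
Proof.
by move=> [Y' [X [g]]]; rewrite wdel_wdel; exists (Y :|: Y'), X, g.
Qed.

Lemma k4minor_wcon W X : k4minor (wcon W X) -> k4minor W.
Proof.
move=> [Y [X' [g]]]; rewrite wdel_wcon wcon_wcon.
by exists (Y :\: X), (X :|: X'), g.
Qed.

Lemma k4image_ground W X Y g : wcon (wdel W Y) X = k4image g ->
  [disjoint X & g @: E4] /\ [disjoint Y & g @: E4].
Proof.
move=> eqW; have out e : e \in E4 -> (g e \notin X) && (g e \notin Y).
  move=> /E4_cycle[A WA eA].
  have : g @: A \in wcon (wdel W Y) X by rewrite eqW; apply: imset_f.
  case/imsetP=> C; rewrite inE => /andP[WC dC] eC.
  have : g e \in C :\: X by rewrite -eC; apply: imset_f.
  by rewrite inE => /andP[-> /(disjointFr dC)->].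
by split; rewrite disjoint_sym disjoints_subset; apply/subsetP=> _ /imsetP[e /out/andP[? ?] ->];
  rewrite inE.
Qed.

Lemma k4minor_model W E : (forall C, C \in W -> C \subset E) -> k4minor W ->
  exists X g, X \subset E /\ k4model W X g.
Proof.
move=> WE [Y [X [g [injg eqW]]]]; have [dX dY] := k4image_ground eqW.
(* Deletion comes first, so elements of X in Y, or outside E, occur in no surviving cycle. *)
exists ((X :\: Y) :&: E), g; split; first exact: subsetIr.
have dXg : [disjoint (X :\: Y) :&: E & g @: E4].
  by apply: disjointWl dX; apply: subset_trans (subsetIl _ _) (subsetDl _ _).
split=> // A sA; split=> [WA|[Z sZ WZ]].
  have : g @: A \in wcon (wdel W Y) X by rewrite eqW; apply: imset_f.
  case/imsetP=> C; rewrite inE => /andP[WC dC] ->.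
  exists (C :&: X).
    apply/subsetP=> x /setIP[xC xX]; rewrite !inE xX (subsetP (WE _ WC)) //.
    by rewrite (disjointFr dC xC).
  suff -> : C :\: X + C :&: X = C by [].
  by apply/setP=> x; rewrite in_add !inE; case: (x \in C); case: (x \in X).
have sgA : g @: A \subset g @: E4 by apply: imsetS.
have dA : [disjoint g @: A & X] by rewrite disjoint_sym (disjointWr sgA).
have eqA : (g @: A + Z) :\: X = g @: A.
  apply/setP=> x; rewrite inE in_add; case: (boolP (x \in X)) => xX /=.
    by rewrite (disjointFl dA xX).
  case: (boolP (x \in Z)) => [/(subsetP sZ)|]; last by rewrite addbF.
  by rewrite !inE (negbTE xX) andbF.
have : g @: A \in k4image g.
  rewrite -eqW -eqA; apply: mem_wcon; rewrite inE WZ /=.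
  rewrite disjoints_subset subset_add //; apply/subsetP=> x.
    by move/(subsetP sgA) => xg; rewrite inE (disjointFl dY xg).
  by move/(subsetP sZ); rewrite !inE => /andP[/andP[]].
case/imsetP=> B WB e; rewrite (imset_in_inj injg _ _ e) //; exact: W4S.
Qed.

Lemma k4model_con W X g : k4model W X g ->
  wcon (wdel W (~: (X :|: g @: E4))) X = k4image g.
Proof.
move=> [injg dX hA]; apply/setP=> C; apply/imsetP/imsetP=> [[D]|[A WA ->]].
  rewrite inE disjoints_subset setCK => /andP[WD sD] ->.
  have sDg : D :\: X \subset g @: E4.
    by apply/subsetP=> x /setDP[/(subsetP sD)]; rewrite inE => /orP[->|].
  exists (E4 :&: g @^-1: (D :\: X)); last by rewrite imset_in_preimset.
  apply/hA; first exact: subsetIl.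
  exists (D :&: X); rewrite ?subsetIr // imset_in_preimset //.
  suff -> : D :\: X + D :&: X = D by [].
  by apply/setP=> x; rewrite in_add !inE; case: (x \in D); case: (x \in X).
have sA := W4S WA; have [Z sZ WZ] := (hA A sA).1 WA.
have sgA : g @: A \subset g @: E4 by apply: imsetS.
exists (g @: A + Z).
  rewrite inE WZ disjoints_subset setCK subset_add //.
    by apply: subset_trans sgA (subsetUr _ _).
  by apply: subset_trans sZ (subsetUl _ _).
apply/setP=> x; rewrite inE in_add; case: (boolP (x \in X)) => xX /=.
  by apply/negbTE/negP=> /(subsetP sgA); rewrite (disjointFr dX xX).
by case: (boolP (x \in Z)) => [/(subsetP sZ)|]; rewrite ?addbF // (negbTE xX).
Qed.

Lemma k4model_minor W X g : k4model W X g -> k4minor W.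
Proof.
move=> km; have [injg _ _] := km.
by exists (~: (X :|: g @: E4)), X, g; rewrite k4model_con.
Qed.

Lemma k4minor_dual W E : subspace W -> (forall C, C \in W -> C \subset E) ->
  k4minor (wdual E W) -> k4minor W.
Proof.
move=> sW WE [Y [X [g [injg eqW]]]].
have sWD := wdual_subspace E W.
have DE C : C \in wdual E W -> C \subset E by apply: wdualS.
have sWY := wdel_subspace Y sWD.
have DE' C : C \in wdel (wdual E W) Y -> C \subset E :\: Y.
  by rewrite inE subsetD => /andP[/DE-> ->].
have gE : g @: E4 \subset E :\: Y :\: X.
  apply/subsetP=> _ /imsetP[e /E4_cycle[A WA eA] ->].
  have : g @: A \in wcon (wdel (wdual E W) Y) X by rewrite eqW; apply: imset_f.
  case/imsetP=> C /DE' sC eC; have : g e \in C :\: X by rewrite -eC; apply: imset_f.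
  by apply: (subsetP (setSD _ sC)).
have e1 := wdual_wcon X sWY DE'; rewrite eqW wdual_wdel // wdualK // in e1.
(* Elements of R lie in no cycle of the minor. They are loops of its dual and have to be deleted
   there; [g'] absorbs the self-duality of K4. *)
pose S := g @: E4; pose R := (E :\: Y :\: X) :\: S; pose g' e := g (~: e).
have dotg (A B : {set {set 'I_4}}) : A \subset E4 -> B \subset E4 ->
    dotS (g @: A) (g @: B) = dotS A B.
  move=> sA sB; rewrite /dotS -imsetI; last first.
    by move=> x y xA yB; apply: injg; [apply: (subsetP sA)|apply: (subsetP sB)].
  rewrite card_in_imset // => x y /setIP[xA _] /setIP[yA _].
  by apply: injg; apply: (subsetP sA).
have CK (A : {set {set 'I_4}}) : [set ~: e | e in [set ~: e | e in A]] = A.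
  by rewrite -imset_comp -[RHS]imset_id; apply: eq_imset => e /=; apply: setCK.
exists ((X :|: R) :\: Y), Y, g'; split.
  by move=> e f eE fE /injg h; apply: setC_inj; apply: h; rewrite setC_E4.
rewrite -wdel_wcon -wdel_wdel -e1; apply/setP=> D; rewrite inE.
have g'E (A : {set {set 'I_4}}) : g' @: A = g @: [set ~: e | e in A] by rewrite -imset_comp.
apply/andP/imsetP=> [[/wdualP[sD hD] dD]|[A WA ->]].
  have sDS : D \subset S.
    apply/subsetP=> x xD; have := disjointFr dD xD; rewrite inE (subsetP sD) // andbT.
    by move/negbFE.
  have sP : E4 :&: g @^-1: D \subset E4 by apply: subsetIl.
  exists [set ~: e | e in E4 :&: g @^-1: D].
    rewrite -W4_selfdual //; apply/wdualP; split=> // A WA.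
    rewrite -(dotg _ _ sP (W4S WA)) (imset_in_preimset sDS); apply: hD; exact: imset_f.
  by rewrite g'E CK (imset_in_preimset sDS).
have sA := W4S WA.
pose A' := [set ~: e | e in A]; have sA' : A' \subset E4.
  by apply/subsetP=> _ /imsetP[e eA ->]; rewrite setC_E4 (subsetP sA).
have sgS : g @: A' \subset S by apply: imsetS.
rewrite g'E; split; last first.
  by rewrite disjoint_sym disjoints_subset; apply/subsetP=> x; rewrite !inE => /andP[xS _];
    apply: contra xS; apply: (subsetP sgS).
apply/wdualP; split=> [|_ /imsetP[B WB ->]]; first exact: subset_trans gE.
rewrite (dotg _ _ sA' (W4S WB)).
have /wdualP[_ h] : A' \in wdual E4 W4 by rewrite W4_selfdual // CK.
exact: h.
Qed.

End K4Minors.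

(** * Minors of matroids *)

Section MinorChains.
Variable T : finType.
Implicit Types (M N : matroid T) (C D E I X Y Z S : {set T}) (W : {set {set T}}).

Lemma wdel0 W : wdel W set0 = W.
Proof. by apply/setP=> C; rewrite inE disjoint_sym disjoints_subset sub0set andbT. Qed.

Lemma wcon0 W : wcon W set0 = W.
Proof. by rewrite -[RHS]imset_id; apply: eq_imset => C /=; rewrite setD0. Qed.

(** R is a parameter so that minors and g-series minors are treated together: a retract step is the
    contraction of the circuit E'. *)
Lemma steps_k4minor (R : matroid T -> matroid T -> Prop) M N W :
  (forall M N, R M N -> exists X, N = deletion M X \/ N = contraction M X) ->
  clos_refl_trans _ R M N -> isomorphic N MK4 -> cycle_space M W -> k4minor W.
Proof.
move=> hR mMN iso cs; suff [Y [X csN]] : exists Y X, cycle_space N (wcon (wdel W Y) X).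
  by have [g [injg _ eqW]] := isomorphic_k4 csN iso; exists Y, X, g.
elim: mMN W cs {iso} => {M N} [M N /hR[X [->|->]]|M|M N P _ IH1 _ IH2] W cs.
- by exists X, set0; rewrite wcon0; apply: cycle_space_deletion.
- by exists set0, X; rewrite wdel0; apply: cycle_space_contraction.
- by exists set0, set0; rewrite wdel0 wcon0.
- have [Y [X /IH2[Y' [X' cs']]]] := IH1 _ cs.
  by move: cs'; rewrite wdel_wcon wcon_wcon wdel_wdel; exists (Y :|: Y' :\: X), (X :|: X').
Qed.

Lemma minor_k4minor M N W : minor M N -> isomorphic N MK4 -> cycle_space M W -> k4minor W.
Proof.
by apply: steps_k4minor => {}M {}N [[e _ ->]|[e _ ->]]; exists [set e]; [left|right].
Qed.

Lemma g_series_minor_k4minor M N W :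
  g_series_minor M N -> isomorphic N MK4 -> cycle_space M W -> k4minor W.
Proof.
apply: steps_k4minor => {}M {}N [[[e _ ->]|[e _ ->]|[e _ ->]]|[s [e [e' [_ _ _ ->]]]]].
- by exists [set e]; left.
- by exists [set e]; right.
- by exists [set e]; right.
- by exists [set e' x | x in setT]; right.
Qed.

Lemma series_minor_g_series M N : series_minor M N -> g_series_minor M N.
Proof.
by elim=> *; [apply: rt_step; left|apply: rt_refl|apply: rt_trans; eassumption].
Qed.

(** R stands for minor steps or series minor steps. A deletion step requires an element of the
    ground set, so the rest of Y, which meets no cycle, is passed over. *)
Lemma deletion_chain (R : matroid T -> matroid T -> Prop) M W Y :
  (forall M N, deletion_step M N -> R M N) -> cycle_space M W ->
  exists N, [/\ clos_refl_trans _ R M N, cycle_space N (wdel W Y)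
    & ground N = ground M :\: Y].
Proof.
move=> delR; elim: {Y}#|Y| {-2}Y (erefl #|Y|) M W => [|n IHn] Y cY M W cs.
  move/eqP: cY; rewrite cards_eq0 => /eqP->; exists M; rewrite wdel0 setD0.
  by split=> //; apply: rt_refl.
have [y yY] : exists y, y \in Y by apply/set0Pn; rewrite -cards_eq0 cY.
have cY' : #|Y :\ y| = n by apply/eqP; rewrite -eqSS -cY (cardsD1 y Y) yY.
have eY : [set y] :|: (Y :\ y) = Y by rewrite setD1K.
case: (boolP (y \in ground M)) => yE.
  have [N [rMN csN gN]] := IHn _ cY' _ _ (cycle_space_deletion [set y] cs).
  exists N; rewrite -{1}eY -wdel_wdel; split=> //; last first.
    by rewrite gN /= setDDl eY.
  by apply: rt_trans rMN; apply/rt_step/delR; exists y.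
have [N [rMN csN gN]] := IHn _ cY' _ _ cs; exists N; split=> //; last first.
  rewrite gN -[in RHS]eY -setDDl; congr (_ :\: _); apply/esym/setDidPl.
  by rewrite disjoint_sym disjoints1.
suff -> : wdel W Y = wdel W (Y :\ y) by [].
rewrite -{1}eY -wdel_wdel; congr wdel; apply/setP=> C; rewrite inE.
case: (boolP (C \in W)) => //= WC; have [_ WE _] := cs.
by rewrite disjoint_sym disjoints1; apply: contra yE; apply/subsetP/WE.
Qed.

Lemma coloop_cycle M W x : cycle_space M W -> x \in ground M ->
  (forall C, C \in W -> x \notin C) -> coloop M x.
Proof.
move=> cs xE xW; have csD := cycle_space_dual cs.
have WDx : [set x] \in wdual (ground M) W.
  by apply/wdualP; rewrite sub1set; split=> // C /xW; rewrite dotSC dotS1.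
have nzx : [set x] != 0 by apply/set0Pn; exists x; rewrite inE.
have [D cD] := cycle_circuit csD WDx nzx.
by rewrite subset1 => /orP[]/eqP eD; [rewrite /coloop -eD|have := circuit_neq0 cD; rewrite eD eqxx].
Qed.

(** The pair is orthogonal to W, so it contains a cocircuit D. This D lies inside the cycle C0 and
    meets it evenly, so it has two elements. *)
Lemma series_cycle M W x y : cycle_space M W -> x \in ground M -> y \in ground M ->
  x != y -> (exists2 C, C \in W & x \in C) ->
  (forall C, C \in W -> (x \in C) = (y \in C)) -> [set x; y] \in cocircuits M.
Proof.
move=> cs xE yE ne [C0 WC0 xC0] xyW; have csD := cycle_space_dual cs.
have WDx : [set x; y] \in wdual (ground M) W.
  apply/wdualP; rewrite subUset !sub1set xE yE; split=> // C WC.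
  by rewrite dotSC dotS2 // (xyW C WC) addbb.
have nzx : [set x; y] != 0 by apply/set0Pn; exists x; rewrite !inE eqxx.
have [D cD sD] := cycle_circuit csD WDx nzx.
have /wdualP[_ hD] := circuit_cycle csD cD; have := hD C0 WC0.
have sDC : D \subset C0.
  by apply: (subset_trans sD); rewrite subUset !sub1set xC0 -(xyW C0 WC0).
rewrite /dotS (setIidPl sDC) => evD.
suff <- : D = [set x; y] by [].
apply/eqP; rewrite eqEcard sD cards2 ne /=.
have := circuit_neq0 cD; rewrite -[D == 0]cards_eq0.
by case: #|D| evD => [|[|[]]].
Qed.

(** The series partners lie in S, which is disjoint from X and survives, so the hypothesis on X is
    inherited by each contraction. *)
Lemma series_chain M W X S : cycle_space M W -> X \subset ground M ->
  S \subset ground M -> [disjoint X & S] ->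
  (forall s, s \in S -> exists2 C, C \in W & s \in C) ->
  (forall x, x \in X -> (forall C, C \in W -> x \notin C) \/
     exists2 s, s \in S & forall C, C \in W -> (x \in C) = (s \in C)) ->
  exists N, [/\ series_minor M N, cycle_space N (wcon W X)
    & ground N = ground M :\: X].
Proof.
elim: {X}#|X| {-2}X (erefl #|X|) M W => [|n IHn] X cX M W cs sX sS dXS WS WX.
  move/eqP: cX; rewrite cards_eq0 => /eqP->; exists M; rewrite wcon0 setD0.
  by split=> //; apply: rt_refl.
have [x xX] : exists x, x \in X by apply/set0Pn; rewrite -cards_eq0 cX.
have cX' : #|X :\ x| = n by apply/eqP; rewrite -eqSS -cX (cardsD1 x X) xX.
have eX : [set x] :|: (X :\ x) = X by rewrite setD1K.
have xE := subsetP sX x xX.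
have sXX : X :\ x \subset X by apply: subsetDl.
have st : series_minor_step M (contraction M [set x]).
  case: (boolP [forall C in W, x \notin C]) => [/forall_inP xW|/forall_inPn[C WC]].
    by apply: Or33; exists x => //; apply: coloop_cycle cs xE xW.
  rewrite negbK => xC; case: (WX x xX) => [/(_ C WC)|[s sS' xs]]; first by rewrite xC.
  have nxs : x != s by apply: contraTneq sS' => <-; rewrite (disjointFr dXS).
  apply: Or32; exists x => //; exists [set x; s].
    by apply: (series_cycle cs) => //; [exact: (subsetP sS)|exists C].
  by rewrite !inE eqxx cards2 nxs.
have ne y : y \in S -> y != x by apply: contraTneq => ->; rewrite (disjointFr dXS).
have [|||y yS|y|N [rMN csN gN]] := IHn _ cX' _ _ (cycle_space_contraction [set x] cs).
- by rewrite /= subsetD (subset_trans sXX sX) disjoint_sym disjoints1 !inE eqxx.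
- by rewrite /= subsetD sS disjoint_sym disjoints1 (disjointFr dXS).
- exact: disjointWl dXS.
- have [C WC yC] := WS y yS; exists (C :\ x); first exact: mem_wcon.
  by rewrite !inE yC ne.
- rewrite !inE => /andP[yx yX]; case: (WX y yX) => [h|[s sS' h]].
    by left=> _ /imsetP[C WC ->]; rewrite inE (negbTE (h C WC)) andbF.
  right; exists s => // _ /imsetP[C WC ->].
  by rewrite !inE yx ne //= h.
exists N; rewrite -{1}eX -wcon_wcon; split=> //; last by rewrite gN /= setDDl eX.
by apply: rt_trans rMN; apply: rt_step.
Qed.

Lemma contraction_chain M W X : cycle_space M W -> X \subset ground M ->
  exists N, [/\ minor M N, cycle_space N (wcon W X) & ground N = ground M :\: X].
Proof.
elim: {X}#|X| {-2}X (erefl #|X|) M W => [|n IHn] X cX M W cs sX.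
  move/eqP: cX; rewrite cards_eq0 => /eqP->; exists M; rewrite wcon0 setD0.
  by split=> //; apply: rt_refl.
have [x xX] : exists x, x \in X by apply/set0Pn; rewrite -cards_eq0 cX.
have cX' : #|X :\ x| = n by apply/eqP; rewrite -eqSS -cX (cardsD1 x X) xX.
have eX : [set x] :|: (X :\ x) = X by rewrite setD1K.
have [|N [rMN csN gN]] := IHn _ cX' _ _ (cycle_space_contraction [set x] cs).
  by rewrite /= subsetD (subset_trans (subsetDl _ _) sX) disjoint_sym disjoints1 !inE eqxx.
exists N; rewrite -{1}eX -wcon_wcon; split=> //; last by rewrite gN /= setDDl eX.
apply: rt_trans rMN; apply: rt_step; right; exists x => //; exact: (subsetP sX).
Qed.

Lemma k4model_ground W X g E : (forall C, C \in W -> C \subset E) -> k4model W X g ->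
  g @: E4 \subset E.
Proof.
move=> WE [injg dX hA]; apply/subsetP=> _ /imsetP[e eE ->].
have [A WA eA] := E4_cycle eE; have [Z sZ WZ] := (hA A (W4S WA)).1 WA.
apply: (subsetP (WE _ WZ)); rewrite in_add imset_f //=.
apply/negP=> /(subsetP sZ) gX; have := disjointFr dX gX.
by rewrite imset_f.
Qed.

Lemma k4minor_minor M W : cycle_space M W -> k4minor W ->
  exists2 N, minor M N & isomorphic N MK4.
Proof.
move=> cs kW; have [sW WE _] := cs.
have [X [g [sX km]]] := k4minor_model WE kW; have [injg dX _] := km.
have gE := k4model_ground WE km.
have [|M1 [r1 cs1 g1]] := @deletion_chain (@minor_step T) M W (~: (X :|: g @: E4)) _ cs.
  by move=> M1 N1; left.
have sX1 : X \subset ground M1.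
  by rewrite g1 setDE setCK subsetI sX subsetUl.
have [N [r2 cs2 g2]] := contraction_chain cs1 sX1.
exists N; first exact: rt_trans r1 r2.
rewrite (k4model_con km) in cs2; apply: k4_isomorphic cs2 => //.
rewrite g2 g1; apply/setP=> x; rewrite !in_setD in_setC negbK in_setU.
case: (boolP (x \in X)) => xX /=; first by rewrite (disjointFr dX).
by case: (boolP (x \in g @: E4)) => [/(subsetP gE)->|]; rewrite ?andbF.
Qed.

End MinorChains.

(** * Regular cycle spaces *)

(** The union of two triangles is K4 minus an edge, with cycles 0, T_i, T_j and T_i + T_j; the edge
    e lies in the second and the fourth. *)
Lemma W4_in_two_triangles (i j : 'I_4) (e : {set 'I_4}) (A : {set {set 'I_4}}) :
  A \in W4 -> A \subset tri i :|: tri j -> e \in tri i -> e \notin tri j ->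
  e \notin A -> A = 0 \/ A = tri j.
Proof.
move=> WA /subsetP sA ei ej eA; have sAE := W4S WA.
have h f : (f \in A) ==> (f \in tri i) || (f \in tri j).
  by apply/implyP=> /sA; rewrite in_setU.
suff /orP[/allP h0|h1] : all (fun f => f \notin A) edges4
    || all (fun f => (f \in A) == (f \in tri j)) edges4.
- left; apply: sub_E4_eq; rewrite ?sub0set //.
  by apply/allP=> f /h0; rewrite in_zero => /negbTE->.
- by right; apply: sub_E4_eq => //; apply: W4S (tri_W4 j).
have eE := subsetP (W4S (tri_W4 i)) e ei; move: ei ej eA WA.
move: (h [set o0; o1]) (h [set o0; o2]) (h [set o0; o3]) (h [set o1; o2])
  (h [set o1; o3]) (h [set o2; o3]) => {h}.
rewrite W4E //=; move: eE; rewrite E4E !in_cons in_nil orbF.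
case/or4P=> [| | |/or3P[]] /eqP->; rewrite !triE;
  elim/ord4_ind: i sA => // _; elim/ord4_ind: j => //;
  by do 6 (case: (_ \in A) => //).
Qed.

(** * Lifting the cycles of K4 along a minimal contraction set *)

Section TightModel.
Variables (T : finType) (W : {set {set T}}) (X : {set T}) (g : {set 'I_4} -> T).
Hypotheses (sW : subspace W) (km : k4model W X g).
Hypothesis tight : forall C, C \in W -> C \subset X -> C = 0.
Implicit Types (A B : {set {set 'I_4}}) (C D : {set T}).

Let S := g @: E4.
Let injg : {in E4 &, injective g}. Proof. by case: km. Qed.

Let edge_notin_X e : e \in E4 -> g e \notin X.
Proof. by case: km => _ dX _ eE; rewrite (disjointFl dX) // imset_f. Qed.

(** For A in [W4] the choice is forced, because two candidates differ by a cycle inside X and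
    [tight] makes it 0. This is why lifting is linear. *)
Definition k4lift A : {set T} :=
  odflt 0 [pick C in W | (C \subset X :|: S) && (C :\: X == g @: A)].

Lemma k4liftP A : A \in W4 -> [/\ k4lift A \in W, k4lift A \subset X :|: S
  & forall e, e \in E4 -> (g e \in k4lift A) = (e \in A)].
Proof.
move=> WA.
have : g @: A \in k4image g by apply: imset_f.
rewrite -(k4model_con km) => /imsetP[C]; rewrite inE disjoints_subset setCK.
move=> /andP[WC sC] eC; rewrite /k4lift; case: pickP => [D|/(_ C)]; last first.
  by rewrite WC sC eC eqxx.
case/and3P=> WD sD /eqP eD; split=> // e eE.
rewrite -(mem_imset_in injg (W4S WA) eE) -eD inE.
by rewrite edge_notin_X.
Qed.

Lemma k4lift_uniq C D : C \in W -> D \in W -> C \subset X :|: S -> D \subset X :|: S ->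
  (forall e, e \in E4 -> (g e \in C) = (g e \in D)) -> C = D.
Proof.
move=> WC WD sC sD h; apply/eqP; rewrite -addS_eq0; apply/eqP/tight; first exact: subspaceD.
apply/subsetP=> y yCD; have := subsetP (subset_add sC sD) y yCD.
rewrite inE => /orP[//|/imsetP[e eE ey]].
by move: yCD; rewrite in_add ey h // addbb.
Qed.

Lemma k4lift_exists C : C \in W -> C \subset X :|: S -> exists2 A, A \in W4 & C = k4lift A.
Proof.
move=> WC sC; have : C :\: X \in k4image g.
  rewrite -(k4model_con km); apply: mem_wcon.
  by rewrite inE WC disjoints_subset setCK.
case/imsetP=> A WA eC; exists A => //; have [WL sL hL] := k4liftP WA.
apply: k4lift_uniq => // e eE; rewrite hL //.
by rewrite -(mem_imset_in injg (W4S WA) eE) -eC inE edge_notin_X.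
Qed.

Lemma k4liftD A B : A \in W4 -> B \in W4 -> k4lift (A + B) = k4lift A + k4lift B.
Proof.
move=> WA WB; have [WLA sLA hA] := k4liftP WA; have [WLB sLB hB] := k4liftP WB.
have [WL sL hL] := k4liftP (subspaceD W4_subspace WA WB).
apply: k4lift_uniq; rewrite ?subspaceD ?subset_add // => e eE.
by rewrite in_add hL // hA // hB // in_add.
Qed.

Lemma k4lift0 : k4lift 0 = 0.
Proof.
have W0 := subspace0 W4_subspace; have [WL sL hL] := k4liftP W0.
by apply: k4lift_uniq; rewrite ?subspace0 ?sub0set // => e /hL->; rewrite !in_zero.
Qed.

(** Membership of x in a lift is a linear functional on [W4], given here by its values on the basis
    of [W4_decomp]. *)
Lemma mem_k4lift x A : A \in W4 -> (x \in k4lift A) =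
  ([set o2; o3] \in A) && (x \in k4lift (tri o1)) (+)
  ([set o1; o3] \in A) && (x \in k4lift (tri o2)) (+)
  ([set o1; o2] \in A) && (x \in k4lift (tri o3)).
Proof.
move=> WA; have Wif (b : bool) i : (if b then tri i else 0) \in W4.
  by case: b; [exact: tri_W4|exact: subspace0 W4_subspace].
have Lif (b : bool) i : (x \in k4lift (if b then tri i else 0)) = b && (x \in k4lift (tri i)).
  by case: b; rewrite // k4lift0 in_zero.
rewrite {1}(W4_decomp WA) k4liftD ?k4liftD ?subspaceD ?W4_subspace //.
by rewrite !in_add (Lif ([set o2; o3] \in A)) (Lif ([set o1; o3] \in A)) (Lif ([set o1; o2] \in A)).
Qed.

(* Otherwise x extends the six elements of S to a minor F7*, which is not
   representable over the rationals. *)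
Lemma regular_no_fano x : regular W -> x \in X ->
  exists i, x \notin k4lift (tri i).
Proof.
move=> [L [Llin Lval Lsupp]] xX.
case: (boolP [forall i, x \in k4lift (tri i)]) => [/forallP xT|/forallPn//]; exfalso.
have u_ex i : exists u, [/\ L u, u x = 1 &
    forall y, if y \in k4lift (tri i) then u y = 1 \/ u y = -1 else u y = 0].
  have [WT _ _] := k4liftP (tri_W4 i); have [u Lu hu] := Lval _ WT.
  have := hu x; rewrite xT => -[ux|ux]; first by exists u.
  (* This is -u, in the form under which L is closed. *)
  exists (fun y => u y + -2 * u y); split; [exact: Llin|by rewrite ux|move=> y].
  by have := hu y; case: ifP => _; [move=> [->|->]; [right|left]|move=> ->].
have Wsub C : C \in W -> (forall y, y \in C -> exists i, y \in k4lift (tri i)) ->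
    exists2 A, A \in W4 & C = k4lift A.
  move=> WC hC; apply: k4lift_exists => //; apply/subsetP=> y /hC[i].
  by have [_ sT _] := k4liftP (tri_W4 i); apply: (subsetP sT).
(* Normalized at x, the vectors of two triangles take the same sign on their common edge e. Here e'
   is an edge of T_i outside T_j. *)
have agree i j e e' u v : L u -> u x = 1 ->
    (forall y, if y \in k4lift (tri i) then u y = 1 \/ u y = -1 else u y = 0) ->
    L v -> v x = 1 ->
    (forall y, if y \in k4lift (tri j) then v y = 1 \/ v y = -1 else v y = 0) ->
    e \in tri i -> e \in tri j -> e' \in tri i -> e' \notin tri j -> u (g e) = v (g e).
  move=> Lu ux hu Lv vx hv ei ej e'i e'j.
  have triS k : tri k \subset E4 by apply: W4S (tri_W4 k).
  have eE := subsetP (triS i) e ei; have e'E := subsetP (triS i) e' e'i.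
  have WT k := k4liftP (tri_W4 k).
  have WQ : tri i + tri j \in W4 by rewrite subspaceD ?W4_subspace ?tri_W4.
  have [WLQ _ hQ] := k4liftP WQ; have [q Lq hq] := Lval _ WLQ.
  have outQ y : y \in k4lift (tri i) -> y \in k4lift (tri j) -> q y = 0.
    by move=> yi yj; have := hq y; rewrite k4liftD ?tri_W4 // in_add yi yj.
  have [[_ _ hi] [_ _ hj]] := (WT i, WT j).
  have qe : q (g e) = 0 by apply: outQ; rewrite ?hi ?hj.
  have ve' : v (g e') = 0 by have := hv (g e'); rewrite hj // (negbTE e'j).
  have qe' : q (g e') * q (g e') = 1.
    by have := hq (g e'); rewrite hQ // in_add e'i (negbTE e'j) => -[->|->].
  (* The vector q of T_i + T_j vanishes at x and at e; its multiple is chosen so that w also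
     vanishes at e'. The support of w then contains no nonzero cycle: avoiding e' leaves only T_j,
     whose lift contains x. *)
  pose w y := (u y + -1 * v y) + - (u (g e') * q (g e')) * q y.
  have Lw : L w by apply: (Llin (fun y => u y + -1 * v y)) => //; apply: Llin.
  have we' : w (g e') = 0.
    have -> : w (g e') = u (g e') * (1 - q (g e') * q (g e')) by rewrite /w ve'; ring.
    by rewrite qe' subrr mulr0.
  have wx : w x = 0 by rewrite /w ux vx (outQ x) // mulr0.
  suff : w (g e) = 0.
    by rewrite /w qe mulr0 addr0 mulN1r => /eqP; rewrite subr_eq0 => /eqP.
  apply/eqP/negPn/negP=> /(Lsupp _ _ Lw)[C [WC nzC hC]].
  have sup y : w y != 0 -> (y \in k4lift (tri i)) || (y \in k4lift (tri j)).
    apply: contraR; rewrite negb_or => /andP[yi yj].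
    have := hu y; have := hv y; have := hq y; rewrite k4liftD ?tri_W4 // in_add.
    by rewrite (negbTE yi) (negbTE yj) /w => -> -> ->; rewrite !mulr0.
  have [|A WA eC] := Wsub _ WC.
    by move=> y /hC/sup/orP[]; [exists i|exists j].
  have [_ _ hA] := k4liftP WA.
  have xC : x \notin C by apply/negP=> /hC; rewrite wx eqxx.
  have sA : A \subset tri i :|: tri j.
    apply/subsetP=> f fA; have fE := subsetP (W4S WA) f fA.
    have : g f \in C by rewrite eC hA.
    by move/hC/sup; rewrite hi // hj // in_setU.
  have e'A : e' \notin A.
    by rewrite -hA // -eC; apply/negP=> /hC; rewrite we' eqxx.
  case: (W4_in_two_triangles WA sA e'i e'j e'A) => eA.
    by move: nzC; rewrite eC eA k4lift0 eqxx.
  by move: xC; rewrite eC eA xT.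
have [u0 [L0 x0 h0]] := u_ex o0; have [u1 [L1 x1 h1]] := u_ex o1.
have [u2 [L2 x2 h2]] := u_ex o2; have [u3 [L3 x3 h3]] := u_ex o3.
have a13 : u1 (g [set o0; o2]) = u3 (g [set o0; o2]).
  by apply: (agree o1 o3 _ [set o0; o3]); rewrite ?triE.
have a12 : u1 (g [set o0; o3]) = u2 (g [set o0; o3]).
  by apply: (agree o1 o2 _ [set o0; o2]); rewrite ?triE.
have a03 : u0 (g [set o1; o2]) = u3 (g [set o1; o2]).
  by apply: (agree o0 o3 _ [set o1; o3]); rewrite ?triE.
have a02 : u0 (g [set o1; o3]) = u2 (g [set o1; o3]).
  by apply: (agree o0 o2 _ [set o1; o2]); rewrite ?triE.
have a01 : u0 (g [set o2; o3]) = u1 (g [set o2; o3]).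
  by apply: (agree o0 o1 _ [set o1; o2]); rewrite ?triE.
have val (i : 'I_4) (u : T -> int) (f : {set 'I_4}) : f \in E4 ->
    (forall y, if y \in k4lift (tri i) then u y = 1 \/ u y = -1 else u y = 0) ->
    if f \in tri i then u (g f) = 1 \/ u (g f) = -1 else u (g f) = 0.
  by move=> fE /(_ (g f)); have [_ _ ->] := k4liftP (tri_W4 i).
have out (i : 'I_4) (u : T -> int) (f : {set 'I_4}) :
    (forall y, if y \in k4lift (tri i) then u y = 1 \/ u y = -1 else u y = 0) ->
    f \in E4 -> f \notin tri i -> u (g f) = 0.
  by move=> hu fE /negbTE nf; have := val i u f fE hu; rewrite nf.
(* Edges shared by one of T_0, T_1 and one of T_2, T_3 cancel, and so does x. On the edge 23, common
   to T_0 and T_1, the value is 2 or -2. So the support is confined to X and two opposite edges,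
   which contain no nonzero cycle of K4. *)
pose w y := (u0 y + 1 * u1 y) + -1 * (u2 y + 1 * u3 y).
have Lw : L w.
  by apply: (Llin (fun y => u0 y + 1 * u1 y) (fun y => u2 y + 1 * u3 y)); apply: Llin.
have wf (f : {set 'I_4}) : f \in E4 -> f != [set o0; o1] -> f != [set o2; o3] -> w (g f) = 0.
  rewrite E4E !in_cons in_nil orbF => fE n01 n23.
  move: fE; rewrite (negbTE n01) (negbTE n23) orbF /= => /or4P[] /eqP ->.
  - have zi : u0 (g [set o0; o2]) = 0 by apply: (out o0) => //; rewrite ?mem_E4 ?triE.
    have zj : u2 (g [set o0; o2]) = 0 by apply: (out o2) => //; rewrite ?mem_E4 ?triE.
    by rewrite /w zi zj a13; ring.
  - have zi : u0 (g [set o0; o3]) = 0 by apply: (out o0) => //; rewrite ?mem_E4 ?triE.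
    have zj : u3 (g [set o0; o3]) = 0 by apply: (out o3) => //; rewrite ?mem_E4 ?triE.
    by rewrite /w zi zj a12; ring.
  - have zi : u1 (g [set o1; o2]) = 0 by apply: (out o1) => //; rewrite ?mem_E4 ?triE.
    have zj : u2 (g [set o1; o2]) = 0 by apply: (out o2) => //; rewrite ?mem_E4 ?triE.
    by rewrite /w zi zj a03; ring.
  - have zi : u1 (g [set o1; o3]) = 0 by apply: (out o1) => //; rewrite ?mem_E4 ?triE.
    have zj : u3 (g [set o1; o3]) = 0 by apply: (out o3) => //; rewrite ?mem_E4 ?triE.
    by rewrite /w zi zj a02; ring.
have wx : w x = 0 by rewrite /w x0 x1 x2 x3.
have wn : w (g [set o2; o3]) != 0.
  have z2 : u2 (g [set o2; o3]) = 0 by apply: (out o2) => //; rewrite ?mem_E4 ?triE.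
  have z3 : u3 (g [set o2; o3]) = 0 by apply: (out o3) => //; rewrite ?mem_E4 ?triE.
  rewrite /w z2 z3 -a01.
  have := val o0 u0 [set o2; o3] _ h0; rewrite mem_E4 triE => /(_ isT).
  by case=> ->.
have [C [WC nzC hC]] := Lsupp _ _ Lw wn.
have [|A WA eC] := Wsub _ WC.
  move=> y /hC nz; apply/existsP; apply: contraR nz; rewrite negb_exists => /forallP h.
  have := h0 y; have := h1 y; have := h2 y; have := h3 y.
  rewrite (negbTE (h o0)) (negbTE (h o1)) (negbTE (h o2)) (negbTE (h o3)) /w.
  by move=> -> -> -> ->.
have [_ _ hA] := k4liftP WA.
have fA (f : {set 'I_4}) : f \in E4 -> f != [set o0; o1] -> f != [set o2; o3] -> f \in A = false.
  move=> fE n1 n2; rewrite -hA // -eC; apply/negbTE/negP=> /hC.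
  by rewrite wf ?eqxx.
suff A0 : A = 0 by rewrite eC A0 k4lift0 eqxx in nzC.
apply: sub_E4_eq; [exact: W4S|exact: sub0set|rewrite /= !in_zero].
have := WA; rewrite W4E ?W4S //= (fA [set o0; o2]) ?(fA [set o0; o3]) ?(fA [set o1; o2])
  ?(fA [set o1; o3]) ?mem_E4 ?set2_eq //.
by do 2 case: (_ \in A).
Qed.

Lemma tight_series x : regular W -> x \in X ->
  (forall C, C \in W -> C \subset X :|: S -> x \notin C) \/
  exists2 s, s \in S & forall C, C \in W -> C \subset X :|: S -> (x \in C) = (s \in C).
Proof.
move=> rW xX; have [i xi] := regular_no_fano rW xX.
have inS e : e \in E4 -> (forall A, A \in W4 -> (x \in k4lift A) = (e \in A)) ->
    exists2 s, s \in S & forall C, C \in W -> C \subset X :|: S -> (x \in C) = (s \in C).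
  move=> eE h; exists (g e); first exact: imset_f.
  move=> C WC sC; have [A WA ->] := k4lift_exists WC sC.
  by have [_ _ ->] := k4liftP WA; rewrite ?h.
have hx A (WA : A \in W4) := mem_k4lift x WA.
(* If all three values were true, x would also lie in the lift of T_0 = T_1 + T_2 + T_3. Each other
   nonzero pattern is that of the one edge lying in the same triangles among T_1, T_2, T_3. *)
have : ~~ [&& x \in k4lift (tri o1), x \in k4lift (tri o2) & x \in k4lift (tri o3)].
  apply: contra xi => /and3P[x1 x2 x3]; elim/ord4_ind: i => //.
  by rewrite hx ?tri_W4 // x1 x2 x3 !triE.
case x1: (x \in k4lift (tri o1)) hx; case x2: (x \in k4lift (tri o2));
  case x3: (x \in k4lift (tri o3)) => // hx _.
- right; apply: (inS [set o0; o3]); rewrite ?mem_E4 // => A WA; rewrite hx //.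
  move: (WA); rewrite W4E ?W4S //= => /and4P[_ _ _].
  by do 4 case: (_ \in A).
- right; apply: (inS [set o0; o2]); rewrite ?mem_E4 // => A WA; rewrite hx //.
  move: (WA); rewrite W4E ?W4S //= => /and4P[_ _ h _]; move: h.
  by do 4 case: (_ \in A).
- right; apply: (inS [set o2; o3]); rewrite ?mem_E4 // => A WA; rewrite hx //.
  by rewrite !andbT !andbF !addbF.
- right; apply: (inS [set o0; o1]); rewrite ?mem_E4 // => A WA; rewrite hx //.
  move: (WA); rewrite W4E ?W4S //= => /and4P[_ h _ _]; move: h.
  by do 4 case: (_ \in A).
- right; apply: (inS [set o1; o3]); rewrite ?mem_E4 // => A WA; rewrite hx //.
  by rewrite !andbT !andbF !addbF.
- right; apply: (inS [set o1; o2]); rewrite ?mem_E4 // => A WA; rewrite hx //.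
  by rewrite !andbT !andbF !addFb.
left=> C WC sC; have [A WA ->] := k4lift_exists WC sC.
by rewrite hx // !andbF.
Qed.

End TightModel.

Lemma tight_model (T : finType) (W : {set {set T}}) (E X : {set T}) g :
  subspace W -> X \subset E -> k4model W X g ->
  exists X' : {set T}, [/\ X' \subset E, k4model W X' g & forall C, C \in W -> C \subset X' -> C = 0].
Proof.
move=> sW; elim: {X}_.+1 {-2}X (ltnSn #|X|) => // n IHn X ltX sX km.
case: (boolP [exists C in W, (C != 0) && (C \subset X)]) => [/exists_inP[C WC /andP[nz sC]]|].
  have /set0Pn[x xC] := nz; have xX := subsetP sC x xC.
  apply: (IHn (X :\ x)).
  - by rewrite ltnS (cardsD1 x X) xX in ltX.
  - by apply: subset_trans sX; apply: subsetDl.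
  have [injg dX hA] := km; split=> //; first by apply: disjointWl dX; apply: subsetDl.
  move=> A sA; split=> [/(hA A sA).1[Z sZ WZ]|[Z sZ WZ]]; last first.
    by apply/(hA A sA); exists Z => //; apply: subset_trans sZ (subsetDl _ _).
  case: (boolP (x \in Z)) => xZ; last by exists Z; rewrite // subsetD1 sZ.
  exists (Z + C); last by rewrite addrA subspaceD.
  by rewrite subsetD1 subset_add // in_add xZ xC.
move=> /exists_inPn h; exists X; split=> // C WC sC.
by have := h C WC; rewrite sC andbT negbK => /eqP.
Qed.

Lemma k4minor_series_minor (T : finType) (M : matroid T) (W : {set {set T}}) :
  cycle_space M W -> regular W -> k4minor W ->
  exists2 N, series_minor M N & isomorphic N MK4.
Proof.
move=> cs rW kW; have [sW WE _] := cs.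
have [X0 [g [sX0 km0]]] := k4minor_model WE kW.
have [X [sX km tX]] := tight_model sW sX0 km0; have [injg dX _] := km.
have gE := k4model_ground WE km.
have [|M1 [r1 cs1 g1]] :=
    @deletion_chain _ (@series_minor_step T) M W (~: (X :|: g @: E4)) _ cs.
  by move=> M1 N1; apply: Or31.
have inW1 C : C \in wdel W (~: (X :|: g @: E4)) -> C \in W /\ C \subset X :|: g @: E4.
  by rewrite inE disjoints_subset setCK => /andP[].
have gM1 : ground M1 = X :|: g @: E4.
  apply/setP=> x; rewrite g1 in_setD in_setC negbK in_setU.
  case: (boolP (x \in X)) => [/(subsetP sX)->//|_].
  by case: (boolP (x \in g @: E4)) => [/(subsetP gE)->|].
have [||| s /imsetP[e eE ->]|x xX|N [r2 cs2 g2]] :=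
    @series_chain _ M1 _ X (g @: E4) cs1; rewrite ?gM1 ?subsetUl ?subsetUr //.
- have [A WA eA] := E4_cycle eE; have [WL sL hL] := k4liftP km WA.
  by exists (k4lift W X g A); rewrite ?hL // inE WL disjoints_subset setCK.
- case: (tight_series sW km tX rW xX) => [h|[s sS h]]; [left|right; exists s => //];
    by move=> C /inW1[WC sC]; apply: h.
exists N; first exact: rt_trans r1 r2.
rewrite (k4model_con km) in cs2; apply: k4_isomorphic cs2 => //.
rewrite g2 gM1; apply/setP=> x; rewrite in_setD in_setU.
by case: (boolP (x \in X)) => //= /(disjointFr dX)->.
Qed.

(** * Dense and cosimple binary matroids *)

Section Span.
Variable I : finType.
Implicit Types (u v x y a b c : {set I}) (s m : seq {set I}) (p q : bool).

(** The span of s, with p recording the parity of the number of terms. Even combinations are what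
    the sums of consecutive vectors generate. *)
Fixpoint combp s p u : bool :=
  if s is x :: s' then combp s' p u || combp s' (~~ p) (u + x) else ~~ p && (u == 0).

Definition comb s u := combp s false u || combp s true u.

Fixpoint free_seq s : bool := if s is x :: s' then ~~ comb s' x && free_seq s' else true.

Lemma combpD s p q u v : combp s p u -> combp s q v -> combp s (p (+) q) (u + v).
Proof.
elim: s p q u v => [|x s IHs] p q u v /=.
  by case: p q => [] [] //= /eqP-> /eqP->; rewrite addr0.
move=> /orP[] hu /orP[] hv.
- by rewrite IHs.
- by rewrite -addrA -addbN (IHs _ _ _ _ hu hv) orbT.
- by rewrite addrAC -addNb (IHs _ _ _ _ hu hv) orbT.
- have -> : u + v = (u + x) + (v + x) by rewrite addrACA addSS addr0.
  by have := IHs _ _ _ _ hu hv; rewrite addNb addbN negbK => ->.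
Qed.

Lemma combp0 s : combp s false 0.
Proof. by elim: s => [|x s IHs] /=; rewrite ?eqxx ?IHs. Qed.

Lemma combp1 s x : x \in s -> combp s true x.
Proof.
elim: s => // y s IHs; rewrite in_cons => /predU1P[->|/IHs /= ->//].
by rewrite /= addSS combp0 orbT.
Qed.

Lemma comb0 s : comb s 0. Proof. by rewrite /comb combp0. Qed.

Lemma combp_comb s p u : combp s p u -> comb s u.
Proof. by rewrite /comb; case: p => ->; rewrite ?orbT. Qed.

Lemma combE s u : reflect (exists p, combp s p u) (comb s u).
Proof.
by apply: (iffP orP) => [[]|[[]]]; [exists false|exists true|right|left].
Qed.

Lemma combD s u v : comb s u -> comb s v -> comb s (u + v).
Proof. by move=> /combE[p hp] /combE[q hq]; apply: combp_comb (combpD hp hq). Qed.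

Lemma combDr s u v : comb s v -> comb s (u + v) = comb s u.
Proof.
move=> hv; apply/idP/idP=> [h|h]; last exact: combD.
by rewrite -(addSK u v) combD.
Qed.

Lemma combDl s u v : comb s u -> comb s (u + v) = comb s v.
Proof. by rewrite addrC; apply: combDr. Qed.

Lemma comb1 s x : x \in s -> comb s x.
Proof. by move/combp1/combp_comb. Qed.

Lemma comb_cons s x u : comb (x :: s) u = comb s u || comb s (u + x).
Proof.
by rewrite /comb /=; do 4 case: (combp _ _ _).
Qed.

Lemma comb_rcons s a u : comb (rcons s a) u = comb s u || comb s (u + a).
Proof.
elim: s u => [|x s IHs] u /=; first by rewrite comb_cons.
rewrite !comb_cons !IHs addrAC.
by do 4 case: (comb _ _).
Qed.

Lemma free_rcons s a : free_seq (rcons s a) = ~~ comb s a && free_seq s.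
Proof.
elim: s => [|x s IHs]; first by rewrite /= andbT.
rewrite /= IHs comb_rcons comb_cons [a + x]addrC.
by do 3 case: (comb _ _); case: (free_seq _).
Qed.

Lemma free_odd s : free_seq s -> ~~ combp s true 0.
Proof.
elim: s => //= x s IHs /andP[nx /IHs/negbTE->] /=; rewrite add0r.
by apply: contra nx; apply: combp_comb.
Qed.

Lemma free_seq_uniq s : free_seq s -> uniq s.
Proof.
elim: s => //= x s IHs /andP[nx /IHs->]; rewrite andbT.
by apply: contra nx; apply: comb1.
Qed.

(** When s lists the spokes of a fan, these are its rims. Contracting them identifies all the
    spokes. *)
Fixpoint rims s : seq {set I} :=
  if s is x :: s' then if s' is y :: _ then (x + y) :: rims s' else [::] else [::].

Lemma rims_comb s u : comb (rims s) u = combp s false u.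
Proof.
elim: s u => [|x [|y s] IHs] u; rewrite /comb ?orbF //=.
  by rewrite !orbF.
have := comb_cons (rims (y :: s)) (x + y) u; rewrite /comb /= => ->.
rewrite -/(comb _ _) -/(comb _ _) !IHs; congr (_ || _).
have hy : combp (y :: s) true y by apply: combp1; rewrite inE eqxx.
rewrite [RHS](_ : _ = combp (y :: s) true (u + x)) //.
apply/idP/idP=> h; last first.
  by have := combpD h hy; rewrite -addrA.
by have := combpD h hy; rewrite addrA addSK.
Qed.

End Span.

(** * Vector configurations containing a K4 *)

Section K4Vectors.
Variables (T I : finType) (rho : T -> {set I}) (F : {set T}).
Implicit Types (u v x y a b c : {set I}) (s m : seq {set I}).

(** The vector form of [k4model]; injectivity of g and disjointness from X are recovered in
    [k4rep_minor]. *)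
Definition k4rep := exists (X : {set T}) (g : {set 'I_4} -> T), [/\ X \subset F, forall e, e \in E4 -> g e \in F
  & forall A : {set {set 'I_4}}, A \subset E4 -> A \in W4 <->
      exists2 Z : {set T}, Z \subset X & \sum_(e in A) rho (g e) + \sum_(z in Z) rho z = 0].

Let R := rho @: F.

Definition bscale (p : bool) u := if p then u else 0.

Lemma in_bscale i p u : (i \in bscale p u) = p && (i \in u).
Proof. by case: p; rewrite //= in_zero. Qed.

(** Each edge ij avoiding vertex 0 is exchanged for the triangle 0ij. The coefficients of the edges
    at 0 become the degrees at 1, 2, 3, and the triangle sums vanish after contraction. *)
Lemma k4_regroup (x01 x02 x03 x12 x13 x23 : bool) (p01 p02 p03 p12 p13 p23 : {set I}) :
  bscale x01 p01 + bscale x02 p02 + bscale x03 p03 + bscale x12 p12 +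
    bscale x13 p13 + bscale x23 p23 =
  (bscale (x01 (+) x12 (+) x13) p01 + bscale (x02 (+) x12 (+) x23) p02 +
    bscale (x03 (+) x13 (+) x23) p03) +
  (bscale x12 (p01 + p02 + p12) + bscale x13 (p01 + p03 + p13) +
    bscale x23 (p02 + p03 + p23)).
Proof.
apply/setP=> i; rewrite !(in_add, in_bscale).
move: (i \in p01) (i \in p02) (i \in p03) (i \in p12) (i \in p13) (i \in p23).
by case: x12 x13 x23 => [] [] []; rewrite ?addbF ?addbT; case: x01 x02 x03 => [] [] [] [] [] [] [] [] [].
Qed.

Lemma comb_sum s u : {subset s <= R} ->
  reflect (exists2 Z : {set T}, Z \subset [set x in F | rho x \in s] & u = \sum_(z in Z) rho z)
    (comb s u).
Proof.
move=> sR; apply: (iffP idP) => [|[Z /subsetP sZ ->]]; last first.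
  elim/big_rec: _ => [|z v /sZ]; first exact: comb0.
  by rewrite inE => /andP[_ zs]; apply: combD; apply: comb1.
elim: s sR u => [|x s' IHs] sR u.
  by rewrite /comb /= orbF => /eqP->; exists set0; rewrite ?sub0set ?big_set0.
have mono (Z : {set T}) : Z \subset [set x in F | rho x \in s'] ->
    Z \subset [set y in F | rho y \in x :: s'].
  move=> sZ; apply: (subset_trans sZ); apply/subsetP=> z; rewrite !inE => /andP[-> ->].
  by rewrite orbT.
have sR' : {subset s' <= R} by move=> y ys; apply: sR; rewrite inE ys orbT.
rewrite comb_cons => /orP[/(IHs sR')[Z sZ ->]|/(IHs sR')[Z sZ eu]].
  by exists Z => //; apply: mono.
have /imsetP[t tF ex] : x \in R by apply: sR; rewrite inE eqxx.
exists (Z + [set t]).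
  by rewrite subset_add ?(mono _ sZ) // sub1set inE tF -ex inE eqxx.
by rewrite sum_addS -eu big_set1 -ex addSK.
Qed.

(* p_ij is the vector of the edge ij: modulo the contracted vectors rr, the six
   of them are the edge vectors of a K4. *)
Lemma k4_criterion (rr : seq {set I}) (p01 p02 p03 p12 p13 p23 : {set I}) : {subset rr <= R} ->
  {subset [:: p01; p02; p03; p12; p13; p23] <= R} ->
  comb rr (p01 + p02 + p12) -> comb rr (p01 + p03 + p13) -> comb rr (p02 + p03 + p23) ->
  (forall j k l, comb rr (bscale j p01 + bscale k p02 + bscale l p03) -> ~~ [|| j, k | l]) ->
  k4rep.
Proof.
move=> rrR pR t12 t13 t23 indep_p.
have ex p : p \in R -> exists2 t, t \in F & rho t = p by move/imsetP=> [t tF ->]; exists t.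
have [|t01 F01 e01] := ex p01; first by apply: pR; rewrite !inE eqxx ?orbT.
have [|t02 F02 e02] := ex p02; first by apply: pR; rewrite !inE eqxx ?orbT.
have [|t03 F03 e03] := ex p03; first by apply: pR; rewrite !inE eqxx ?orbT.
have [|t12' F12 e12] := ex p12; first by apply: pR; rewrite !inE eqxx ?orbT.
have [|t13' F13 e13] := ex p13; first by apply: pR; rewrite !inE eqxx ?orbT.
have [|t23' F23 e23] := ex p23; first by apply: pR; rewrite !inE eqxx ?orbT.
pose g (e : {set 'I_4}) := if e == [set o0; o1] then t01 else if e == [set o0; o2] then t02
  else if e == [set o0; o3] then t03 else if e == [set o1; o2] then t12'
  else if e == [set o1; o3] then t13' else t23'.
exists [set x in F | rho x \in rr], g; split=> [|e _|A sA].
- by apply/subsetP=> x; rewrite inE => /andP[].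
- by rewrite /g; do ?case: ifP.
suff hA : A \in W4 <-> comb rr (\sum_(e in A) rho (g e)).
  apply: (iff_trans hA).
  split=> [/(comb_sum _ rrR)[Z sZ ->]|[Z sZ /eqP]]; first by exists Z; rewrite ?addSS.
  by rewrite addS_eq0 => /eqP e; apply/(comb_sum _ rrR); exists Z.
have -> : \sum_(e in A) rho (g e) = \sum_(e in E4) bscale (e \in A) (rho (g e)).
  rewrite [RHS](bigID (mem A)) /= [X in _ = _ + X]big1 => [|e /andP[_ /negbTE->//]].
  rewrite addr0; apply: eq_big => [e|e ->//].
  by case: (boolP (e \in A)) => [/(subsetP sA)->|]; rewrite ?andbF.
rewrite sum_E4 /g !set2_eq /= e01 e02 e03 e12 e13 e23 W4E //=.
set x01 := _ \in A; set x02 := _ \in A; set x03 := _ \in A.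
set x12 := _ \in A; set x13 := _ \in A; set x23 := _ \in A.
have sc k u : comb rr u -> comb rr (bscale k u) by case: k => //= _; apply: comb0.
pose w := bscale (x01 (+) x12 (+) x13) p01 + bscale (x02 (+) x12 (+) x23) p02 +
  bscale (x03 (+) x13 (+) x23) p03.
pose d := bscale x12 (p01 + p02 + p12) + bscale x13 (p01 + p03 + p13) +
  bscale x23 (p02 + p03 + p23).
have combd : comb rr d by rewrite /d !combD ?sc.
have -> : bscale x01 p01 + bscale x02 p02 + bscale x03 p03 + bscale x12 p12 +
    bscale x13 p13 + bscale x23 p23 = w + d.
  exact: k4_regroup.
rewrite combDr //; split=> [/and4P[h0 h1 h2 h3]|/indep_p].
  rewrite /w (negbTE h1) [x02 (+) x12 (+) x23](negbTE h2).
  by rewrite [x03 (+) x13 (+) x23](negbTE h3) /bscale /= !addr0 comb0.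
rewrite -/x01; move: x01 x02 x03 x12 x13 x23 {w d combd}.
by do 6 case.
Qed.

End K4Vectors.

(** * Fans, and the density that forces a K4 *)

Section Dirac.
Variables (T I : finType).
Implicit Types (rho : T -> {set I}) (F : {set T}).
Implicit Types (u v x y a b c t : {set I}) (s m : seq {set I}).

(** The entries of s are spokes, and two consecutive spokes form a triangle with a rim in R. *)
Definition fan (R : {set {set I}}) s :=
  all (mem R) s && sorted (fun x y => x + y \in R) s.

Lemma rims_sub (R : {set {set I}}) s : fan R s -> {subset rims s <= R}.
Proof.
case/andP=> _; elim: s => [|x [|y s] IHs] //= /andP[xy /IHs h] z.
by rewrite in_cons => /predU1P[->|/h].
Qed.

(* The spokes are c, the head y of m, ..., and the last element of m that occurs
   in v; contracting the rims between the inner ones leaves K4. *)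
Lemma fan_k4 rho F c m y v : let R := rho @: F in
  fan R (c :: y :: m) -> free_seq (c :: y :: m) -> comb (y :: m) v -> v != 0 -> v != y ->
  v \in R -> v + c \in R -> k4rep rho F.
Proof.
move=> R fanR fr hv nz ny vR vcR.
elim/last_ind: m fanR fr hv => [|m a IHm] fanR fr hv.
  by move: hv; rewrite comb_cons /comb /= !orbF addS_eq0 (negbTE nz) (negbTE ny).
have eqr : c :: y :: rcons m a = rcons (c :: y :: m) a by [].
have fan' : fan R (c :: y :: m).
  move: fanR; rewrite /fan eqr all_rcons => /andP[/andP[_ ->]] /=.
  by rewrite rcons_path => /andP[-> /andP[->]].
have := fr; rewrite eqr free_rcons => /andP[ha fr'].
(* If v does not involve the last spoke a, the fan is shortened. *)
case: (boolP (comb (y :: m) v)) => [hv'|nhv]; first exact: IHm.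
have {}hv : comb (y :: m) (v + a).
  by move: hv; rewrite -rcons_cons comb_rcons (negbTE nhv).
pose b := last y m; pose rr := rims (y :: m).
have bm : b \in y :: m by apply: mem_last.
have [allR] := andP fanR; rewrite /= rcons_path => /andP[cyR /andP[_ baR]].
have inR x : x \in c :: y :: rcons m a -> x \in R by move/(allP allR).
have [cR yR] : c \in R /\ y \in R by split; apply: inR; rewrite !inE eqxx ?orbT.
have aR : a \in R by apply: inR; rewrite !inE mem_rcons inE eqxx !orbT.
have bR : b \in R.
  by apply: inR; rewrite inE -rcons_cons mem_rcons !inE; move: bm; rewrite inE => ->; rewrite !orbT.
have rrR : {subset rr <= R}.
  by apply: rims_sub; move: fan'; rewrite /fan /= => /andP[/andP[_ ->] /andP[_ ->]].
have ba : b + a \in R by [].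
have {}cyR : c + y \in R by [].
have frm : free_seq (y :: m) by case/andP: fr'.
have by_ : comb rr (b + y).
  rewrite rims_comb -[false]/(true (+) true); apply: combpD; first exact: combp1.
  by apply: combp1; rewrite inE eqxx.
have nb : ~~ comb rr b.
  rewrite rims_comb; apply/negP=> hb; have := combpD hb (combp1 bm).
  by rewrite addSS; apply/negP/free_odd.
have rrm u : comb rr u -> comb (y :: m) u by rewrite rims_comb; apply: combp_comb.
have bcm k : comb (y :: m) (bscale k b) by case: k; [apply: comb1|apply: comb0].
have nc u : comb (y :: m) u -> ~~ comb (y :: rcons m a) (c + u).
  move=> hu; rewrite combDr; first by case/andP: fr.
  by rewrite -rcons_cons comb_rcons hu.
have na : ~~ comb (y :: m) a by apply: contra ha => h; rewrite comb_cons h.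
have wide u : comb (y :: m) u -> comb (y :: rcons m a) u.
  by rewrite -rcons_cons comb_rcons => ->.
have aw : comb (y :: rcons m a) a by apply: comb1; rewrite inE mem_rcons !inE eqxx !orbT.
have yw : comb (y :: rcons m a) y by apply: comb1; rewrite inE eqxx.
have ncw : ~~ comb (y :: rcons m a) c by case/andP: fr.
have scale s k u : comb s u -> comb s (bscale k u).
  by case: k => // _; apply: comb0.
(* The third vector is c or c + y, as required by the two cases below. *)
have indep_abc (d : bool) j k l :
    comb rr (bscale j a + bscale k b + bscale l (c + bscale d y)) -> ~~ [|| j, k | l].
  case: l => /= h.
    case/negP: ncw; move/rrm/wide: h.
    have hab := combD (scale _ j _ aw) (wide _ (bcm k)).
    by rewrite (combDl _ hab) (combDr _ (scale _ _ _ yw)).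
  rewrite addr0 in h; case: j h => [/rrm|].
    by rewrite combDr ?bcm //= (negbTE na).
  by rewrite /= add0r; case: k => // /(negP nb).
have [p hp] : exists p, combp (y :: m) p (v + a) by apply/combE.
have eqba : a + b + (b + a) = 0 by rewrite [b + a]addrC addSS.
have bcy : b + c + (c + y) = b + y by rewrite -addrA addKS.
(* Modulo the contracted rims all of y, ..., b are equal, so v becomes a + b or a according to the
   parity p. Then v + c closes a K4 with a, b, c + y and c in different roles. *)
case: p hp => hp.
  have va : comb rr (v + a + b).
    by rewrite rims_comb -[false]/(true (+) true); apply: combpD hp _; apply: combp1.
  apply: (@k4_criterion _ _ _ _ rr a b (c + y) (b + a) (v + c) c) => //.
  - by apply/allP; rewrite /= aR bR cyR ba vcR cR.
  - by rewrite eqba comb0.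
  - have -> : a + (c + y) + (v + c) = (v + a + b) + (b + y).
      rewrite -!addrA [b + (b + y)]addKS [c + _]addrC -!addrA [c + _]addrC.
      by rewrite ![_ + c]addrC !addrA addSK addrC !addrA.
    exact: combD.
  - have -> : b + (c + y) + c = b + y by rewrite -addrA [c + y]addrC -addrA addSS addr0.
    exact: by_.
  - by move=> j k l h; apply: (indep_abc true).
apply: (@k4_criterion _ _ _ _ rr a b c (b + a) (v + c) (c + y)) => //.
- by apply/allP; rewrite /= aR bR cyR ba vcR cR.
- by rewrite eqba comb0.
- have -> : a + c + (v + c) = v + a by rewrite addrACA [a + v]addrC addSS addr0.
  by rewrite rims_comb.
- by rewrite bcy.
- by move=> j k l h; apply: (indep_abc false); rewrite /bscale /= addr0.
Qed.

(** The second hypothesis gives through each y a triangle other than the one through t. Taking for t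
    the spoke next to c, the new triangle at c either prolongs the fan or closes it up to a K4. *)
Lemma fan_extend rho F c m : let R := rho @: F in 0 \notin R ->
  (forall y t, y \in R -> exists v, [/\ v \in R, y + v \in R, v != t & v != t + y]) ->
  fan R (c :: m) -> free_seq (c :: m) ->
  k4rep rho F \/ exists v, fan R [:: v, c & m] /\ free_seq [:: v, c & m].
Proof.
move=> R n0 hR fanR fr.
have cR : c \in R by case/andP: fanR => /andP[].
have [v [vR cvR vt vtc]] := hR c (head 0 m) cR.
case: (boolP (comb (c :: m) v)) => [hv|nv]; last first.
  right; exists v; rewrite /= nv; split=> //; move: fanR.
  by rewrite /fan /= vR [v + c]addrC cvR.
(* The triangle {c, v, v + c} is symmetric in v and v + c, and one of the two lies in the span of
   m. *)
left; suff [w [wR wcR wt hw]] : exists w, [/\ w \in R, w + c \in R, w != head 0 m & comb m w].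
  have nzw : w != 0 by apply: contraNneq n0 => <-.
  case: m fanR fr hv vt vtc wt hw => [|y m] fanR fr hv vt vtc wt hw.
    by move: hw; rewrite /comb /= orbF (negbTE nzw).
  exact: (fan_k4 fanR fr hw).
move: hv; rewrite comb_cons => /orP[hv|hv].
  by exists v; rewrite [v + c]addrC.
exists (v + c); rewrite addSK [v + c]addrC cvR; split=> //.
  by apply: contra vtc => /eqP<-; rewrite addrAC addSS add0r.
by rewrite addrC.
Qed.

(** A free sequence has no repetition, so its length is bounded and a fan cannot be prolonged
    forever. *)
Lemma two_triangles_k4 rho F : let R := rho @: F in 0 \notin R -> F != set0 ->
  (forall y t, y \in R -> exists v, [/\ v \in R, y + v \in R, v != t & v != t + y]) ->
  k4rep rho F.
Proof.
move=> R n0 /set0Pn[f fF] hR.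
have chain n : k4rep rho F \/ exists s, [/\ size s = n.+1, fan R s & free_seq s].
  elim: n => [|n [h|[s [sz fanR fr]]]]; [right|by left|case: s => // c m in sz fanR fr *].
    have fR : rho f \in R by apply: imset_f.
    exists [:: rho f]; rewrite /fan /= fR /comb /= orbF; split=> //.
    by rewrite andbT; apply: contraNneq n0 => <-.
  have [h|[v [fanv frv]]] := fan_extend n0 hR fanR fr; [by left|right].
  by exists [:: v, c & m]; rewrite /= -sz.
have [//|[s [sz _ fr]]] := chain #|{: {set I}}|.
have := card_uniqP (free_seq_uniq fr) => cs.
by have := max_card (mem s); rewrite cs sz ltnn.
Qed.

(** Clearing the coordinate i by means of [rho e] is linear with kernel {0, [rho e]}: it contracts
    e. A sum that vanishes afterwards vanishes before, possibly after adding e to Z. *)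
Lemma contract_k4rep rho F (F' : {set T}) e i : e \in F -> F' \subset F -> i \in rho e ->
  k4rep (fun x : T => if i \in rho x then rho x + rho e else rho x) F' -> k4rep rho F.
Proof.
move=> eF sF ie [X [g [sX gF hA]]].
pose pi u := if i \in u then u + rho e else u.
have piD u v : pi (u + v) = pi u + pi v.
  rewrite /pi in_add; case: (i \in u); case: (i \in v) => //=.
  - by rewrite addrACA addSS addr0.
  - by rewrite addrAC.
  - by rewrite addrA.
have pi0 u : pi u = 0 <-> u = 0 \/ u = rho e.
  split=> [|[->|->]]; rewrite /pi; first last.
  - by rewrite ie addSS.
  - by rewrite in_zero.
  by case: ifP => _ => [/eqP|]; [rewrite addS_eq0 => /eqP|]; auto.
have pi_sum (P : {set T}) (h : T -> {set I}) : \sum_(x in P) pi (h x) = pi (\sum_(x in P) h x).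
  by rewrite (big_morph pi piD (id1 := 0)) // /pi in_zero.
have pi_sumE (P : {set {set 'I_4}}) (h : {set 'I_4} -> {set I}) :
    \sum_(x in P) pi (h x) = pi (\sum_(x in P) h x).
  by rewrite (big_morph pi piD (id1 := 0)) // /pi in_zero.
exists (e |: X), g; split=> [|f /gF/(subsetP sF)//|A sA].
  by rewrite subUset sub1set eF (subset_trans sX sF).
apply: (iff_trans (hA A sA)); split=> [[Z sZ]|[Z sZ sum0]].
  rewrite (pi_sumE A (fun f => rho (g f))) (pi_sum Z rho) -piD => /pi0[h|h].
    by exists Z => //; apply: subset_trans sZ (subsetUr _ _).
  exists (Z + [set e]).
    rewrite subset_add ?sub1set ?setU11 //.
    by apply: subset_trans sZ (subsetUr _ _).
  by rewrite sum_addS big_set1 addrA h addSS.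
have pie : pi (rho e) = 0 by apply/pi0; right.
have XZ : Z :\ e \subset X.
  apply/subsetP=> x; rewrite !inE => /andP[ne /(subsetP sZ)].
  by rewrite !inE (negbTE ne).
exists (Z :\ e) => //; rewrite (pi_sumE A (fun f => rho (g f))) (pi_sum (Z :\ e) rho) -piD.
case: (boolP (e \in Z)) => eZ; last first.
  have -> : Z :\ e = Z by apply/setDidPl; rewrite disjoint_sym disjoints1.
  by rewrite sum0 /pi in_zero.
rewrite (big_setD1 e eZ) /= addrCA in sum0.
have pi_e u : pi u = pi (rho e + u) by rewrite piD pie add0r.
by rewrite pi_e sum0 /pi in_zero.
Qed.

(* With |B| = n - 1 this is the fact that a simple graph with n >= 2 vertices
   and at least 2n - 2 edges has a K4 minor. *)
Lemma dense_k4rep rho F (B : {set I}) : F != set0 -> {in F &, injective rho} ->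
  (forall y : T, y \in F -> rho y != 0 /\ rho y \subset B) -> (2 * #|B| <= #|F|)%N ->
  k4rep rho F.
Proof.
elim: {B}_.+1 {-2}B (ltnSn #|B|) rho F => // n IHn B ltB rho F nzF inj hB dense.
set R := rho @: F.
have n0 : 0 \notin R by apply/imsetP=> -[y /hB[nz _] e]; rewrite -e eqxx in nz.
case: (boolP [forall y in R, forall t : {set I}, exists v in R,
    [&& y + v \in R, v != t & v != t + y]]) => [/forall_inP h|].
  apply: two_triangles_k4 => // y t /h/forallP/(_ t)/exists_inP[v vR /and3P[]].
  by exists v.
move/forall_inPn=> [_ /imsetP[e eF ->] /forallPn[t /exists_inPn ht]].
have [nze seB] := hB e eF; have /set0Pn[i ie] := nze.
have iB := subsetP seB i ie.
(* The only possible triangle at e is the one through t. Contracting e makes t and t + e parallel,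
   so t is deleted: at most two elements are lost for one dimension, which preserves the density. *)
pose F' := [set y in F | (y != e) && (rho y != t)].
have sF : F' \subset F by apply/subsetP=> y; rewrite inE => /andP[].
apply: (contract_k4rep eF sF ie).
have cF : (#|F| <= #|F'| + 2)%N.
  have sub : F \subset F' :|: (e |: [set y in F | rho y == t]).
    apply/subsetP=> y yF; rewrite !inE yF /=.
    by case: (y == e) => //=; rewrite ?orbT //; case: (rho y == t).
  apply: leq_trans (subset_leq_card sub) _; apply: leq_trans (leq_card_setU _ _) _.
  rewrite leq_add2l; apply: leq_trans (leq_card_setU _ _) _; rewrite cards1.
  rewrite -(leq_add2l 1) // !add1n !ltnS.
  apply/card_le1_eqP=> x y; rewrite !inE => /andP[xF /eqP ex] /andP[yF /eqP ey].
  by apply: inj => //; rewrite ex ey.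
have cB : #|B| = #|B :\ i|.+1 by rewrite (cardsD1 i B) iB.
have inF' (y : T) : y \in F' -> [/\ y \in F, y != e & rho y != t].
  by rewrite inE => /and3P[].
have pi0 u v : (if i \in u then u + rho e else u) = (if i \in v then v + rho e else v) ->
    u = v \/ u = v + rho e.
  case: ifP => iu; case: ifP => iv; last by left.
  - by move/(congr1 (fun z => z + rho e)); rewrite !addSK; left.
  - by move=> <-; rewrite addSK; right.
  - by move=> ->; right.
apply: (IHn (B :\ i)).
- by rewrite -ltnS -cB.
(* If B is reduced to i, the at least two elements of F would all have the vector [set i], against
   injectivity. *)
- case: (posnP #|B :\ i|) => [cB0|cB1]; last first.
    by rewrite -card_gt0 -(ltn_add2r 2); apply: leq_trans cF; apply: leq_trans dense; rewrite cB; lia.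
  have Bi : B = [set i] by apply/eqP; rewrite eq_sym eqEcard sub1set iB cards1 cB cB0.
  have : (1 < #|F|)%N by apply: leq_trans dense; rewrite cB; lia.
  case/card_gt1P=> x [y [xF yF]] /negP[]; apply/eqP/inj => //.
  have rB (z : T) : z \in F -> rho z = [set i].
    move=> zF; have [nz] := hB z zF; rewrite Bi subset1 => /orP[/eqP//|].
    by rewrite -[set0]/(0 : {set I}) (negbTE nz).
  by rewrite !rB.
- move=> x y /inF'[xF xe xt] /inF'[yF ye yt] /pi0[|exy]; first exact: inj.
  have /ht := imset_f rho xF; rewrite exy addrCA addSS addr0 imset_f //=.
  rewrite -exy xt /= negbK => /eqP ext; case/negP: yt; apply/eqP.
  by move: exy; rewrite ext => /(congr1 (fun z => z + rho e)); rewrite !addSK.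
- move=> y /inF'[yF ye yt]; have [nzy syB] := hB y yF; split.
    apply/eqP=> h; have [|//|] := pi0 (rho y) 0; rewrite ?h ?in_zero //.
      by move/eqP; rewrite (negbTE nzy).
    by rewrite add0r => /(inj _ _ yF eF)/eqP; rewrite (negbTE ye).
  case: ifP => iy; rewrite subsetD1.
    by rewrite subset_add //= in_add iy ie.
  by rewrite syB iy.
- by move: dense cF; rewrite cB; lia.
Qed.

End Dirac.

(** * Binary matroids without loops, coloops, parallel pairs and series pairs *)

Section SeriesParallel.
Variable T : finType.
Implicit Types (C D B E X Y Z : {set T}) (W U : {set {set T}}) (rho : T -> {set T}).
Implicit Types (x y : T).

(** Two edges with the same image would form a cycle of K4, and an edge mapped into X would be a
    loop of K4; so the vectors give a genuine model. *)
Lemma k4rep_minor U E rho :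
  (forall C, C \subset E -> C \in U <-> \sum_(y in C) rho y = 0) ->
  k4rep rho E -> k4minor U.
Proof.
move=> hU [X [g [sX gE hA]]].
have n1 (e : {set 'I_4}) : e \in E4 -> [set e] \notin W4.
  move=> /edgeP[i [j [_ ->]]]; apply/negP=> /even_setsP[_].
  by rewrite big_set1 => /setP/(_ i); rewrite !inE eqxx.
have injg : {in E4 &, injective g}.
  move=> e f eE fE eg; apply/eqP; rewrite -addS_eq0; apply/eqP.
  have [//|ne] := eqVneq e f; first by move=> ->; rewrite addSS.
  have sef : [set e; f] \subset E4 by rewrite subUset !sub1set eE fE.
  have /even_setsP[_] : [set e; f] \in W4.
    apply/(hA _ sef); exists set0; rewrite ?sub0set // big_set0 addr0.
    by rewrite big_setU1 ?inE //= big_set1 eg addSS.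
  by rewrite big_setU1 ?inE //= big_set1.
have dX : [disjoint X & g @: E4].
  rewrite disjoint_sym disjoints_subset; apply/subsetP=> _ /imsetP[e eE ->].
  rewrite inE; apply: contra (n1 e eE) => gX; apply/hA; first by rewrite sub1set.
  by exists [set g e]; rewrite ?sub1set // !big_set1 addSS.
apply: (@k4model_minor _ U X g); split=> // A sA; apply: (iff_trans (hA A sA)).
have sgA : g @: A \subset E.
  by apply/subsetP=> _ /imsetP[e eA ->]; apply: gE; apply: (subsetP sA).
have eqs : \sum_(y in g @: A) rho y = \sum_(e in A) rho (g e).
  rewrite big_imset // => e f eA fA.
  by apply: injg; apply: (subsetP sA).
split=> -[Z sZ h]; exists Z => //.
  by apply/hU; rewrite ?subset_add ?(subset_trans sZ sX) // sum_addS eqs.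
by rewrite -eqs -sum_addS; apply/hU; rewrite ?subset_add ?(subset_trans sZ sX).
Qed.

(** Adding the fundamental cycles of the elements of C turns C into the sum of the [rho y] modulo U.
    That sum lies inside B, where 0 is the only member of U. *)
Lemma fundamental_rep U E B rho : subspace U ->
  (forall y, y \in E -> rho y \subset B /\ [set y] + rho y \in U) ->
  (forall C, C \in U -> C \subset B -> C = 0) ->
  forall C, C \subset E -> C \in U <-> \sum_(y in C) rho y = 0.
Proof.
move=> sU hr hB C sC.
have h : C + \sum_(y in C) rho y \in U.
  rewrite -{1}(sum_set1 C) -big_split; apply: subspace_sum => // y yC.
  by have [] := hr y (subsetP sC y yC).
split=> [UC|s0]; last by move: h; rewrite s0 addr0.
apply: hB; first by rewrite -(subspaceDl _ sU UC).
by apply: subset_sum => y yC; have [] := hr y (subsetP sC y yC).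
Qed.

Lemma dense_k4minor U E B rho : subspace U -> E != set0 ->
  (forall y, y \in E -> [set y] \notin U) ->
  (forall x y, x \in E -> y \in E -> x != y -> [set x; y] \notin U) ->
  (forall y, y \in E -> rho y \subset B /\ [set y] + rho y \in U) ->
  (forall C, C \in U -> C \subset B -> C = 0) ->
  (2 * #|B| <= #|E|)%N -> k4minor U.
Proof.
move=> sU nzE noloop nopar hr hB dense; have hU := fundamental_rep sU hr hB.
apply: (k4rep_minor hU); apply: (dense_k4rep (B := B)) => // [x y xE yE exy|y yE].
  apply/eqP; apply/negPn/negP=> ne; case/negP: (nopar x y xE yE ne).
  apply/hU; first by rewrite subUset !sub1set xE yE.
  by rewrite big_setU1 ?inE //= big_set1 exy addSS.
split; last by have [] := hr y yE.
apply: contra (noloop y yE) => /eqP r0; apply/hU; first by rewrite sub1set.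
by rewrite big_set1.
Qed.

(* Either the rank or the corank is at most |E| / 2, so that dense_k4minor
   applies to W or to its dual. *)
Lemma simple_cosimple_k4minor W E : subspace W -> (forall C, C \in W -> C \subset E) ->
  E != set0 ->
  (forall y, y \in E -> [set y] \notin W) ->
  (forall x y, x \in E -> y \in E -> x != y -> [set x; y] \notin W) ->
  (forall y, y \in E -> exists2 C, C \in W & y \in C) ->
  (forall x y, x \in E -> y \in E -> x != y -> exists2 C, C \in W & (x \in C) != (y \in C)) ->
  k4minor W.
Proof.
move=> sW WE nzE noloop nopar nocoloop noseries.
pose P B := (B \subset E) && [forall C in W, (C \subset B) ==> (C == 0)].
have P0 : P set0.
  by rewrite /P sub0set; apply/forall_inP=> C _; apply/implyP; rewrite subset0.
have [B /maxsetP[/andP[sB /forall_inP hB']] maxB _] := maxset_exists P0.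
have hB C : C \in W -> C \subset B -> C = 0.
  by move=> WC sC; apply/eqP; have := hB' C WC; rewrite sC.
pose rho y := odflt 0 [pick R : {set T} | (R \subset B) && ([set y] + R \in W)].
have hr y : y \in E -> rho y \subset B /\ [set y] + rho y \in W.
  move=> yE; rewrite /rho; case: pickP => [R /andP[]//|no]; exfalso.
  case: (boolP (y \in B)) => yB.
    by have := no [set y]; rewrite sub1set yB addSS subspace0.
  suff : P (y |: B) by move/maxB/(_ (subsetUr _ _))=> eB; rewrite -eB setU11 in yB.
  rewrite /P subUset sub1set yE sB; apply/forall_inP=> C WC; apply/implyP=> sC.
  case: (boolP (y \in C)) => yC; last first.
    apply/eqP/hB => //; apply/subsetP=> z zC; have := subsetP sC z zC; rewrite !inE.
    by case: eqP zC => // ->; rewrite (negbTE yC).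
  have := no ([set y] + C); rewrite addKS WC andbT => /negbT/subsetPn[z].
  rewrite in_add inE; have [->|ne] := eqVneq z y; first by rewrite yC.
  by move=> /(subsetP sC); rewrite !inE (negbTE ne) /= => ->.
have rB x : x \in B -> rho x = [set x].
  move=> xB; have [sr Wr] := hr x (subsetP sB x xB); apply/eqP; rewrite -addS_eq0 addrC.
  by apply/eqP/hB => //; rewrite subset_add // sub1set.
have [le|gt] := leqP (2 * #|B|) #|E|; first exact: (dense_k4minor sW nzE noloop nopar hr hB).
apply: (k4minor_dual sW WE); have sD := wdual_subspace E W.
(* The fundamental cocycles with respect to the complement of B, that is, the transposed matrix. *)
pose rho' x := if x \in B then [set y in E :\: B | x \in rho y] else [set x].
have hW := fundamental_rep sW hr hB.
apply: (@dense_k4minor _ E (E :\: B) rho') => // [y yE|x y xE yE ne|x xE|D /wdualP[sDE hD] sDB|].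
- have [C WC yC] := nocoloop y yE; apply/negP=> /wdualP[_ /(_ C WC)].
  by rewrite dotSC dotS1 yC.
- have [C WC neC] := noseries x y xE yE ne; apply/negP=> /wdualP[_ /(_ C WC)].
  by rewrite dotSC dotS2 //; move: neC; case: (x \in C); case: (y \in C).
- rewrite /rho'; case: (boolP (x \in B)) => xB; last first.
    by rewrite sub1set inE xB xE addSS subspace0.
  split; first by apply/subsetP=> y; rewrite inE => /andP[].
  apply/wdualP; split=> [|C WC].
    by rewrite subset_add ?sub1set //; apply/subsetP=> y; rewrite inE => /andP[/setDP[]].
  have s0 := (hW C (WE C WC)).1 WC.
  (* Row x of the vanishing sum is the orthogonality of C to the cocycle of x. *)
  have : x \in \sum_(y in C) rho y = false by rewrite s0 in_zero.
  rewrite in_sum (bigID (mem B)) /= dotSC dotSDr dotS1.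
  have -> : \sum_(y in C | y \in B) (x \in rho y) = (x \in C) :> bool.
    case: (boolP (x \in C)) => xC.
      rewrite (bigD1 x) ?xC //= rB // inE eqxx big1 // => y /andP[/andP[_ yB] ne].
      by rewrite rB // inE eq_sym (negbTE ne).
    rewrite big1 // => y /andP[yC yB]; rewrite rB // inE.
    by apply/negbTE; apply: contraNneq xC => ->.
  have -> : \sum_(y in C | y \notin B) (x \in rho y) =
      dotS C [set y in E :\: B | x \in rho y] :> bool.
    rewrite dotSE big_mkcondr; apply: eq_bigr => y yC.
    by rewrite !inE (subsetP (WE C WC)) // andbT; case: (y \in B).
  by move=> h; apply/negbT.
- apply/eqP/set0Pn=> -[y yD]; have yE := subsetP sDE y yD.
  have [sr Wr] := hr y yE; have := hD _ Wr; rewrite dotSDr dotS1 yD /dotS.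
  suff -> : D :&: rho y = set0 by rewrite cards0.
  apply/setP=> z; rewrite !inE; apply/negP=> /andP[/(subsetP sDB)].
  by rewrite inE => /andP[zB _] /(subsetP sr); rewrite (negbTE zB).
- have := cardsID B E; rewrite (setIidPr sB); lia.
Qed.

End SeriesParallel.

(** * Quadratic moves *)

Lemma connect_simulation (A B : finType) (RA : rel A) (RB : rel B) (L : A -> B -> Prop) :
  (forall a b b', L a b -> RB b b' -> exists2 a', connect RA a a' & L a' b') ->
  forall a b b', L a b -> connect RB b b' -> exists2 a', connect RA a a' & L a' b'.
Proof.
move=> step a b b' Lab /connectP[p]; elim: p a b Lab => [|b1 p IHp] a b Lab /=.
  by move=> _ ->; exists a.
case/andP=> bb1 pth eb'; have [a1 aa1 La1] := step _ _ _ Lab bb1.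
have [a' a1a' La'] := IHp _ _ La1 pth eb'.
by exists a' => //; apply: connect_trans a1a'.
Qed.

Lemma connect_crossing (A : finType) (R : rel A) (P : pred A) a b :
  connect R a b -> P a -> ~~ P b ->
  exists u v, [/\ connect R a u, R u v, P u & ~~ P v].
Proof.
move=> /connectP[p]; elim: p a => [|a1 p IHp] a /=; first by move=> _ -> ->.
case/andP=> aa1 pth eb Pa Pb; case: (boolP (P a1)) => Pa1; last first.
  by exists a, a1.
have [u [v [au uv Pu Pv]]] := IHp _ pth eb Pa1 Pb.
by exists u, v; split=> //; apply: connect_trans (connect1 aa1) au.
Qed.

Lemma connect_invariant (A : finType) (R : rel A) (P : A -> Prop) a b :
  (forall x y, P x -> R x y -> P y) -> connect R a b -> P a -> P b.
Proof.
move=> step /connectP[p]; elim: p a => [|a1 p IHp] a /=; first by move=> _ ->.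
by case/andP=> aa1 pth eb Pa; apply: (IHp a1) => //; apply: step aa1.
Qed.

Section Configurations.
Variable T : finType.
Implicit Types (C D E X Y K : {set T}) (W : {set {set T}}) (x y e f : T).

(* A tuple of cycles stands for the monomial that is the product of its variables
   x_C; the image of this monomial is determined by d and the column sums. *)
Definition inW W d (c : {ffun 'I_d -> {set T}}) := forall i, c i \in W.

Definition colsum d (c : {ffun 'I_d -> {set T}}) x : nat := (\sum_(i < d) (x \in c i))%N.

Definition swap d (c : {ffun 'I_d -> {set T}}) (i j : 'I_d) D : {ffun 'I_d -> {set T}} :=
  [ffun k => if (k == i) || (k == j) then c k + D else c k].

Definition mv W d : rel {ffun 'I_d -> {set T}} := fun c c' =>
  [exists i, exists j, exists D in W, (D \subset c i + c j) && (c' == swap c i j D)].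

Definition quadratic W := forall d (c c' : {ffun 'I_d -> {set T}}),
  inW W c -> inW W c' -> colsum c =1 colsum c' -> connect (@mv W d) c c'.

Lemma mvP W d (c c' : {ffun 'I_d -> {set T}}) :
  reflect (exists i j D, [/\ D \in W, D \subset c i + c j & c' = swap c i j D]) (mv W c c').
Proof.
apply: (iffP existsP) => [[i /existsP[j /exists_inP[D WD /andP[sD /eqP->]]]]|].
  by exists i, j, D.
case=> i [j [D [WD sD ->]]]; exists i; apply/existsP; exists j; apply/exists_inP.
by exists D; rewrite // sD eqxx.
Qed.

Lemma mv_swap W d (c : {ffun 'I_d -> {set T}}) (i j : 'I_d) D :
  D \in W -> D \subset c i + c j -> connect (@mv W d) c (swap c i j D).
Proof. by move=> WD sD; apply/connect1/mvP; exists i, j, D. Qed.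

(** A move with i = j is permitted and changes nothing. *)
Lemma swap_id d (c : {ffun 'I_d -> {set T}}) i D : D \subset c i + c i -> D = 0.
Proof. by rewrite addSS subset0 => /eqP. Qed.

Lemma mv_inW W d (c c' : {ffun 'I_d -> {set T}}) :
  subspace W -> inW W c -> mv W c c' -> inW W c'.
Proof.
move=> sW Wc /mvP[i [j [D [WD sD ->]]]] k; rewrite ffunE.
by case: ifP => // _; rewrite subspaceD.
Qed.

(** The old values at i and j stand on the left, which avoids subtraction of natural numbers. *)
Lemma sum_swap d (c : {ffun 'I_d -> {set T}}) (i j : 'I_d) D (F : {set T} -> nat) : i != j ->
  (\sum_(k < d) F (swap c i j D k) + (F (c i) + F (c j)) =
   \sum_(k < d) F (c k) + (F (c i + D)%R + F (c j + D)%R))%N.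
Proof.
move=> ne; have ne' : j != i by rewrite eq_sym.
rewrite (bigD1 i) //= (bigD1 j ne') /= [in RHS](bigD1 i) //= [in RHS](bigD1 j ne') /=.
rewrite !ffunE !eqxx orbT /=.
have regroup (a b p q S S' : nat) : S = S' -> (a + (b + S) + (p + q) = p + (q + S') + (a + b))%N
  by lia.
apply: regroup.
by apply: eq_bigr => k /andP[/negbTE ki /negbTE kj]; rewrite ffunE ki kj.
Qed.

Lemma mv_colsum W d (c c' : {ffun 'I_d -> {set T}}) : mv W c c' -> colsum c =1 colsum c'.
Proof.
case/mvP=> i [j [D [WD sD ->]]] x; have [eij|ne] := eqVneq i j.
  rewrite eij in sD *; rewrite (swap_id sD); apply: eq_bigr => k _.
  by rewrite ffunE addr0 if_same.
have := sum_swap c D (fun C => nat_of_bool (x \in C)) ne; rewrite /colsum !in_add.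
case: (boolP (x \in D)) => xD; last by rewrite !addbF; lia.
have := subsetP sD x xD; rewrite in_add.
by case: (x \in c i); case: (x \in c j) => //=; lia.
Qed.

Lemma mv_sym W d : ssrbool.symmetric (@mv W d).
Proof.
have h (c c' : {ffun 'I_d -> {set T}}) : mv W c c' -> mv W c' c.
  case/mvP=> i [j [D [WD sD ->]]]; apply/mvP; exists i, j, D; split=> //.
    by rewrite !ffunE !eqxx orbT /= addrACA addSS addr0.
  by apply/ffunP=> k; rewrite !ffunE; case: (_ || _); rewrite ?addSK.
by move=> c c'; apply/idP/idP; apply: h.
Qed.

Lemma connect_mv_sym W d : connect_sym (@mv W d).
Proof. by apply: sym_connect_sym; apply: mv_sym. Qed.

Lemma connect_mv_inW W d (c c' : {ffun 'I_d -> {set T}}) :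
  subspace W -> connect (@mv W d) c c' -> inW W c -> inW W c'.
Proof. by move=> sW; apply: connect_invariant => x y; apply: mv_inW. Qed.

Lemma connect_mv_colsum W d (c c' : {ffun 'I_d -> {set T}}) :
  connect (@mv W d) c c' -> colsum c =1 colsum c'.
Proof.
move=> h x; pose P (y : {ffun 'I_d -> {set T}}) := colsum c x = colsum y x.
have step a b : P a -> mv W a b -> P b by rewrite /P => -> /mv_colsum->.
exact: (connect_invariant step h).
Qed.

(** A tool for finding exchange partners: value 0 means D inside K + C, and the total over a tuple
    depends only on the column sums. *)
Definition agree D K C : nat := #|[set x in D | (x \in C) == (x \in K)]|.

Lemma agreeE D K C : agree D K C = (\sum_(x in D) ((x \in C) == (x \in K)))%N.
Proof.
rewrite /agree -sum1_card (eq_bigl (fun x => (x \in D) && ((x \in C) == (x \in K)))) => [|x];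
  last by rewrite inE.
by rewrite big_mkcondr; apply: eq_bigr => x _; case: eqP.
Qed.

Lemma sum_agree D K d (c c' : {ffun 'I_d -> {set T}}) : colsum c =1 colsum c' ->
  (\sum_(i < d) agree D K (c i) = \sum_(i < d) agree D K (c' i))%N.
Proof.
move=> cc'; under eq_bigr do rewrite agreeE; under [in RHS]eq_bigr do rewrite agreeE.
rewrite exchange_big [RHS]exchange_big; apply: eq_bigr => x _ /=.
case: (x \in K); first by under eq_bigr do rewrite eqb_id; under [RHS]eq_bigr do rewrite eqb_id; exact: cc'.
have h (a : {ffun 'I_d -> {set T}}) : (\sum_(i < d) ((x \in a i) == false) + colsum a x = d)%N.
  rewrite -big_split /= -[RHS](card_ord d) -sum1_card; apply: eq_bigr => i _.
  by case: (x \in a i).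
apply/eqP; rewrite -(eqn_add2r (colsum c x)); apply/eqP.
by transitivity d; [exact: h|rewrite cc'; exact/esym/h].
Qed.

Lemma agree_add D K C : (agree D K (C + D)%R + agree D K C = #|D|)%N.
Proof.
rewrite !agreeE -big_split -sum1_card; apply: eq_bigr => x xD /=.
by rewrite in_add xD; case: (x \in C); case: (x \in K).
Qed.

Lemma agree_self D K : agree D K K = #|D|.
Proof. by rewrite agreeE -sum1_card; apply: eq_bigr => x _; rewrite eqxx. Qed.

Lemma agree0 D K C : agree D K C = 0%N -> D \subset K + C.
Proof.
move/eqP; rewrite cards_eq0 => /eqP h; apply/subsetP=> x xD.
have /negbT : x \in [set x in D | (x \in C) == (x \in K)] = false by rewrite h inE.
by rewrite inE xD in_add; case: (x \in C); case: (x \in K).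
Qed.

Lemma sum_lt_exists d (F G : 'I_d -> nat) (i : 'I_d) : (\sum_(k < d) F k = \sum_(k < d) G k)%N -> (G i < F i)%N ->
  exists l, (F l < G l)%N.
Proof.
move=> eqs lti; apply/existsP; apply: contraLR lti; rewrite negb_exists -leqNgt => /forallP h.
move: eqs; rewrite (bigD1 i) //= [RHS](bigD1 i) //= => eqs.
have gen (a b p q : nat) : (a + p = b + q -> q <= p -> a <= b)%N by lia.
by apply: gen eqs _; apply: leq_sum => k _; rewrite leqNgt; apply: h.
Qed.

(** Equal column sums force the members that must be changed by D to come in pairs on which D can be
    exchanged; each exchange repairs two of them. *)
Lemma fibre_connect W D d (c c' : {ffun 'I_d -> {set T}}) :
  subspace W -> D \in W -> (0 < #|D| <= 2)%N -> inW W c ->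
  (forall i, c' i = c i \/ c' i = c i + D) -> colsum c =1 colsum c' -> connect (@mv W d) c c'.
Proof.
move=> sW WD /andP[D0 D2].
elim: {c}_.+1 {-2}c (ltnSn #|[set i | c' i != c i]|) => // n IHn c ltn Wc cD cs.
case: (boolP [forall i, c' i == c i]) => [/forallP h|/forallPn[i nei]].
  by have -> : c' = c by apply/ffunP=> i; apply/eqP.
have ci : c' i = c i + D by case: (cD i) => // e; rewrite e eqxx in nei.
(* Compared with K = c i, member i drops from full agreement to none, so another member gains to
   keep the total. *)
have [l ltl] : exists l, (agree D (c i) (c l) < agree D (c i) (c' l))%N.
  apply: (sum_lt_exists (i := i)) (sum_agree D (c i) cs) _.
  by rewrite ci agree_self; have := agree_add D (c i) (c i); rewrite agree_self; lia.
have cl : c' l = c l + D by case: (cD l) => // e; rewrite e ltnn in ltl.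
(* The agreements before and after add up to |D|; as |D| is at most 2, the smaller of two unequal
   values is 0. *)
have agl : agree D (c i) (c l) = 0%N.
  by have := agree_add D (c i) (c l); rewrite cl in ltl; lia.
have sD := agree0 agl.
have m1 := mv_swap WD sD; apply: (connect_trans m1).
have neil : i != l.
  by apply: contraTneq D0 => eil; rewrite -(agree_self D (c i)) {2}eil agl.
apply: IHn.
- rewrite -ltnS; apply: leq_trans ltn; rewrite ltnS; apply: proper_card; apply/properP; split.
    apply/subsetP=> k; rewrite !inE ffunE; case: ifP => // /orP[]/eqP->.
      by rewrite ci eqxx.
    by rewrite cl eqxx.
  by exists i; rewrite !inE ?nei // ffunE eqxx ci eqxx.
- by move=> k; rewrite ffunE; case: ifP => // _; rewrite subspaceD.
- move=> k; rewrite ffunE; case: ifP => // /orP[]/eqP->; [rewrite ci|rewrite cl]; by left.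
- by move=> x; rewrite -(connect_mv_colsum m1).
Qed.

Definition cmap d (h : {set T} -> {set T}) (c : {ffun 'I_d -> {set T}}) := [ffun i => h (c i)].

Lemma colsum_cmap d (h : {set T} -> {set T}) (c c' : {ffun 'I_d -> {set T}}) x :
  (forall C, (x \in h C) = (x \in C)) \/ (forall C, x \notin h C) ->
  colsum c x = colsum c' x -> colsum (cmap h c) x = colsum (cmap h c') x.
Proof.
case=> hx; rewrite /colsum.
  have eqh (a : {ffun 'I_d -> {set T}}) :
      (\sum_(i < d) (x \in cmap h a i) = \sum_(i < d) (x \in a i))%N.
    by apply: eq_bigr => i _; rewrite ffunE hx.
  by rewrite !eqh.
by move=> _; rewrite !big1 // => i _; rewrite ffunE (negbTE (hx _)).
Qed.

(** A path for W \ e lifts move by move; its end differs from c' only by the loop, which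
    [fibre_connect] corrects. *)
Lemma quadratic_loop W e : subspace W -> [set e] \in W ->
  quadratic (wdel W [set e]) -> quadratic W.
Proof.
move=> sW We qW d c c' Wc Wc' cs.
have rem C : C \in W -> C :\ e \in W.
  case: (boolP (e \in C)) => eC WC.
    by rewrite -add_subset ?sub1set // subspaceD.
  by have -> : C :\ e = C by apply/setDidPl; rewrite disjoint_sym disjoints1.
pose h C := C :\ e.
have delh a : inW W a -> inW (wdel W [set e]) (cmap (d := d) h a).
  move=> Wa i; rewrite ffunE inE rem //=.
  by rewrite disjoint_sym disjoints1 !inE eqxx.
have csh : colsum (cmap h c) =1 colsum (cmap h c').
  move=> x; apply: colsum_cmap (cs x); have [->|ne] := eqVneq x e.
    by right=> C; rewrite !inE eqxx.
  by left=> C; rewrite !inE ne.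
pose L (a b : {ffun 'I_d -> {set T}}) := inW W a /\ b = cmap h a.
have [||a ca [Wa eqa]] := @connect_simulation _ _ (@mv W d) (@mv (wdel W [set e]) d) L _
    c _ _ _ (qW d _ _ (delh _ Wc) (delh _ Wc') csh); last 1 first.
- apply: (connect_trans ca); apply: (fibre_connect sW We) => //; rewrite ?cards1 //.
    move=> i; move/ffunP/(_ i): eqa; rewrite !ffunE => ei.
    case: (boolP ((e \in c' i) == (e \in a i))) => ee; [left|right].
      apply/setP=> x; have [->|ne] := eqVneq x e; first exact/eqP.
      by move/setP/(_ x): ei; rewrite !inE ne.
    apply/setP=> x; rewrite in_add inE; have [->|ne] := eqVneq x e.
      by move: ee; case: (e \in c' i); case: (e \in a i).
    by move/setP/(_ x): ei; rewrite !inE ne addbF.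
  by move=> x; rewrite -(connect_mv_colsum ca).
- move=> a _ b' [Wa ->] /mvP[i [j [D [WD sD ->]]]].
  move: WD; rewrite inE disjoint_sym disjoints1 => /andP[WD eD].
  have ne x : x \in D -> x != e by apply: contraTneq => ->.
  have m1 : connect (@mv W d) a (swap a i j D).
    apply: mv_swap => //; apply/subsetP=> x xD; have := subsetP sD x xD.
    by rewrite !ffunE !in_add !inE ne.
  exists (swap a i j D) => //; split; first exact: connect_mv_inW m1 Wa.
  apply/ffunP=> k; rewrite !ffunE; case: ifP => // _.
  by rewrite /h setD_add; congr (_ + _); apply/esym/setDidPl; rewrite disjoint_sym disjoints1.
- by split.
Qed.

(** Since f records membership of e, removing e from the cycles is injective, and inclusions lift as
    well. *)
Lemma quadratic_series W e f : subspace W -> e != f ->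
  (forall C, C \in W -> (e \in C) = (f \in C)) -> quadratic (wcon W [set e]) -> quadratic W.
Proof.
move=> sW nef Wef qW d c c' Wc Wc' cs.
pose h C := C :\ e.
have conh a : inW W a -> inW (wcon W [set e]) (cmap (d := d) h a).
  by move=> Wa i; rewrite ffunE mem_wcon.
have csh : colsum (cmap h c) =1 colsum (cmap h c').
  move=> x; apply: colsum_cmap (cs x); have [->|ne] := eqVneq x e.
    by right=> C; rewrite !inE eqxx.
  by left=> C; rewrite !inE ne.
have nfe : f != e by rewrite eq_sym.
pose L (a b : {ffun 'I_d -> {set T}}) := inW W a /\ b = cmap h a.
have [||a ca [Wa eqa]] := @connect_simulation _ _ (@mv W d) (@mv (wcon W [set e]) d) L _
    c _ _ _ (qW d _ _ (conh _ Wc) (conh _ Wc') csh); last 1 first.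
- suff -> : c' = a by [].
  apply/ffunP=> i; move/ffunP/(_ i): eqa; rewrite !ffunE => /setP ei.
  apply/setP=> x; have [->|ne] := eqVneq x e; last by have := ei x; rewrite !inE ne.
  by rewrite !Wef //; have := ei f; rewrite !inE nfe.
- move=> a _ b' [Wa ->] /mvP[i [j [_ [/imsetP[D WD ->] sD ->]]]].
  have m1 : connect (@mv W d) a (swap a i j D).
    apply: mv_swap => //; apply/subsetP=> x xD.
    have sub y : y \in D -> y != e -> y \in a i + a j.
      move=> yD ny; have := subsetP sD y; rewrite in_setD1 ny yD => /(_ isT).
      by rewrite !ffunE !in_add !in_setD1 ny.
    have [ex|ne] := eqVneq x e; last exact: sub.
    by rewrite ex Wef ?subspaceD // sub // -Wef // -ex.
  exists (swap a i j D) => //; split; first exact: connect_mv_inW m1 Wa.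
  by apply/ffunP=> k; rewrite !ffunE; case: ifP => // _; rewrite /h setD_add.
- by split.
Qed.

End Configurations.

(** Here n and m count odd members before and after an exchange that flips two parities p and q; the
    count rises only if both were even. *)
Lemma flip_two (m n : nat) (p q : bool) : (m + (p + q) = n + (~~ p + ~~ q))%N ->
  odd n = odd m /\ ((m <= n)%N \/ [/\ ~~ p, ~~ q & m = n + 2]%N).
Proof.
case: p; case: q => /= h; split; try lia; by [left; lia|right; split=> //; lia].
Qed.

Lemma parity_squeeze (k m n : nat) : odd k = odd m -> (m <= k)%N -> ~~ (n <= k)%N ->
  n = (m + 2)%N -> m = k.
Proof. by lia. Qed.

(** * Quadratic moves across a parallel pair *)

Section Parallel.
Variables (T : finType) (W : {set {set T}}) (e f : T).
Let D := [set e; f].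
Hypotheses (sW : subspace W) (nef : e != f) (WD : D \in W) (nWe : [set e] \notin W).
Implicit Types (A B C K : {set T}) (x : T).

Let De : e \in D. Proof. by rewrite !inE eqxx. Qed.
Let Df : f \in D. Proof. by rewrite !inE eqxx orbT. Qed.
Let cD : #|D| = 2. Proof. by rewrite cards2 nef. Qed.
Let inD x : x \in D -> x = e \/ x = f.
Proof. by rewrite !inE => /orP[]/eqP; [left|right]. Qed.

(** The representative of C modulo D that avoids f, hence a cycle of W \ f. *)
Let nrm C := if f \in C then C + D else C.
Let par C : bool := (e \in C) (+) (f \in C).
Let npar d (c : {ffun 'I_d -> {set T}}) : nat := (\sum_(i < d) par (c i))%N.

Let in_nrm C x : (x \in nrm C) = if x == f then false else if x == e then par C else x \in C.
Proof.
rewrite /nrm /par; case: (boolP (f \in C)) => fC.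
  rewrite in_add; have [->|nf] := eqVneq x f; first by rewrite fC Df.
  have [->|ne] := eqVneq x e; first by rewrite De.
  by rewrite !inE (negbTE nf) (negbTE ne) addbF.
have [->|nf] := eqVneq x f; first exact/negbTE.
by have [->|//] := eqVneq x e; rewrite addbF.
Qed.

Let nrmD A B : nrm (A + B) = nrm A + nrm B.
Proof.
apply/setP=> x; rewrite in_add !in_nrm /par !in_add; case: ifP => // _; case: ifP => // _.
by case: (e \in A); case: (e \in B); case: (f \in A); case: (f \in B).
Qed.

Let nrm_id A : f \notin A -> nrm A = A.
Proof. by rewrite /nrm => /negbTE->. Qed.

Let nrm_addD A : nrm (A + D) = nrm A.
Proof. by rewrite nrmD {2}/nrm Df addSS addr0. Qed.

Let nrm_eq A B : nrm A = nrm B -> A = B \/ A = B + D.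
Proof.
rewrite /nrm; case: ifP => _; case: ifP => _ h.
- by left; rewrite -(addSK A D) h addSK.
- by right; rewrite -h addSK.
- by right.
- by left.
Qed.

Let nrmW C : C \in W -> nrm C \in wdel W [set f].
Proof.
move=> WC; rewrite inE disjoint_sym disjoints1 in_nrm eqxx andbT /nrm.
by case: ifP => // _; rewrite subspaceD.
Qed.

Let nWf : [set f] \notin W.
Proof.
apply: contra nWe => Wf; rewrite -(addSK [set e] [set f]) subspaceD //.
by rewrite -set2_add.
Qed.

(** As e and f are not loops, [C :&: D] is in W only if it is empty or D. Hence parity can be read
    off in W / D. *)
Let parE C : C \in W -> par C = (C :\: D \notin W).
Proof.
move=> WC; rewrite -(subspaceDr _ sW WC).
have -> : C :\: D + C = C :&: D.
  by apply/setP=> x; rewrite in_add !inE; case: (x \in C); rewrite ?andbT ?andbF // addbT negbK.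
rewrite /par; case: (boolP (e \in C)) => eC; case: (boolP (f \in C)) => fC.
- by rewrite (setIidPr _) ?WD // subUset !sub1set eC fC.
- suff -> : C :&: D = [set e] by rewrite nWe.
  apply/setP=> x; rewrite !inE; have [->|ne] := eqVneq x e; first by rewrite eC.
  by have [->|] := eqVneq x f; rewrite ?(negbTE fC) ?andbF.
- suff -> : C :&: D = [set f] by rewrite nWf.
  apply/setP=> x; rewrite !inE; have [->|ne] := eqVneq x f; first by rewrite fC orbT.
  by have [->|] := eqVneq x e; rewrite ?(negbTE eC) ?andbF.
- suff -> : C :&: D = 0 by rewrite subspace0.
  apply/setP=> x; rewrite !inE; have [->|ne] := eqVneq x f; first by rewrite (negbTE fC).
  by have [->|] := eqVneq x e; rewrite ?(negbTE eC) ?andbF.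
Qed.

Let colsum_nrm d (c : {ffun 'I_d -> {set T}}) x :
  colsum (cmap nrm c) x = if x == f then 0%N else if x == e then npar c else colsum c x.
Proof.
rewrite /colsum; have [->|nf] := eqVneq x f.
  by rewrite big1 // => i _; rewrite ffunE in_nrm eqxx.
have [->|ne] := eqVneq x e.
  by apply: eq_bigr => i _; rewrite ffunE in_nrm (negbTE nef) eqxx.
by apply: eq_bigr => i _; rewrite ffunE in_nrm (negbTE nf) (negbTE ne).
Qed.

(** The image of C in W / D determines its normal form, so a tuple over W / D yields one over W \
    f. *)
Let nrmE C : C \in W -> nrm C = if C :\: D \in W then C :\: D else C :\: D + [set e].
Proof.
move=> WC; apply/setP=> x; rewrite in_nrm -[_ \in W]negbK -parE //.
have [->|nf] := eqVneq x f.
  by case: (par C); rewrite /= ?in_add in_setD Df //= in_set1 eq_sym (negbTE nef).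
have [->|ne] := eqVneq x e.
  by case: (par C); rewrite /= ?in_add in_setD De //= in_set1 eqxx.
have xD : x \in D = false by rewrite !inE (negbTE nf) (negbTE ne).
by case: (par C); rewrite /= ?in_add in_setD xD //= in_set1 (negbTE ne) addbF.
Qed.

Let class_lift d (c b : {ffun 'I_d -> {set T}}) : quadratic (wdel W [set f]) ->
  inW W c -> inW (wdel W [set f]) b -> colsum (cmap nrm c) =1 colsum b ->
  exists2 c', connect (@mv _ W d) c c' & inW W c' /\ b = cmap nrm c'.
Proof.
move=> qN Wc Nb cs.
pose L (a b : {ffun 'I_d -> {set T}}) := inW W a /\ b = cmap nrm a.
have Nc : inW (wdel W [set f]) (cmap nrm c) by move=> i; rewrite ffunE nrmW.
apply: (@connect_simulation _ _ (@mv _ W d) (@mv _ (wdel W [set f]) d) L _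
  c _ _ _ (qN d _ _ Nc Nb cs)); last by split.
move=> a _ b' [Wa ->] /mvP[i [j [D0 [ND0 sD0 ->]]]].
move: ND0; rewrite inE disjoint_sym disjoints1 => /andP[WD0 fD0].
have sub x : x \in D0 -> x \in nrm (a i + a j).
  by move/(subsetP sD0); rewrite !ffunE -nrmD.
have [D1 [WD1 sD1 nD1]] : exists D1, [/\ D1 \in W, D1 \subset a i + a j & nrm D1 = D0].
  case: (boolP ((e \in D0) ==> (e \in a i + a j))) => [/implyP h|].
    exists D0; split; rewrite ?nrm_id //; apply/subsetP=> x xD0.
    have := sub x xD0; rewrite in_nrm; case: ifP => // _; case: eqP => // ex _.
    by rewrite ex h // -ex.
  rewrite negb_imply => /andP[eD0 ne]; exists (D0 + D).
  rewrite subspaceD // nrm_addD nrm_id //; split=> //.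
  apply/subsetP=> x; have := sub e eD0.
  rewrite in_nrm (negbTE nef) eqxx /par (negbTE ne) /= => fa.
  rewrite in_add; have [->|nf] := eqVneq x f; first by rewrite fa.
  have [->|nex] := eqVneq x e; first by rewrite eD0 De.
  have -> : x \in D = false by rewrite !inE (negbTE nf) (negbTE nex).
  rewrite addbF => /sub.
  by rewrite in_nrm (negbTE nf) (negbTE nex).
have m1 := mv_swap WD1 sD1; exists (swap a i j D1) => //.
split; first exact: connect_mv_inW m1 Wa.
by apply/ffunP=> k; rewrite !ffunE; case: ifP => // _; rewrite nrmD nD1.
Qed.

(** Equal values of [npar] are equal sums in column e after normalization. The lifted path ends at
    c' up to adding D to members, a case of [fibre_connect]. *)
Let class_connect d (c c' : {ffun 'I_d -> {set T}}) : quadratic (wdel W [set f]) ->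
  inW W c -> inW W c' -> colsum c =1 colsum c' -> npar c = npar c' ->
  connect (@mv _ W d) c c'.
Proof.
move=> qN Wc Wc' cs ks.
have Nc : inW (wdel W [set f]) (cmap nrm c') by move=> i; rewrite ffunE nrmW.
have [|a ca [Wa eqa]] := class_lift qN Wc Nc.
  by move=> x; rewrite !colsum_nrm ks cs.
apply: (connect_trans ca); apply: (fibre_connect sW WD) => //; first by rewrite cD.
  by move=> i; apply: nrm_eq; move/ffunP/(_ i): eqa; rewrite !ffunE.
by move=> x; rewrite -(connect_mv_colsum ca).
Qed.

Let parD A B : par (A + B) = par A (+) par B.
Proof.
by rewrite /par !in_add; case: (e \in A); case: (e \in B); case: (f \in A); case: (f \in B).
Qed.

(** If exactly one of A and B is odd they agree at one element of D, otherwise at none or at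
    both. *)
Let par_agree A B : (agree D B A + par A + par B <= 2 + 2 * (par A && par B))%N
  /\ (agree D B A = 0 \/ agree D B A + par A + par B >= 2)%N.
Proof.
rewrite agreeE /D big_setU1 ?inE //= big_set1 /par.
by case: (e \in A); case: (e \in B); case: (f \in A); case: (f \in B); split=> //; auto.
Qed.

(* The step that needs the contraction: along a path for W / D the number of odd
   members must cross the value npar c + 2. *)
Let npar_step d (c c' : {ffun 'I_d -> {set T}}) : quadratic (wdel W [set f]) ->
  quadratic (wcon W D) -> inW W c -> inW W c' -> colsum c =1 colsum c' ->
  (npar c < npar c')%N ->
  exists2 c1, connect (@mv _ W d) c c1 & npar c1 = (npar c + 2)%N.
Proof.
move=> qN qC Wc Wc' cs ltk.
pose W1 := wcon W D; have sW1 : subspace W1 by apply: wcon_subspace.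
pose h C := C :\: D.
pose k1 (p : {ffun 'I_d -> {set T}}) := (\sum_(i < d) (p i \notin W))%N.
have conh a : inW W a -> inW W1 (cmap (d := d) h a).
  by move=> Wa i; rewrite ffunE mem_wcon.
have k1h a : inW W a -> k1 (cmap (d := d) h a) = npar a.
  by move=> Wa; apply: eq_bigr => i _; rewrite ffunE -parE.
have csh : colsum (cmap h c) =1 colsum (cmap h c').
  move=> x; apply: colsum_cmap (cs x); case: (boolP (x \in D)) => xD.
    by right=> C; rewrite inE xD.
  by left=> C; rewrite inE xD.
have W1notW A B : A \in W1 -> B \in W1 -> (A + B \notin W) = (A \notin W) (+) (B \notin W).
  by move=> /imsetP[A' WA ->] /imsetP[B' WB ->]; rewrite -setD_add -!parE ?subspaceD // parD.
(* A move of W / D by an even set preserves all parities, and one by an odd set flips two; an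
   increase comes from two even members made odd. *)
have mvk (u v : {ffun 'I_d -> {set T}}) : inW W1 u -> mv W1 u v ->
    odd (k1 u) = odd (k1 v) /\ ((k1 v <= k1 u)%N \/ exists i j D0,
      [/\ [/\ i != j, D0 \in W1, D0 \notin W & D0 \subset u i + u j],
          u i \in W, u j \in W, v = swap u i j D0 & k1 v = (k1 u + 2)%N]).
  move=> W1u /mvP[i [j [D0 [WD0 sD0 ->]]]]; have [eij|nij] := eqVneq i j.
    have -> : swap u i j D0 = u; last by split=> //; left.
    rewrite -eij in sD0; apply/ffunP=> k; rewrite ffunE (swap_id sD0) addr0.
    by rewrite if_same.
  have := sum_swap u D0 (fun C => nat_of_bool (C \notin W)) nij; rewrite -!/(k1 _).
  rewrite !W1notW //; case: (boolP (D0 \in W)) => WD0' hk.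
    have -> : k1 (swap u i j D0) = k1 u by apply/(@addIn _ _ _)/(etrans hk); rewrite !addbF.
    by split=> //; left.
  have [|-> [le|[ui uj kv]]] := @flip_two (k1 (swap u i j D0)) (k1 u) (u i \notin W) (u j \notin W).
  - by rewrite hk !addbT.
  - by split=> //; left.
  by split=> //; right; exists i, j, D0; rewrite -kv; move: ui uj; rewrite !negbK.
have con := qC d _ _ (conh _ Wc) (conh _ Wc') csh.
pose P (p : {ffun 'I_d -> {set T}}) := (k1 p <= npar c)%N.
(* The first move that takes the count above [npar c]. By parity u still has the value [npar c]. *)
have [||u [v [cu uv Pu Pv]]] := connect_crossing (P := P) con.
- by rewrite /P k1h.
- by rewrite /P k1h // -ltnNge.
have W1u := connect_mv_inW sW1 cu (conh _ Wc).
have odd_u : odd (npar c) = odd (k1 u).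
  pose Q (p : {ffun 'I_d -> {set T}}) := inW W1 p /\ odd (npar c) = odd (k1 p).
  have stepQ a b : Q a -> mv W1 a b -> Q b.
    move=> [W1a oa] mab; split; first exact: mv_inW mab.
    by have [<- _] := mvk a b W1a mab.
  by have [] := connect_invariant stepQ cu; rewrite // /Q k1h //; split=> //; apply: conh.
have [odd_v [le|[i [j [D0 [[nij W1D0 nWD0 sD0] ui uj ev kv]]]]]] := mvk u v W1u uv.
  by move: Pv; rewrite /P (leq_trans le Pu).
have ku : k1 u = npar c := parity_squeeze odd_u Pu Pv kv.
have csu x : colsum u x = colsum (cmap h c) x by rewrite (connect_mv_colsum cu).
have uD k x : x \in D -> x \notin u k.
  by move=> xD; have /imsetP[C _ ->] := W1u k; rewrite inE xD.
(* The tuple of W \ f that corresponds to u. As [k1 u] is [npar c], it has the column sums of the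
   normalized c, so c can be moved to some c2 above u. *)
pose b : {ffun 'I_d -> {set T}} := [ffun k => if u k \in W then u k else u k + [set e]].
have Nb : inW (wdel W [set f]) b.
  move=> k; have /imsetP[C WC euk] := W1u k.
  by rewrite ffunE euk -nrmE // nrmW.
have in_b k x : (x \in b k) = if x == f then false else if x == e then u k \notin W else x \in u k.
  by have /imsetP[C WC euk] := W1u k; rewrite ffunE euk -nrmE // in_nrm -parE //;
    case: eqP => // nf; case: eqP => // ne; rewrite in_setD !inE; case: eqP => // _; case: eqP.
have csb : colsum (cmap nrm c) =1 colsum b.
  move=> x; rewrite colsum_nrm; have [->|nf] := eqVneq x f.
    by rewrite /colsum big1 // => k _; rewrite in_b eqxx.
  have [->|ne] := eqVneq x e.
    by rewrite -ku; apply: eq_bigr => k _; rewrite in_b (negbTE nef) eqxx.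
  have xD : x \notin D by rewrite !inE negb_or ne.
  have -> : colsum b x = colsum u x.
    by apply: eq_bigr => k _; rewrite in_b (negbTE nf) (negbTE ne).
  by rewrite csu; apply: eq_bigr => k _; rewrite ffunE in_setD xD.
have [c2 cc2 [Wc2 eb]] := class_lift qN Wc Nb csb.
have nb k : nrm (c2 k) = b k by rewrite eb ffunE.
have hc2 k : h (c2 k) = u k.
  apply/setP=> x; rewrite in_setD; case: (boolP (x \in D)) => xD.
    by rewrite (negbTE (uD _ _ xD)).
  have := congr1 (fun A : {set T} => x \in A) (nb k); rewrite /= in_nrm in_b.
  by move: xD; rewrite !inE negb_or => /andP[/negbTE-> /negbTE->].
(* If the members i and j of a tuple above u differ on all of D, every lift of D0 can be exchanged
   between them, and this makes both odd. *)
have finish (a : {ffun 'I_d -> {set T}}) : connect (@mv _ W d) c a ->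
    (forall k, h (a k) = u k) -> D \subset a i + a j ->
    exists2 c1, connect (@mv _ W d) c c1 & npar c1 = (npar c + 2)%N.
  move=> ca ha sDa; have Wa := connect_mv_inW sW ca Wc.
  have /imsetP[D' WD' eD0] := W1D0.
  have sD' : D' \subset a i + a j.
    apply/subsetP=> x xD'; case: (boolP (x \in D)) => [/(subsetP sDa)//|xD].
    have : x \in D0 by rewrite eD0 in_setD xD.
    by move/(subsetP sD0); rewrite -!ha !in_add !in_setD xD.
  have m1 := mv_swap WD' sD'; exists (swap a i j D'); first exact: connect_trans ca m1.
  have pa k : par (a k) = (u k \notin W) by rewrite parE // -ha.
  have ka : npar a = npar c by rewrite -ku; apply: eq_bigr => k _; rewrite pa.
  have := sum_swap a D' (fun C => nat_of_bool (par C)) nij.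
  rewrite /= !parD (parE WD') -eD0 nWD0 !pa ui uj /= => hs.
  exact: (etrans (esym (addn0 _)) (etrans hs (congr1 (addn^~ 2) ka))).
have pc2 k : par (c2 k) = (u k \notin W) by rewrite parE // -/(h _) hc2.
case: (boolP (D \subset c2 i + c2 j)) => [|nsD]; first exact: finish.
(* Otherwise agreement with c2 i plus parity is at least 2 for each member of c2 and at most 2 for
   each member of c'; the total agreements being equal, [npar c'] could not exceed [npar c]. *)
have [l agl] : exists l, agree D (c2 i) (c2 l) = 0%N.
  suff /existsP[l /eqP agl] : [exists l, agree D (c2 i) (c2 l) == 0%N] by exists l.
  apply: contraLR ltk; rewrite negb_exists -leqNgt => /forallP nag.
  have ge : (\sum_(k < d) 2 <= \sum_(k < d) (agree D (c2 i) (c2 k) + par (c2 k)))%N.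
    apply: leq_sum => k _; have [_ [e0|]] := par_agree (c2 k) (c2 i).
      by have := nag k; rewrite e0 eqxx.
    by rewrite (pc2 i) ui addn0.
  have le : (\sum_(k < d) (agree D (c2 i) (c' k) + par (c' k)) <= \sum_(k < d) 2)%N.
    apply: leq_sum => k _; have [+ _] := par_agree (c' k) (c2 i).
    by rewrite (pc2 i) ui /= andbF muln0 !addn0.
  have := leq_trans le ge; rewrite !big_split /=.
  rewrite (sum_agree D (c2 i) (c := c2) (c' := c')); last first.
    by move=> x; rewrite -(connect_mv_colsum cc2).
  rewrite leq_add2l -/(npar c') => /leq_trans; apply.
  by rewrite -ku; apply: leq_sum => k _; rewrite pc2.
have sDl := agree0 agl.
have nil : i != l.
  by apply/eqP=> eil; move: agl; rewrite -eil agree_self cD.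
have njl : j != l by apply/eqP=> ejl; rewrite ejl sDl in nsD.
(* Both members are even, so each contains all or nothing of D; as they do not differ on all of D,
   they coincide there. Exchanging D between j and l then makes i and j differ on D. *)
have eij x : x \in D -> (x \in c2 i) = (x \in c2 j).
  have pij : par (c2 i) = par (c2 j) by rewrite !pc2 ui uj.
  move: pc2 nsD; rewrite subUset !sub1set !in_add => /(_ i); rewrite ui /=; move: pij.
  rewrite /par => pij pi ns /inD[]->; move: pij pi ns;
  by case: (e \in c2 i); case: (f \in c2 i); case: (e \in c2 j); case: (f \in c2 j).
have sDjl : D \subset c2 j + c2 l.
  apply/subsetP=> x xD; have := subsetP sDl x xD.
  by rewrite !in_add eij.
have m1 := mv_swap WD sDjl.
apply: (finish (swap c2 j l D)); first exact: connect_trans cc2 m1.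
  move=> k; rewrite ffunE; case: ifP => // _.
  by rewrite /h setD_add setDv addr0 -/(h _) hc2.
rewrite !ffunE eqxx (negbTE nij) (negbTE nil) /=; apply/subsetP=> x xD.
by rewrite !in_add eij // xD; case: (x \in c2 j).
Qed.

Lemma quadratic_parallel : quadratic (wdel W [set f]) -> quadratic (wcon W D) -> quadratic W.
Proof.
move=> qN qC d.
suff main n (c c' : {ffun 'I_d -> {set T}}) : (npar c <= npar c')%N -> (npar c' - npar c <= n)%N ->
    inW W c -> inW W c' -> colsum c =1 colsum c' -> connect (@mv _ W d) c c'.
  move=> c c' Wc Wc' cs; have [le|lt] := leqP (npar c) (npar c'); first exact: (main _ _ _ le).
  by rewrite connect_mv_sym; apply: (main _ _ _ (ltnW lt)).
elim: n c c' => [|n IHn] c c' le len Wc Wc' cs.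
  by apply: class_connect => //; apply/eqP; rewrite eqn_leq le -subn_eq0 -leqn0.
have [eqk|ne] := eqVneq (npar c) (npar c'); first exact: class_connect.
have ltk : (npar c < npar c')%N by rewrite ltn_neqAle ne.
have [c1 cc1 k1] := npar_step qN qC Wc Wc' cs ltk.
have Wc1 := connect_mv_inW sW cc1 Wc.
have cs1 : colsum c1 =1 colsum c' by move=> x; rewrite -(connect_mv_colsum cc1).
apply: (connect_trans cc1).
have oddE a : odd (npar (d := d) a) = odd (colsum a e + colsum a f).
  rewrite /npar /colsum -big_split /= !(big_morph odd oddD (erefl : odd 0 = false)).
  by apply: eq_bigr => k _; rewrite oddD !oddb.
have odd_k : odd (npar c) = odd (npar c') by rewrite !oddE !cs.
(* Equal parity keeps the step of 2 from overshooting. *)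
have step (p q r m : nat) : odd p = odd q -> (p < q)%N -> r = (p + 2)%N -> (q - p <= m.+1)%N ->
  (r <= q)%N /\ (q - r <= m)%N by lia.
by have [] := step _ _ _ _ odd_k ltk k1 len; move=> *; apply: IHn.
Qed.

End Parallel.

Lemma quadratic_no_k4minor (T : finType) (W : {set {set T}}) (E : {set T}) :
  subspace W -> (forall C, C \in W -> C \subset E) -> ~ k4minor W -> quadratic W.
Proof.
elim: {E}_.+1 {-2}E (ltnSn #|E|) W => // n IHn E ltE W sW WE nk4.
have smaller (W' : {set {set T}}) x : x \in E -> subspace W' ->
    (forall C, C \in W' -> C \subset E :\ x) -> (k4minor W' -> k4minor W) -> quadratic W'.
  move=> xE sW' W'E k4; apply: (IHn (E :\ x)) => //; last by move=> /k4.
  by rewrite -ltnS; apply: leq_trans ltE; rewrite ltnS (cardsD1 x E) xE.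
have delq x : x \in E -> quadratic (wdel W [set x]).
  move=> xE; apply: (smaller _ x) => //; [exact: wdel_subspace| |exact: k4minor_wdel].
  by move=> C; rewrite inE subsetD => /andP[/WE-> ->].
have conq x (X : {set T}) : x \in E -> x \in X -> quadratic (wcon W X).
  move=> xE xX; apply: (smaller _ x) => //; [exact: wcon_subspace| |exact: k4minor_wcon].
  move=> _ /imsetP[C /WE sC ->]; rewrite subsetD1 (subset_trans (subsetDl _ _) sC).
  by rewrite inE xX.
have [E0|nzE] := eqVneq E set0.
  move=> d c c' Wc Wc' _; suff -> : c' = c by [].
  apply/ffunP=> i; have := WE _ (Wc i); have := WE _ (Wc' i).
  by rewrite E0 !subset0 => /eqP-> /eqP->.
case: (boolP [exists x in E, [set x] \in W]) => [/exists_inP[x xE Wx]|/exists_inPn noloop].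
  exact: quadratic_loop (delq x xE).
case: (boolP [exists x in E, exists y in E, (x != y) && ([set x; y] \in W)]) => [|nopar].
  case/exists_inP=> x xE /exists_inP[y yE /andP[ne Wxy]].
  apply: (quadratic_parallel sW ne Wxy (noloop x xE)); first exact: delq.
  by apply: (conq x) => //; rewrite !inE eqxx.
case: (boolP [exists x in E, [forall C in W, x \notin C]]) => [|nocoloop].
  (* A coloop occurs in no cycle, so W itself is a space over the smaller ground set. *)
  case/exists_inP=> x xE /forall_inP xW; apply: (smaller _ x) => // C WC.
  by rewrite subsetD1 WE // xW.
case: (boolP [exists x in E, exists y in E,
    (x != y) && [forall C in W, (x \in C) == (y \in C)]]) => [|noseries].
  case/exists_inP=> x xE /exists_inP[y yE /andP[ne /forall_inP xy]].
  apply: (quadratic_series sW ne); first by move=> C /xy/eqP.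
  by apply: (conq x); rewrite ?inE.
case: nk4; apply: (@simple_cosimple_k4minor _ W E) => // [x y xE yE ne|x xE|x y xE yE ne].
- apply: contra nopar => Wxy; apply/exists_inP; exists x => //.
  by apply/exists_inP; exists y; rewrite // ne.
- have := exists_inPn nocoloop x xE => /forall_inPn[C WC].
  by rewrite negbK; exists C.
- have := exists_inPn noseries x xE => /exists_inPn/(_ y yE).
  by rewrite ne /= => /forall_inPn[C WC neq]; exists C.
Qed.

(** * The cycle ideal *)

Section CycleIdealFibres.
Variables (K : fieldType) (T : finType) (M : matroid T).
Implicit Types (C D : {set T}).
Let n := #|cycles M|.
Local Notation ideal := (@cycle_ideal K T M).
Let N := #|ground M|.+1.
Implicit Types (m u v w : 'X_{1..n}) (p q : cycle_ring K M).

Definition cycle_exponent C : 'X_{1..N} :=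
  [multinom if unlift ord0 j is Some x then (enum_val x \in C : nat) else 1%N | j < N].

(* The exponent of the image under Defs.cycle_map of the monomial with exponent m. *)
Definition fibre_exponent m : 'X_{1..N} :=
  [multinom if unlift ord0 j is Some x then
     (\sum_(i < n) m i * (enum_val x \in (enum_val i : {set T})))%N else mdeg m | j < N].

Lemma cycle_monomialE C : cycle_monomial K M C = 'X_[cycle_exponent C].
Proof.
rewrite mpolyXE_id big_ord_recl mnmE unlift_none /= expr1 /cycle_monomial mulrC.
congr (_ * _); rewrite big_mkcond; apply: eq_bigr => i _.
by rewrite mnmE liftK; case: (_ \in C).
Qed.

Lemma cycle_mapX m : Defs.cycle_map ('X_[m] : cycle_ring K M) = 'X_[fibre_exponent m].
Proof.
rewrite /Defs.cycle_map comp_mpolyX.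
rewrite (eq_bigr (fun i => 'X_[cycle_exponent (enum_val i) *+ m i])) => [|i _]; last first.
  by rewrite tnth_mktuple cycle_monomialE mpolyXn.
rewrite -(big_morph (fun m : 'X_{1..N} => 'X_[K, m]) (@mpolyXD _ _) (@mpolyX0 _ _)).
congr 'X_[_]; apply/mnmP=> j; rewrite mnm_sumE !mnmE.
case: unliftP => [x ->|->].
  by apply: eq_bigr => i _; rewrite mulmnE mnmE liftK mulnC.
by rewrite mdegE; apply: eq_bigr => i _; rewrite mulmnE mnmE unlift_none mul1n.
Qed.

(** Monomials go to monomials, so a coefficient of the image collects the coefficients of p over one
    fibre. *)
Lemma cycle_idealP (p : cycle_ring K M) :
  reflect (forall w : 'X_{1..N}, \sum_(m <- msupp p | fibre_exponent m == w) p@_m = 0) (p \in ideal).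
Proof.
have key (w : 'X_{1..N}) : (Defs.cycle_map p)@_w = \sum_(m <- msupp p | fibre_exponent m == w) p@_m.
  rewrite /Defs.cycle_map comp_mpolyEX raddf_sum [RHS]big_mkcond /=; apply: eq_bigr => m _.
  by rewrite mcoeffZ -/(Defs.cycle_map _) cycle_mapX mcoeffX; case: eqP; rewrite ?mulr1 ?mulr0.
rewrite unfold_in; apply: (iffP eqP) => [p0 w|h]; first by rewrite -key p0 mcoeff0.
by apply/mpolyP=> w; rewrite key h mcoeff0.
Qed.

Lemma fibre_mdeg m m' : fibre_exponent m = fibre_exponent m' -> mdeg m = mdeg m'.
Proof. by move/mnmP/(_ ord0); rewrite !mnmE unlift_none. Qed.

Lemma generated_by0 (s : seq (cycle_ring K M)) : generated_by s 0.
Proof. by exists (fun _ => 0); rewrite big1 // => q _; rewrite mul0r. Qed.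

Lemma generated_byD (s : seq (cycle_ring K M)) p q :
  generated_by s p -> generated_by s q -> generated_by s (p + q).
Proof.
move=> [c ->] [d ->]; exists (fun q => c q + d q).
by rewrite -big_split; apply: eq_bigr => r _; rewrite mulrDl.
Qed.

Lemma generated_byM (s : seq (cycle_ring K M)) p q :
  generated_by s p -> generated_by s (q * p).
Proof.
move=> [c ->]; exists (fun r => q * c r).
by rewrite mulr_sumr; apply: eq_bigr => r _; rewrite mulrA.
Qed.

Lemma generated_by_mem (s : seq (cycle_ring K M)) p : uniq s -> p \in s -> generated_by s p.
Proof.
move=> us ps; exists (fun q => (q == p)%:R).
rewrite (bigD1_seq p) //= eqxx mul1r big1 ?addr0 // => q /negbTE->.
by rewrite mul0r.
Qed.

Lemma generated_by_sum (s : seq (cycle_ring K M)) (J : eqType) (r : seq J)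
    (F : J -> cycle_ring K M) :
  (forall j, j \in r -> generated_by s (F j)) -> generated_by s (\sum_(j <- r) F j).
Proof.
move=> h; rewrite big_seq; elim/big_rec: _ => [|j p jr hp]; first exact: generated_by0.
by apply: generated_byD hp; apply: h.
Qed.

Lemma generated_by_trans (s t : seq (cycle_ring K M)) p :
  (forall q, q \in s -> generated_by t q) -> generated_by s p -> generated_by t p.
Proof.
by move=> st [c ->]; apply: generated_by_sum => q qs; apply/generated_byM/st.
Qed.

Lemma cycle_idealD p q : p \in ideal -> q \in ideal -> p + q \in ideal.
Proof.
rewrite !unfold_in /Defs.cycle_map comp_mpolyD => /eqP-> /eqP->.
by rewrite addr0.
Qed.

Lemma cycle_idealM p q : q \in ideal -> p * q \in ideal.
Proof.
by rewrite !unfold_in /Defs.cycle_map rmorphM /= => /eqP->; rewrite mulr0.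
Qed.

Lemma generated_by_ideal (s : seq (cycle_ring K M)) p :
  {subset s <= ideal} -> generated_by s p -> p \in ideal.
Proof.
move=> sI [c ->]; rewrite big_seq; elim/big_rec: _ => [|q r qs hr].
  by rewrite unfold_in /Defs.cycle_map comp_mpoly0.
by apply: cycle_idealD hr; apply/cycle_idealM/sI.
Qed.

Lemma binomial_in_ideal u v : fibre_exponent u = fibre_exponent v ->
  ('X_[u] - 'X_[v] : cycle_ring K M) \in ideal.
Proof.
move=> e; rewrite unfold_in /Defs.cycle_map comp_mpolyB -!/(Defs.cycle_map _) !cycle_mapX e.
by rewrite subrr.
Qed.

(* The second hypothesis says that u admits no nontrivial quadratic move; then u
   occurs in no multiple of an element of the ideal of degree at most 2. *)
Lemma mu_le2_isolated u v : mu_le K M 2 ->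
  (forall w w', (w <= u)%MM -> (mdeg w <= 2)%N ->
     fibre_exponent w = fibre_exponent w' -> w = w') ->
  fibre_exponent u = fibre_exponent v -> u = v.
Proof.
move=> [k [s [us _ gens _] ek] k3] iso euv; apply/eqP/negPn/negP=> ne.
have [c] := (gens _).1 (binomial_in_ideal euv).
move/(congr1 (fun p : {mpoly K[n]} => p@_u)); rewrite /= mcoeffB !mcoeffX eqxx.
rewrite eq_sym (negbTE ne) subr0 => /eqP; rewrite raddf_sum /= big_seq big1 ?oner_eq0 //.
move=> q qs; rewrite mcoeffM big1 // => -[i j] /= /eqP eu.
suff -> : q@_j = 0 by rewrite mulr0.
have ju : (j <= u)%MM by rewrite [X in (_ <= X)%MM]eu lem_addl.
apply/eqP; rewrite mcoeff_eq0.
(* [msize] exceeds the degree by one. *)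
have sz : (msize q <= 3)%N.
  by apply: leq_trans k3; rewrite ek; apply: (@leq_bigmax_seq _ s xpredT (fun p => msize p)).
have [d2|d3] := leqP (mdeg j) 2; last by apply: msize_mdeg_ge; apply: leq_trans sz d3.
apply/negP=> jq; have /cycle_idealP/(_ (fibre_exponent j)) : q \in ideal.
  by apply/gens; apply: generated_by_mem.
rewrite big_mkcond (bigD1_seq (bmnm j)) ?msupp_uniq //= eqxx big1.
  by rewrite addr0 => /eqP; rewrite mcoeff_eq0 jq.
move=> m nm; case: eqP => // em; case/eqP: nm; apply/esym.
by apply: iso => //; rewrite em.
Qed.

(** Induction on the size. Whether a smaller generating subset exists is decided classically, and
    duplicates are removed so that the size drops. *)
Lemma minimal_generators (s : seq (cycle_ring K M)) : uniq s -> generates s ->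
  exists t, [/\ {subset t <= s}, uniq t, generates t
    & forall t', {subset t' <= t} -> generates t' -> {subset t <= t'}].
Proof.
elim: {s}_.+1 {-2}s (ltnSn (size s)) => // l IHl s lts us gs.
case: (classic (exists t', [/\ {subset t' <= s}, generates t' & ~ {subset s <= t'}]));
    last first.
  move=> no; exists s; split=> // t' st' gt'.
  by apply: NNPP => h; apply: no; exists t'.
move=> [t' [st' gt' nst]]; have st : {subset undup t' <= s} by move=> q; rewrite mem_undup => /st'.
have sI : {subset s <= ideal} by move=> q qs; apply/gs/generated_by_mem.
have gt : generates (undup t').
  move=> p; split=> [/gt'|].
    apply: generated_by_trans => q qt'; apply: generated_by_mem; rewrite ?undup_uniq //.
    by rewrite mem_undup.
  by apply: generated_by_ideal => q /st/sI.
have ltt : (size (undup t') < size s)%N.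
  rewrite ltnNge; apply/negP=> le; apply: nst => q.
  by have [_ e] := uniq_min_size (undup_uniq t') st le; rewrite -e mem_undup.
have [|t [tt ut gt2 mt]] := IHl (undup t') _ (undup_uniq _) gt.
  exact: leq_trans ltt _.
by exists t; split=> // q /tt/st.
Qed.

Definition quadratic_binomial (x : ('I_n * 'I_n) * ('I_n * 'I_n)) : cycle_ring K M :=
  'X_[U_(x.1.1) + U_(x.1.2)] - 'X_[U_(x.2.1) + U_(x.2.2)].

Definition quadratic_binomials : seq (cycle_ring K M) := undup
  [seq quadratic_binomial x | x <- enum {: ('I_n * 'I_n) * ('I_n * 'I_n)} &
     fibre_exponent (U_(x.1.1) + U_(x.1.2)) == fibre_exponent (U_(x.2.1) + U_(x.2.2))].

Lemma quadratic_binomialsP p : p \in quadratic_binomials -> exists i j k l,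
  fibre_exponent (U_(i) + U_(j)) = fibre_exponent (U_(k) + U_(l)) /\
  p = 'X_[U_(i) + U_(j)] - 'X_[U_(k) + U_(l)].
Proof.
rewrite mem_undup => /mapP[[[i j] [k l]]]; rewrite mem_filter => /andP[/eqP e _] ->.
by exists i, j, k, l.
Qed.

Lemma mem_quadratic_binomials i j k l :
  fibre_exponent (U_(i) + U_(j)) = fibre_exponent (U_(k) + U_(l)) ->
  ('X_[U_(i) + U_(j)] - 'X_[U_(k) + U_(l)] : cycle_ring K M) \in quadratic_binomials.
Proof.
move=> e; rewrite mem_undup; apply/mapP; exists ((i, j), (k, l)) => //.
by rewrite mem_filter mem_enum /= e eqxx.
Qed.

(** A monomial of p cannot be alone in its fibre, where the coefficients add up to 0. Trading it for
    another monomial of p in that fibre shrinks the support. *)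
Lemma binomial_generates (s : seq (cycle_ring K M)) p :
  (forall u v, fibre_exponent u = fibre_exponent v -> generated_by s ('X_[u] - 'X_[v])) ->
  p \in ideal -> generated_by s p.
Proof.
move=> bin; elim: {p}_.+1 {-2}p (ltnSn (size (msupp p))) => // l IHl p ltp pI.
have [->|nzp] := eqVneq p 0; first exact: generated_by0.
have [m mp] : exists m, m \in msupp p.
  by move: nzp; rewrite -msupp_eq0; case: (msupp p) => // m r _; exists m; rewrite inE eqxx.
have [m' [m'p ne em]] : exists m', [/\ m' \in msupp p, m' != m & fibre_exponent m = fibre_exponent m'].
  case: (boolP (has (fun m' => (m' != m) && (fibre_exponent m' == fibre_exponent m)) (msupp p))).
    by case/hasP=> m' m'p /andP[ne /eqP e]; exists m'.
  move=> /hasPn no; have /cycle_idealP/(_ (fibre_exponent m)) := pI.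
  rewrite big_mkcond (bigD1_seq m) ?msupp_uniq //= eqxx big_seq_cond big1.
    by rewrite addr0 => /eqP; rewrite mcoeff_eq0 mp.
  by move=> k /andP[kp nk]; case: eqP => // /eqP ek; have := no k kp; rewrite nk ek.
pose b : cycle_ring K M := 'X_[m] - 'X_[m'].
have eqp : p = (p - (p@_m)%:MP * b) + (p@_m)%:MP * b by rewrite subrK.
have bI : (p@_m)%:MP * b \in ideal by apply/cycle_idealM/binomial_in_ideal.
rewrite eqp; apply: generated_byD; last by apply/generated_byM/bin.
apply: IHl; last first.
  by rewrite -mulNr; apply: cycle_idealD => //; apply/cycle_idealM/binomial_in_ideal.
rewrite -ltnS; apply: leq_trans ltp; rewrite ltnS.
have sub : {subset msupp (p - (p@_m)%:MP * b) <= rem m (msupp p)}.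
  move=> k; rewrite mem_rem_uniq ?msupp_uniq // inE !mcoeff_msupp mcoeffB mul_mpolyC.
  rewrite mcoeffZ mcoeffB !mcoeffX.
  have [->|nk] := eqVneq k m; first by rewrite ?eqxx (negbTE ne) subr0 mulr1 subrr ?eqxx.
  rewrite ?[m == k]eq_sym ?(negbTE nk) sub0r mulrN opprK /=.
  have [<-|nk'] := eqVneq m' k; first by rewrite -[in X in _ -> X]mcoeff_msupp m'p.
  by rewrite mulr0 addr0.
apply: leq_ltn_trans (uniq_leq_size (msupp_uniq _) sub) _.
rewrite size_rem //; case: (msupp p) mp => //.
Qed.

Lemma quadratic_binomials_mu :
  (forall u v, fibre_exponent u = fibre_exponent v ->
     generated_by quadratic_binomials ('X_[u] - 'X_[v])) -> mu_le K M 2.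
Proof.
move=> bin; have uq : uniq quadratic_binomials by apply: undup_uniq.
have gq : generates quadratic_binomials.
  move=> p; split; first exact: binomial_generates.
  apply: generated_by_ideal => q /quadratic_binomialsP[i [j [k [l [e ->]]]]].
  exact: binomial_in_ideal.
have [t [st ut gt mt]] := minimal_generators uq gq.
exists (\max_(p <- t) msize p)%N.
  exists t => //; split=> // p /st/quadratic_binomialsP[i [j [k [l [_ ->]]]]].
  by exists 2; apply: rpredB; rewrite dhomogX /= mdegD !mdeg1.
apply/bigmax_leqP_seq => p /st/quadratic_binomialsP[i [j [k [l [_ ->]]]]] _.
apply: leq_trans (msizeD_le _ _) _; rewrite mmeasureN !mmeasureX /= !mdegD !mdeg1.
by rewrite maxnn.
Qed.

End CycleIdealFibres.

(** * Monomials as tuples of cycles, and the obstruction from K4 *)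

Section Monomials.
Variables (K : fieldType) (T : finType) (M : matroid T).
Hypothesis cs : cycle_space M (cycles M).
Let n := #|cycles M|.
Implicit Types (C D : {set T}) (x : T) (m u v w : 'X_{1..n}).

Let sW : subspace (cycles M). Proof. by case: cs. Qed.
Let W0 : 0 \in cycles M. Proof. exact: subspace0. Qed.

Definition cycle_index C : 'I_n := enum_rank_in W0 C.

Lemma cycle_indexK C : C \in cycles M -> enum_val (cycle_index C) = C.
Proof. by move=> WC; rewrite enum_rankK_in. Qed.

Lemma enum_val_cycleK i : cycle_index (enum_val i) = i.
Proof. exact: enum_valK_in. Qed.

Definition cover_count x m : nat := (\sum_(i < n) m i * (x \in (enum_val i : {set T})))%N.

Lemma cover_countD x u v : cover_count x (u + v)%MM = (cover_count x u + cover_count x v)%N.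
Proof.
rewrite /cover_count -big_split; apply: eq_bigr => i _.
by rewrite mnmDE mulnDl.
Qed.

Lemma cover_countU x i : cover_count x U_(i)%MM = (x \in (enum_val i : {set T})).
Proof.
rewrite /cover_count (bigD1 i) //= mnm1E eqxx mul1n big1 ?addn0 // => j ne.
by rewrite mnm1E eq_sym (negbTE ne).
Qed.

Lemma cover_count0 x : cover_count x 0%MM = 0%N.
Proof. by rewrite /cover_count big1 // => i _; rewrite mnm0E. Qed.

Lemma cover_count_sum x d (s : 'I_d -> 'I_n) :
  cover_count x (\sum_(i < d) U_(s i))%MM = (\sum_(i < d) (x \in (enum_val (s i) : {set T})))%N.
Proof.
rewrite (big_morph (cover_count x) (cover_countD x) (cover_count0 x)).
by apply: eq_bigr => i _; rewrite cover_countU.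
Qed.

Lemma cover_count_out x m : x \notin ground M -> cover_count x m = 0%N.
Proof.
move=> nx; rewrite /cover_count big1 // => i _.
have [_ WE _] := cs; have := WE _ (enum_valP i) => sC.
by rewrite (negbTE (contra (subsetP sC x) nx)) muln0.
Qed.

Lemma fibre_exponentP u v :
  fibre_exponent u = fibre_exponent v <-> mdeg u = mdeg v /\ cover_count^~ u =1 cover_count^~ v.
Proof.
split=> [e|[ed ec]].
  split=> [|x]; first exact: fibre_mdeg e.
  case: (boolP (x \in ground M)) => xE; last by rewrite !cover_count_out.
  have := congr1 (fun m : 'X_{1..#|ground M|.+1} => m (lift ord0 (enum_rank_in xE x))) e.
  by rewrite /= !mnmE liftK enum_rankK_in.
by apply/mnmP=> j; rewrite !mnmE; case: unliftP => [i _|_ //]; apply: ec.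
Qed.

Definition config_monomial d (c : {ffun 'I_d -> {set T}}) : 'X_{1..n} :=
  (\sum_(i < d) U_(cycle_index (c i)))%MM.

Lemma cover_count_config d (c : {ffun 'I_d -> {set T}}) x : inW (cycles M) c ->
  cover_count x (config_monomial c) = colsum c x.
Proof.
move=> Wc; rewrite cover_count_sum; apply: eq_bigr => i _.
by rewrite cycle_indexK.
Qed.

Lemma monomial_seq m : m = (\sum_(i <- m2s m) U_(i))%MM.
Proof.
apply/mnmP=> j; rewrite -[in LHS](s2mK m) mnmE mnm_sumE -sum1_count [LHS]big_mkcond.
by apply: eq_bigr => i _; rewrite mnm1E /=; case: eqP.
Qed.

Lemma mdeg_le2 m : (mdeg m <= 2)%N ->
  [\/ m = 0%MM, exists i, m = U_(i)%MM | exists i j, m = (U_(i) + U_(j))%MM].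
Proof.
rewrite -size_m2s; have := monomial_seq m; case: (m2s m) => [|i [|j [|//]]] e _.
- by apply: Or31; rewrite e big_nil.
- by apply: Or32; exists i; rewrite e big_seq1.
- by apply: Or33; exists i, j; rewrite e !big_cons big_nil addm0.
Qed.

Lemma monomial_config m : exists c : {ffun 'I_(mdeg m) -> {set T}},
  inW (cycles M) c /\ config_monomial c = m.
Proof.
pose i0 := cycle_index 0; exists [ffun i : 'I_(mdeg m) => enum_val (nth i0 (m2s m) i)].
split=> [i|]; first by rewrite ffunE enum_valP.
rewrite [RHS]monomial_seq (big_nth i0) size_m2s big_mkord.
by apply: eq_bigr => i _; rewrite ffunE enum_val_cycleK.
Qed.

Local Notation gens := (quadratic_binomials K M).

(** A move alters two factors, so the difference of the monomials is a quadratic binomial times the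
    product of the others. *)
Lemma mv_generated d (c c' : {ffun 'I_d -> {set T}}) : inW (cycles M) c -> mv (cycles M) c c' ->
  generated_by gens ('X_[config_monomial c] - 'X_[config_monomial c']).
Proof.
move=> Wc mcc; have Wc' := mv_inW sW Wc mcc.
case/mvP: mcc Wc' => i [j [D [WD sD ->]]] Wc'; have [eij|nij] := eqVneq i j.
  rewrite -eij in sD *; suff -> : swap c i i D = c by rewrite subrr; apply: generated_by0.
  by apply/ffunP=> k; rewrite ffunE (swap_id sD) addr0 if_same.
have nji : j != i by rewrite eq_sym.
pose r := (\sum_(k < d | (k != i) && (k != j)) U_(cycle_index (c k)))%MM.
have e1 : config_monomial c = (U_(cycle_index (c i)) + U_(cycle_index (c j)) + r)%MM.
  by rewrite /config_monomial (bigD1 i) //= (bigD1 j nji) /= addmA.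
have e2 : config_monomial (swap c i j D) =
    (U_(cycle_index (c i + D)%R) + U_(cycle_index (c j + D)%R) + r)%MM.
  rewrite /config_monomial (bigD1 i) //= (bigD1 j nji) /= addmA !ffunE !eqxx orbT /=.
  congr (_ + _)%MM; apply: eq_bigr => k /andP[/negbTE ki /negbTE kj].
  by rewrite ffunE ki kj.
rewrite e1 e2 !mpolyXD -mulrBl mulrC -!mpolyXD; apply: generated_byM.
apply: generated_by_mem; first exact: undup_uniq.
apply: mem_quadratic_binomials; apply/fibre_exponentP; split=> [|x].
  by rewrite !mdegD !mdeg1.
have Wci := Wc i; have Wcj := Wc j.
rewrite /= !cover_countD !cover_countU !cycle_indexK ?subspaceD // !in_add.
case: (boolP (x \in D)) => xD; last by rewrite !addbF.
have := subsetP sD x xD; rewrite in_add.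
by case: (x \in c i); case: (x \in c j).
Qed.

Lemma quadratic_mu_le : quadratic (cycles M) -> mu_le K M 2.
Proof.
move=> qW; apply: quadratic_binomials_mu => u v /fibre_exponentP[ed ec].
have [c [Wc ecu]] := monomial_config u; have [c' [Wc' ecv]] := monomial_config v.
rewrite -ed in c' Wc' ecv.
have con : connect (@mv _ (cycles M) _) c c'.
  apply: qW => // x; rewrite -!cover_count_config // ecu ecv; exact: ec.
pose P (a : {ffun 'I_(mdeg u) -> {set T}}) := inW (cycles M) a /\
  generated_by gens ('X_[config_monomial c] - 'X_[config_monomial a]).
have step a b : P a -> mv (cycles M) a b -> P b.
  move=> [Wa ha] mab; split; first exact: mv_inW mab.
  have := generated_byD ha (mv_generated Wa mab).
  by rewrite addrA subrK.
have [|_] := connect_invariant step con; last by rewrite ecu ecv.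
by split=> //; rewrite subrr; apply: generated_by0.
Qed.

Lemma k4minor_mu : regular (cycles M) -> k4minor (cycles M) -> ~ mu_le K M 2.
Proof.
move=> rW kW mu2; have [_ WE _] := cs.
have [X0 [g [sX0 km0]]] := k4minor_model WE kW.
have [X [sX km tX]] := tight_model sW sX0 km0.
pose L A := k4lift (cycles M) X g A.
have WT i : tri o0 + tri i \in W4 by rewrite subspaceD ?W4_subspace ?tri_W4.
have LW A (WA : A \in W4) : L A \in cycles M by case: (k4liftP km WA).
have LX A (WA : A \in W4) : L A \subset X :|: g @: E4 by case: (k4liftP km WA).
have Lg A (WA : A \in W4) e : e \in E4 -> (g e \in L A) = (e \in A).
  by move=> eE; case: (k4liftP km WA) => _ _ ->.
have L_inj A B : A \in W4 -> B \in W4 -> L A = L B -> A = B.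
  move=> WA WB eL; have sA := W4S WA; have sB := W4S WB; apply/setP=> e.
  case: (boolP (e \in E4)) => eE; first by rewrite -(Lg A WA e eE) eL Lg.
  have out (C : {set {set 'I_4}}) : C \subset E4 -> e \in C = false.
    by move=> sC; apply: contraNF eE; apply: (subsetP sC).
  by rewrite !out.
(* Every edge of K4 lies in two of the T_0 + T_i and in two of the T_i. *)
pose u := (\sum_(i < 4) U_(cycle_index (L (tri o0 + tri i)%R)))%MM.
pose v := (\sum_(i < 4) U_(cycle_index (L (tri i))))%MM.
have cu x : cover_count x u = (\sum_(i < 4) (x \in L (tri o0 + tri i)%R))%N.
  by rewrite cover_count_sum; apply: eq_bigr => i _; rewrite cycle_indexK ?LW ?WT.
have cv x : cover_count x v = (\sum_(i < 4) (x \in L (tri i)))%N.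
  by rewrite cover_count_sum; apply: eq_bigr => i _; rewrite cycle_indexK ?LW ?tri_W4.
have cg e : e \in E4 -> cover_count (g e) u = cover_count (g e) v.
  move=> eE; rewrite cu cv (eq_bigr (fun i => (e \in tri o0 + tri i) : nat)) => [|i _].
    rewrite -sum_tri; apply: eq_bigr => i _; by rewrite Lg ?tri_W4.
  by rewrite Lg ?WT.
have euv : fibre_exponent u = fibre_exponent v.
  apply/fibre_exponentP; split=> [|x /=].
    by rewrite /u /v !mdeg_sum; apply: eq_bigr => i _; rewrite !mdeg1.
  (* An element of X lies in no lift or follows an edge of K4, so its column sum is 0 on both sides
     or that of the edge. *)
  have [xX|nX] := boolP (x \in X).
    case: (tight_series sW km tX rW xX) => [h|[_ /imsetP[e eE ->] h]].
      by rewrite cu cv !big1 // => i _; apply/eqP; rewrite eqb0 h ?LW ?LX ?WT ?tri_W4.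
    rewrite cu cv; under eq_bigr do rewrite h ?LW ?LX ?WT //.
    under [RHS]eq_bigr do rewrite h ?LW ?LX ?tri_W4 //.
    by rewrite -cu -cv cg.
  have [/imsetP[e eE ->]|nS] := boolP (x \in g @: E4); first exact: cg.
  have out A : A \in W4 -> x \in L A = false.
    move=> WA; apply/negbTE/negP=> /(subsetP (LX _ WA)).
    by rewrite in_setU (negbTE nX) (negbTE nS).
  by rewrite cu cv !big1 // => i _; rewrite out ?WT ?tri_W4.
(* The variable of T_0 divides v but not u, since T_0 + T_i = T_0 would make T_i empty. *)
suff /mnmP/(_ (cycle_index (L (tri o0)))) : u = v.
  rewrite !mnm_sumE [RHS](bigD1 o0) //= mnm1E eqxx big1 // => i _.
  rewrite mnm1E; apply/eqP; rewrite eqb0; apply/eqP=> /(congr1 enum_val).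
  rewrite !cycle_indexK ?LW ?WT ?tri_W4 // => /(L_inj _ _ (WT i) (tri_W4 o0)).
  move/(congr1 (fun A => tri o0 + A)); rewrite addKS addSS => t0.
  have [e eT] : exists e, e \in tri i.
    by elim/ord4_ind: i {t0}; [exists [set o1; o2]|exists [set o0; o2]|exists [set o0; o1]|
      exists [set o0; o1]]; rewrite triE.
  by rewrite t0 in_zero in eT.
have supp_u k w : (w <= u)%MM -> (0 < w k)%N -> exists2 A, A \in W4 & enum_val k = L A.
  move=> /mnm_lepP/(_ k) le wk; have : (u k != 0)%N by rewrite -lt0n; apply: leq_trans wk le.
  rewrite mnm_sumE sum_nat_eq0 => /forallPn[i]; rewrite /= mnm1E eqb0 negbK => /eqP <-.
  by exists (tri o0 + tri i); rewrite ?cycle_indexK ?LW ?WT.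
apply: mu_le2_isolated mu2 _ euv => w w' wu d2 /fibre_exponentP[ed ec].
case: (mdeg_le2 d2) => [w0|[i ew]|[i [j ew]]].
- move: ed; rewrite w0 mdeg0 => /esym/eqP; by rewrite mdeg_eq0 => /eqP->.
- move: ed; rewrite ew mdeg1 => /esym/eqP/mdeg1P[k /eqP ew']; rewrite ew'.
  congr U_(_)%MM; apply: enum_val_inj; apply/setP=> x.
  by have := ec x; rewrite /= ew ew' !cover_countU; do 2 case: (_ \in _).
have d2' : mdeg w' = 2 by rewrite -ed ew mdegD !mdeg1.
have [k [l ew']] : exists k l, w' = (U_(k) + U_(l))%MM.
  have := @mdeg_le2 w'; rewrite d2' => /(_ isT)[w0|[k e1]|//].
    by move: d2'; rewrite w0 mdeg0.
  by move: d2'; rewrite e1 mdeg1.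
have [A WA eA] : exists2 A, A \in W4 & enum_val i = L A.
  by apply: (supp_u i w) => //; rewrite ew mnmDE mnm1E eqxx.
have [B WB eB] : exists2 B, B \in W4 & enum_val j = L B.
  by apply: (supp_u j w) => //; rewrite ew mnmDE !mnm1E eqxx addn1.
have cnt x : ((x \in (enum_val i : {set T})) + (x \in (enum_val j : {set T})) =
    (x \in (enum_val k : {set T})) + (x \in (enum_val l : {set T})))%N.
  by have := ec x; rewrite /= ew ew' !cover_countD !cover_countU.
have [C WC eC] : exists2 C, C \in W4 & enum_val k = L C.
  apply: (k4lift_exists sW km tX); first exact: enum_valP.
  apply/subsetP=> x xk; have := cnt x; rewrite xk eA eB.
  case: (boolP (x \in L A)) => [/(subsetP (LX _ WA))//|_].
  by case: (boolP (x \in L B)) => [/(subsetP (LX _ WB))//|_].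
have cancel_ p q : enum_val p = enum_val k :> {set T} ->
    (forall x, ((x \in (enum_val p : {set T})) + (x \in (enum_val q : {set T})) =
      (x \in (enum_val k : {set T})) + (x \in (enum_val l : {set T})))%N) ->
    p = k /\ q = l.
  move=> ep hpq; split; first exact: enum_val_inj.
  apply: enum_val_inj; apply/setP=> x; have := hpq x; rewrite ep => /eqP.
  by rewrite eqn_add2l; do 2 case: (_ \in _).
rewrite ew ew'; have WAC := subspaceD W4_subspace WA WC.
have WBC := subspaceD W4_subspace WB WC.
(* A common edge would lie in both A and B but not in C, or in C but in neither of them; both
   contradict the equal counts. As K4 has no two disjoint nonzero cycles, C is A or B. *)
have dj : [disjoint A + C & B + C].
  rewrite disjoints_subset; apply/subsetP=> e eAC.
  have eE := subsetP (W4S WAC) e eAC; have := cnt (g e).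
  rewrite eA eB eC !Lg // inE in_add; move: eAC; rewrite in_add.
  by case: (e \in A); case: (e \in B); case: (e \in C); case: (_ \in enum_val l).
case: (W4_disjoint WAC WBC dj) => /eqP; rewrite addS_eq0 => /eqP eAC.
  by have [|-> ->] := cancel_ i j _ cnt; rewrite // eA eC eAC.
have [||-> ->] := cancel_ j i; [by rewrite eB eC eAC| |by rewrite addmC].
by move=> x; rewrite addnC cnt.
Qed.

End Monomials.

Theorem theorem7p4 (K : fieldType) (G : sgraph) (M : matroid {set G}) :
  connected G ->
  M = cycle_matroid G \/ M = dual (cycle_matroid G) ->
  nonfree M ->
  [<-> mu_le K M 2;
       ~ (exists2 N, g_series_minor M N & isomorphic N MK4);
       ~ (exists2 N, series_minor M N & isomorphic N MK4);
       ~ (exists2 N, minor M N & isomorphic N MK4)].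
Proof.
move=> _ defM _; have [cs rW] : cycle_space M (cycles M) /\ regular (cycles M).
  have csG := cycle_space_even_sets G; case: defM => ->.
    by rewrite (cycles_cycle_space csG); split=> //; apply: regular_even_sets.
  have csD := cycle_space_dual csG; rewrite (cycles_cycle_space csD).
  by split=> //; apply: regular_cuts.
have [sW WE _] := cs; tfae.
- move=> mu2 [N mMN iso]; apply: k4minor_mu mu2 => //.
  exact: g_series_minor_k4minor mMN iso cs.
- move=> noG [N mMN iso]; apply: noG; exists N => //; exact: series_minor_g_series.
- move=> noS [N mMN iso]; apply: noS.
  exact: k4minor_series_minor cs rW (minor_k4minor mMN iso cs).
- move=> noM; apply: quadratic_mu_le => //; apply: (quadratic_no_k4minor sW WE) => kW.
  exact: noM (k4minor_minor cs kW).
Qed.
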